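(* Let $C_0\ge1$, $C_1>0$, $s>1/2$. There exists a constant $C_{C_0,C_1,s}$, depending only on $(C_0,C_1,s)$, such that, for every integer $N\geq2$, every real $\alpha>0$ and every $h\in\{1,\dots,N-1\}$, under the privatization mechanism $K_{1:N}^{\mathrm{Lap},\alpha}$, the estimator $\widetilde\gamma(h)$ satisfies $$\sup_{f\in\mathcal F(C_0,C_1,s)}\mathbb E_{f,K_{1:N}^{\mathrm{Lap},\alpha}}\left[|\widetilde\gamma(h)-\gamma_f(h)|^2\right]\ \leq\ C_{C_0,C_1,s}\left(1\wedge\left[(\alpha^4\wedge1)(N-h)\right]^{-1}\right).$$
   Context: Notation: $u\wedge v=\min\{u,v\}$, $u\vee v=\max\{u,v\}$; $[N]=\{1,\dots,N\}$; $\Phi$ is the standard Gaussian distribution function. A spectral density is a nonnegative, integrable, even function $f$ on $[-\pi,\pi]$; $\gamma_f(h)=\int_{-\pi}^{\pi}f(\lambda)e^{ih\lambda}\,d\lambda$, $h\in\mathbb Z$, and $\rho_f(h)=\gamma_f(h)/\gamma_f(0)$ when $\gamma_f(0)>0$. $\mathcal F(C_0,C_1,s)$ is the set of spectral densities $f$ with $\gamma_f(0)\in[C_0^{-1},C_0]$ and $\sum_{h\in\mathbb Z\setminus\{0\}}|h|^{2s}|\rho_f(h)|^2\le C_1^2$. $X=(X_t)_{t\in\mathbb Z}$ is a centered real stationary Gaussian process with spectral density $f$, i.e. $\operatorname{Cov}(X_0,X_h)=\gamma_f(h)$. Mechanism $K_{1:N}^{\mathrm{Lap},\alpha}$: for $i\in[N]$,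 $Z_i=(Z_{i,1},Z_{i,2})$ with $Z_{i,1}=\mathbf 1_{\{|X_i|>C_0\}}+\frac3\alpha W_{i,1}$ and $Z_{i,2}=\operatorname{sgn}(X_i)+\frac3\alpha W_{i,2}$, where the $W_{i,j}$ are i.i.d. centered standard Laplace random variables (density $\frac12e^{-|w|}$), independent of $X$. $\mathbb E_{f,K_{1:N}^{\mathrm{Lap},\alpha}}$ is expectation under the resulting joint law of $(X,Z)$. Variance estimator: with $I_{C_0}=[2(1-\Phi(C_0^{3/2})),\,2(1-\Phi(C_0^{1/2}))]$ and $\Pi_{[a,b]}(x)=(x\wedge b)\vee a$, set $\hat p_f=\Pi_{I_{C_0}}\big(\frac1N\sum_{i=1}^NZ_{i,1}\big)$ and $\hat\gamma(0)=\big(C_0/\Phi^{-1}(1-\hat p_f/2)\big)^2$. Autocovariance estimator: $\widetilde\gamma(h)=\hat\gamma(0)\,\sin\big(\frac{\pi}{2(N-h)}\sum_{j=1}^{N-h}Z_{j,2}Z_{j+h,2}\big)$. *)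

(* Defs.v *)
From HB Require Import structures.
From mathcomp Require Import all_boot all_order all_algebra finmap.
From mathcomp Require Import all_classical all_reals all_analysis.
From mathcomp Require Import measurable_realfun complex.
Set Implicit Arguments.
Unset Strict Implicit.
Unset Printing Implicit Defensive.
Import Order.TTheory GRing.Theory Num.Theory.
Import numFieldNormedType.Exports.
Local Open Scope classical_set_scope.
Local Open Scope ring_scope.

Section SpectralDensity.
Context {R : realType}.
Implicit Types (f : R -> R) (h : int).
Local Notation mu := (@lebesgue_measure R).

(* Only the values of [f] on [-pi, pi] are constrained, and only these are used. *)
Record spectral_density f : Prop := SpectralDensity {
  spectral_ge0 : forall x, x \in `[- pi, pi] -> 0 <= f x;
  spectral_integrable : mu.-integrable `[- pi, pi] (EFin \o f);
  spectral_even : forall x, x \in `[- pi, pi] -> f (- x) = f x }.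

(* The integral of [f x * exp (i * h * x)] over [-pi, pi], taken separately on
   the real and imaginary parts. *)
Definition fourier_coef f h : R[i] :=
  complex.Complex (\int[mu]_(x in `[- pi, pi]) (f x * cos (h%:~R * x)))
                  (\int[mu]_(x in `[- pi, pi]) (f x * sin (h%:~R * x))).

(* For a spectral density the Fourier coefficient is real, see
   [fourier_coef_real] below. *)
Definition autocov f h : R := complex.Re (fourier_coef f h).

Definition autocorr f h : R := autocov f h / autocov f 0.

Lemma fourier_coef_real f h : spectral_density f ->
  fourier_coef f h = (autocov f h)%:C%C.
Proof.
move=> [_ fint fev]; rewrite /fourier_coef /autocov/=.
congr complex.Complex.
pose D : set R := `[- pi, pi]%classic.
pose g : R -> \bar R := fun x => (f x * sin (h%:~R * x))%:E.
have mD : measurable D by exact: measurable_itv.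
have mg : measurable_fun D g.
  apply/measurable_EFinP; apply: measurable_funM.
    by apply/measurable_EFinP; exact: measurable_int fint.
  apply: (measurableT_comp (f := @sin R)); last exact: mulrl_measurable.
  by apply: continuous_measurable_fun; exact: continuous_sin.
have opD : (-%R : R -> measurableTypeR R) @^-1` D = D.
  by rewrite /D opp_preimage_itvbndbnd/= opprK.
have gN x : D x -> g (- x) = (- g x)%E.
  by rewrite /g => Dx; rewrite fev// mulrN sinN mulrN.
suff E : (\int[mu]_(x in D) g^\+ x = \int[mu]_(x in D) g^\- x)%E.
  rewrite /Rintegral integralE E.
  by case: (\int[mu]_(x in D) g^\- x)%E => //= r; rewrite subrr.
transitivity (\int[pushforward mu (-%R : _ -> measurableTypeR R)]_(x in D)
                 g^\+ x)%E.
  by apply: eq_measure_integral => A mA _; exact/esym/lebesgue_measureN.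
rewrite ge0_integral_pushforward//=; last exact: measurable_funepos.
rewrite opD; apply: eq_integral => x; rewrite inE => Dx /=.
by rewrite funeposE funenegE gN.
Qed.

Definition smoothness_class (C0 C1 s : R) f : Prop :=
  [/\ spectral_density f,
      autocov f 0 \in `[C0^-1, C0] &
      (\esum_(h in [set h : int | h != 0%R])
         ((`|h|%N%:R `^ (2 * s)) * `|autocorr f h| ^+ 2)%:E
       <= (C1 ^+ 2)%:E)%E].

End SpectralDensity.

Section Probability.
Context d (T : measurableType d) {R : realType} (P : probability T R).

(* Possibly degenerate Gaussian law with mean [m] and standard deviation [sigma]:
   the library's [normal_prob m 0] is not the point mass at [m]. *)
Definition gaussian_law (Y : T -> R) : Prop :=
  exists m sigma : R, forall A : set R, measurable A ->
    P (Y @^-1` A) = if sigma == 0 then \d_m A else normal_prob m sigma A.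

Definition gaussian_process (X : int -> {RV P >-> R}) : Prop :=
  forall (n : nat) (t : 'I_n -> int) (a : 'I_n -> R),
    gaussian_law (fun w => \sum_(k < n) a k * X (t k) w).

(* Stationarity is the dependence of the covariance of [X t] and [X (t + h)]
   on [h] alone; for centered Gaussian processes this is equivalent to shift
   invariance of the law. *)
Record stationary_gaussian (f : R -> R) (X : int -> {RV P >-> R}) : Prop :=
  StationaryGaussian {
    process_gaussian : gaussian_process X;
    process_centered : forall t, ('E_P[X t] = 0)%E;
    process_autocov : forall t h, covariance P (X t) (X (t + h)) = (autocov f h)%:E }.

Definition laplace_pdf (x : R) : R := 2^-1 * expR (- `|x|).

Definition laplace_law (Y : T -> R) : Prop :=
  forall A : set R, measurable A ->
    P (Y @^-1` A) = (\int[lebesgue_measure]_(x in A) (laplace_pdf x)%:E)%E.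

Definition mutually_independent (I : choiceType) (D : set I)
    (Y : I -> {RV P >-> R}) : Prop :=
  forall (J : {fset I}) (B : I -> set R), [set` J] `<=` D ->
    (forall i, measurable (B i)) ->
    P (\bigcap_(i in [set` J]) (Y i @^-1` B i))
    = (\prod_(i <- J) P (Y i @^-1` B i))%E.

Definition generated_sigma (I : Type) (D : set I) (Y : I -> {RV P >-> R}) :
    set (set T) :=
  <<s \bigcup_(i in D) preimage_set_system setT (Y i) measurable >>.

Definition independent_systems (F G : set (set T)) : Prop :=
  forall A B, F A -> G B -> P (A `&` B) = (P A * P B)%E.

(* [W (i, j)] is only constrained for [i] in {1, ..., N} and [j] in {1, 2}. *)
Definition noise_index (N : nat) : set (nat * nat) :=
  [set ij | (1 <= ij.1 <= N)%N && (1 <= ij.2 <= 2)%N].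

Record laplace_noise (N : nat) (X : int -> {RV P >-> R})
    (W : nat * nat -> {RV P >-> R}) : Prop := LaplaceNoise {
  noise_law : forall ij, noise_index N ij -> laplace_law (W ij);
  noise_indep : mutually_independent (noise_index N) W;
  noise_indep_process :
    independent_systems (generated_sigma setT X)
                        (generated_sigma (noise_index N) W) }.

End Probability.

Section Estimator.
Context {R : realType}.

Definition privatize (C0 alpha x w1 w2 : R) : R * R :=
  ((C0 < `|x|)%R%:R + 3 / alpha * w1, Num.sg x + 3 / alpha * w2).

Definition released d (T : measurableType d) (P : probability T R)
    (C0 alpha : R) (X : int -> {RV P >-> R}) (W : nat * nat -> {RV P >-> R})
    (w : T) (i : nat) : R * R :=
  privatize C0 alpha (X i%:Z w) (W (i, 1%N) w) (W (i, 2%N) w).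

Definition Phi (x : R) : R := fine (normal_prob 0 1 `]-oo, x]).

(* The inverse of the bijection [Phi] from [R] onto ]0, 1[, set to 0 outside
   of ]0, 1[. *)
Definition Phi_inv (p : R) : R := xget 0 [set x | Phi x = p].

Definition clamp (a b x : R) : R := Num.max (Num.min x b) a.

(* Estimators are functions of the released sample [z 1, ..., z N]. *)
Definition p_hat (C0 : R) (N : nat) (z : nat -> R * R) : R :=
  clamp (2 * (1 - Phi (C0 `^ (3 / 2)))) (2 * (1 - Phi (C0 `^ (1 / 2))))
        (N%:R^-1 * \sum_(1 <= i < N.+1) (z i).1).

Definition var_hat (C0 : R) (N : nat) (z : nat -> R * R) : R :=
  (C0 / Phi_inv (1 - p_hat C0 N z / 2)) ^+ 2.

Definition autocov_tilde (C0 : R) (N h : nat) (z : nat -> R * R) : R :=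
  var_hat C0 N z *
  sin (pi / (2 * (N - h)%:R)
       * \sum_(1 <= j < (N - h).+1) (z j).2 * (z (j + h)%N).2).

End Estimator.

(* Main.v *)
Require Import Defs.
From mathcomp Require Import all_boot all_order all_algebra finmap.
From mathcomp Require Import all_classical all_reals all_analysis.
From mathcomp Require Import measurable_realfun ring lra.
Import Order.TTheory GRing.Theory Num.Theory.
Import numFieldNormedType.Exports.
Local Open Scope classical_set_scope.
Local Open Scope ring_scope.
Set Implicit Arguments.
Unset Strict Implicit.
Unset Printing Implicit Defensive.

(* Since 1 - rho(h)^2 is bounded below in terms of C_1 alone, both released
   averages have variance at most of order 1 / (alpha^4 /\ 1) / (N - h): their
   noise terms are orthogonal, and their signal terms decorrelate like rho^2,
   which is summable over the class.  Sheppard's formula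
   sin (pi / 2 * E[sgn X_0 sgn X_h]) = rho(h) and the Lipschitz continuity of the
   sine and of the inverse of sigma |-> P(|X_0| > C_0) transfer these bounds to
   the estimator.

   The joint law of the X_t enters only through E[cos Y] = exp(- Var(Y) / 2) for
   linear combinations Y.  On cosine polynomials this gives the decorrelation
   inequality |Cov(F(U), G(V))| <= 2 (n max |Cov(U_i, V_j)|)^2 for normalized
   Gaussian vectors U, V of size n, as only the terms of order at least 2 of the
   power series of cosh occur.  Signs and indicators are bounded iterated limits
   of trigonometric polynomials, so the inequality passes to them. *)

(** The square on the correlation comes from evenness: products of two signs and indicators of |X| >
    C0 are even, hence approximated by cosines, whose covariances involve cosh - 1, free of a linear
    term. The inequality wants standardized vectors, so the pair (X_j, X_(j+h)) has to be whitened,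
    at the price of dividing by 1 - rho(h)^2; this is where the gap enters. The gap itself comes
    from the geometry of L^2: a correlation near 1 or -1 at lag h persists at many multiples of h,
    and the squares then exceed the budget C_1^2. The inequality is for functions bounded by 1, so
    the approximants must stay in [-1, 1], where truncated Fourier series of a sign overshoot;
    iterating a polynomial that maps [-1, 1] into itself keeps the bound. Sheppard's formula is
    obtained without the bivariate density: the probability that two rotated variables have
    different signs is additive in the angle. It also yields the shift invariance of
    E[sgn X_t sgn X_(t+h)] from that of the covariances. *)

Import HBNNSimple.

(** * Moments of the normal law *)

Section Density.
Local Open Scope ereal_scope.
Context {d} {T : measurableType d} {R : realType}.
Variables (mu nu : {measure set T -> \bar R}) (p : T -> R).
Hypotheses (p0 : forall x, (0 <= p x)%R) (mp : measurable_fun setT p).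
Hypothesis nup : forall A, measurable A -> nu A = \int[mu]_(x in A) (p x)%:E.

(** By monotone convergence both sides are limits along the same increasing simple functions, and on
    each level set the identity is [nup]. *)
Lemma ge0_integral_density (f : T -> \bar R) : measurable_fun setT f ->
  (forall x, 0 <= f x) -> \int[nu]_x f x = \int[mu]_x (f x * (p x)%:E).
Proof.
move=> mf f0; pose h := nnsfun_approx measurableT mf.
have fE x : EFin (h n x) @[n --> \oo] --> f x.
  by apply: (@cvg_nnsfun_approx _ _ _ setT measurableT f mf).
have ndh x a b : (a <= b)%N -> (h a x <= h b x)%R.
  by move=> ab; have /lefP := nd_nnsfun_approx measurableT mf ab.
have mpE : measurable_fun setT (EFin \o p) by exact/measurable_EFinP.
have -> : \int[nu]_x f x = limn (fun n => \int[nu]_x (h n x)%:E).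
  rewrite -monotone_convergence//.
  - by apply: eq_integral => x _; apply/esym/cvg_lim => //; exact: fE.
  - by move=> n; apply/measurable_EFinP.
  - by move=> n x _; rewrite lee_fin.
  - by move=> x _ a b ab; rewrite lee_fin ndh.
have -> : \int[mu]_x (f x * (p x)%:E) =
    limn (fun n => \int[mu]_x ((h n x)%:E * (p x)%:E)).
  rewrite -monotone_convergence//.
  - apply: eq_integral => x _; apply/esym/cvg_lim => //.
    by apply: cvgeZr => //; exact: fE.
  - by move=> n; apply: emeasurable_funM => //; exact/measurable_EFinP.
  - by move=> n x _; rewrite mule_ge0 ?lee_fin.
  - by move=> x _ a b ab; rewrite lee_wpmul2r ?lee_fin ?ndh.
congr (limn _); apply/funext => n.
transitivity (\sum_(y \in range (h n)) y%:E * nu (h n @^-1` [set y])).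
  rewrite -sintegralE integral_nnsfun//; congr sintegral.
  by apply/funext => x; rewrite patchT ?inE.
transitivity (\int[mu]_x (\sum_(y \in range (h n))
    ((y * \1_(h n @^-1` [set y]) x)%:E * (p x)%:E))); last first.
  apply: eq_integral => x _.
  rewrite -ge0_mule_fsuml => [|y]; last exact: nnfun_muleindic_ge0.
  by rewrite fsumEFin // -(fimfunE _ x).
rewrite ge0_integral_fsum//; last 2 first.
  - by move=> y; apply: emeasurable_funM => //; apply/measurable_EFinP;
      exact: measurable_funM.
  - move=> m y Ey; rewrite mule_ge0 ?lee_fin//.
    by have := nnfun_muleindic_ge0 (h n) m y; rewrite -EFinM lee_fin.
apply: eq_fsbigr => r rhn.
have r0 : (0 <= r)%R by move: rhn; rewrite inE => -[t _ <-].
under eq_integral do rewrite EFinM -muleA.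
rewrite ge0_integralZl//.
- rewrite nup//; congr (_ * _).
  under [RHS]eq_integral do rewrite muleC.
  rewrite [RHS](eq_integral ((EFin \o p) \_ (h n @^-1` [set r]))); last first.
    by move=> x xE; rewrite epatch_indic.
  by rewrite -integral_mkcond.
- by apply: emeasurable_funM => //; apply/measurable_EFinP.
- by move=> t Et; rewrite mule_ge0 ?lee_fin.
Qed.

Local Close Scope ereal_scope.

Lemma integrable_density (f : T -> R) : measurable_fun setT f ->
  mu.-integrable setT (EFin \o (fun x => f x * p x)) ->
  nu.-integrable setT (EFin \o f).
Proof.
move=> mf /integrableP[_ fp]; apply/integrableP; split.
  exact/measurable_EFinP.
rewrite ge0_integral_density//.
  apply: le_lt_trans fp; rewrite le_eqVlt; apply/orP; left; apply/eqP.
  by apply: eq_integral => x _ /=; rewrite normrM (ger0_norm (p0 x)) EFinM.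
by apply/measurable_EFinP; exact: measurableT_comp.
Qed.

(** Multiplication by the nonnegative [p] commutes with taking positive and negative parts. *)
Lemma Rintegral_density (f : T -> R) : measurable_fun setT f ->
  mu.-integrable setT (EFin \o (fun x => f x * p x)) ->
  \int[nu]_x f x = \int[mu]_x (f x * p x).
Proof.
move=> mf fp; have fE := integrable_density mf fp.
rewrite /Rintegral; congr fine; rewrite integralE [RHS]integralE.
congr (_ - _)%E; rewrite ge0_integral_density//.
- apply: eq_integral => x _.
  rewrite !funeposE -!EFin_max -EFinM; congr EFin.
  have [fx|fx] := leP 0 (f x); first by rewrite !max_l// mulr_ge0.
  by rewrite !max_r ?mul0r// ?mulr_le0_ge0// ltW.
- by apply: measurable_funepos; exact/measurable_EFinP.
- apply: eq_integral => x _.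
  rewrite !funenegE -!EFinN -!EFin_max -EFinM -mulNr; congr EFin.
  have [fx|fx] := leP 0 (- f x); first by rewrite !max_l// mulr_ge0.
  by rewrite !max_r ?mul0r// ?mulr_le0_ge0// ltW.
- by apply: measurable_funeneg; exact/measurable_EFinP.
Qed.
End Density.

Section LawDensity.
Context {d} {T : measurableType d} {R : realType} (P : probability T R).
Variable Y : T -> R.
Hypothesis mY : measurable_fun setT Y.
Local Notation mu := (@lebesgue_measure R).
Let nu : {measure set (measurableTypeR R) -> \bar R} :=
  measure_function_pushforward__canonical__measure_function_Measure P
    (mY : measurable_fun setT (Y : T -> measurableTypeR R)).
Variable p : R -> R.
Hypotheses (p0 : forall x, 0 <= p x) (mp : measurable_fun setT p).
Hypothesis Yp : forall A, measurable A ->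
  P (Y @^-1` A) = (\int[mu]_(x in A) (p x)%:E)%E.

Lemma law_integrable (f : R -> R) : measurable_fun setT f ->
  mu.-integrable setT (EFin \o (fun x => f x * p x)) ->
  P.-integrable setT (EFin \o (f \o Y)).
Proof.
move=> mf fp.
have fnu := @integrable_density _ _ _ mu nu p p0 mp Yp f mf fp.
apply/integrableP; split.
  by apply/measurable_EFinP; exact: measurableT_comp.
have /integrableP[_] := fnu; rewrite ge0_integral_pushforward//.
exact: (measurable_int nu (integrable_abse fnu)).
Qed.

Lemma law_Rintegral (f : R -> R) : measurable_fun setT f ->
  mu.-integrable setT (EFin \o (fun x => f x * p x)) ->
  \int[P]_w f (Y w) = \int[mu]_x (f x * p x).
Proof.
move=> mf fp.
rewrite -(@Rintegral_density _ _ _ mu nu p p0 mp Yp f mf fp).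
rewrite /Rintegral integral_pushforward//.
- exact/measurable_EFinP.
- exact: law_integrable.
Qed.

End LawDensity.

Section IntegralDerivative.
Context {R : realType}.
Local Notation mu := (@lebesgue_measure R).

(** On the window of radius n + 1 around m the boundary values of F are at most K / (n + 1), so the
    integral over the window tends to 0; dominated convergence identifies its limit with the
    integral over the line. *)
Lemma Rintegral_derivative_eq0 (f F : R -> R) (m K : R) :
  (forall x : R, is_derive x 1 F (f x)) -> continuous f ->
  mu.-integrable setT (EFin \o f) ->
  (forall x, `|F x| * `|x - m| <= K) -> \int[mu]_x f x = 0.
Proof.
move=> dF cf intf FK.
pose a n : R := m - n.+1%:R; pose b n : R := m + n.+1%:R.
pose f_ n : R -> \bar R := (EFin \o f) \_ `[a n, b n].
have mf : measurable_fun setT (EFin \o f) by exact: (measurable_int mu intf).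
have cvgf : (\int[mu]_x f_ n x)%E @[n --> \oo] --> (\int[mu]_x (f x)%:E)%E.
  apply: (@dominated_cvg _ _ _ mu setT measurableT f_ _ (abse \o (EFin \o f))).
  - by move=> n; apply/(measurable_restrictT _ _).1 => //; exact: measurable_funTS.
  - move=> x _; apply: cvg_near_cst; near=> n.
    rewrite /f_ patchE mem_set//= in_itv/= -ler_distl.
    rewrite (@le_trans _ _ n%:R) ?ler_nat//.
    near: n; exact: nbhs_infty_ger.
  - by move=> x _.
  - exact: integrable_abse.
  - move=> n x _; rewrite /f_ patchE; case: ifPn => //= _.
    by rewrite normr0 lee_fin.
have fE n : (\int[mu]_x f_ n x)%E = (F (b n) - F (a n))%:E.
  have abn : a n < b n.
    by rewrite /a /b ltrD2l (@lt_trans _ _ 0)// oppr_lt0.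
  rewrite /f_ -integral_mkcond (@continuous_FTC2 _ f F)//.
  - exact: continuous_subspaceT.
  - have cF : continuous F.
      move=> x; apply/differentiable_continuous/derivable1_diffP.
      by have [] := dF x.
    split.
    + by move=> x _; have [] := dF x.
    + by apply: cvg_at_right_filter; exact: cF.
    + by apply: cvg_at_left_filter; exact: cF.
  - by move=> x _; rewrite derive1E; have [] := dF x.
have cvg0 : (\int[mu]_x f_ n x)%E @[n --> \oo] --> 0%:E.
  under eq_fun do rewrite fE.
  apply: cvg_EFin; first exact: nearW.
  apply: (@squeeze_cvgr _ _ _ _ (fun n => - (K *+ 2 * n.+1%:R^-1)) (fun n => K *+ 2 * n.+1%:R^-1)).
  - near=> n => /=; rewrite -ler_norml (le_trans (ler_normB _ _))//.
    rewrite mulrnAl mulr2n; apply: lerD; rewrite ler_pdivlMr//.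
      apply: le_trans (FK (b n)); rewrite ler_wpM2l//.
      by rewrite /b [m + _]addrC addrK ger0_norm.
    apply: le_trans (FK (a n)); rewrite ler_wpM2l//.
    by rewrite /a addrAC subrr add0r normrN ger0_norm.
  - rewrite -oppr0; apply: cvgN; rewrite -[X in _ --> X](mulr0 (K *+ 2)).
    by apply: cvgM; [exact: cvg_cst|exact: cvg_harmonic].
  - rewrite -[X in _ --> X](mulr0 (K *+ 2)).
    by apply: cvgM; [exact: cvg_cst|exact: cvg_harmonic].
by rewrite /Rintegral (cvg_unique _ cvgf cvg0).
Unshelve. all: by end_near. Qed.

End IntegralDerivative.

Section NormalMoments.
Context {R : realType}.
Local Notation mu := (@lebesgue_measure R).
Variables m s : R.
Hypothesis s0 : s != 0.
Local Notation p := (normal_pdf m s).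

Let s2_gt0 : 0 < s ^+ 2. Proof. by rewrite exprn_even_gt0. Qed.

Lemma is_derive_normal_pdf (x : R) :
  is_derive x 1 p (- ((x - m) / s ^+ 2) * p x).
Proof.
rewrite normal_pdfE// /normal_fun.
have -> : - ((x - m) / s ^+ 2) *
    (normal_peak s * expR (- (x - m) ^+ 2 / (s ^+ 2 *+ 2))) =
  normal_peak s *: (expR (- (x - m) ^+ 2 / (s ^+ 2 *+ 2)) *:
    (- (2 * (x - m)) / (s ^+ 2 *+ 2))).
  by rewrite /GRing.scale/=; field.
apply: is_deriveZ; apply: is_derive1_comp.
have -> : - (2 * (x - m)) / (s ^+ 2 *+ 2) =
  (s ^+ 2 *+ 2)^-1 *: (- (2 * (x - m)) ) :> R.
  by rewrite /GRing.scale/= mulrC.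
under eq_fun do rewrite mulrC.
apply: is_deriveZ.
apply: is_deriveN.
apply: is_derive_eq.
by rewrite /GRing.scale/=; ring.
Qed.

(** Doubling the standard deviation absorbs the quadratic factor. Integrability and boundedness of
    functions of quadratic growth against [p] thus reduce to those of a Gaussian density. *)
Lemma normal_pdf_sqr_le : exists2 K : R, 0 <= K &
  forall x, (x - m) ^+ 2 * p x <= K * normal_pdf m (2 * s) x.
Proof.
have s20 : 2 * s != 0 by rewrite mulf_neq0.
(* 1 / c = 1 / (2 s^2) - 1 / (8 s^2) is the decay left over once the wider Gaussian is factored out;
   it pays for y through y / c <= exp (y / c). *)
pose c := 8 * s ^+ 2 / 3.
have c0 : 0 < c by rewrite divr_gt0// mulr_gt0.
have pk : 0 < normal_peak (2 * s) by exact: normal_peak_gt0.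
exists (c * normal_peak s / normal_peak (2 * s)).
  by apply: divr_ge0; rewrite ?normal_peak_ge0// mulr_ge0 ?normal_peak_ge0// ltW.
move=> x; rewrite !normal_pdfE// /normal_fun; set y := (x - m) ^+ 2.
have -> : c * normal_peak s / normal_peak (2 * s) *
    (normal_peak (2 * s) * expR (- y / ((2 * s) ^+ 2 *+ 2))) =
  normal_peak s * (c * expR (- y / ((2 * s) ^+ 2 *+ 2))).
  by field; rewrite gt_eqF.
rewrite mulrCA ler_wpM2l ?normal_peak_ge0//.
have -> : - y / (s ^+ 2 *+ 2) = - y / ((2 * s) ^+ 2 *+ 2) - y / c.
  by rewrite /c; field.
rewrite expRD expRN mulrCA mulrC ler_wpM2r ?expR_ge0//.
rewrite ler_pdivrMr ?expR_gt0// mulrC -ler_pdivrMr//.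
by apply: le_trans (expR_ge1Dx _); rewrite lerDr.
Qed.

Lemma normal_pdf_quadratic_integrable (g : R -> R) (A B : R) :
  measurable_fun setT g -> 0 <= A -> 0 <= B ->
  (forall x, `|g x| <= A + B * (x - m) ^+ 2) ->
  mu.-integrable setT (EFin \o (fun x => g x * p x)).
Proof.
move=> mg A0 B0 gAB; have [K K0 pK] := normal_pdf_sqr_le.
apply: (@le_integrable _ _ _ mu setT measurableT _
   (EFin \o (fun x => A * p x + B * K * normal_pdf m (2 * s) x))) => //.
- apply/measurable_EFinP; apply: measurable_funM => //.
  exact: measurable_normal_pdf.
- move=> x _; rewrite /= lee_fin normrM (ger0_norm (normal_pdf_ge0 _ _ _)).
  rewrite [leRHS]ger0_norm; last first.
    by rewrite addr_ge0// mulr_ge0 ?normal_pdf_ge0// mulr_ge0.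
  apply: (@le_trans _ _ ((A + B * (x - m) ^+ 2) * p x)).
    by rewrite ler_wpM2r ?normal_pdf_ge0.
  rewrite mulrDl lerD2l -[B * _ * p x]mulrA -[B * K * _]mulrA.
  by rewrite ler_wpM2l.
- have -> : EFin \o (fun x => A * p x + B * K * normal_pdf m (2 * s) x) =
    ((fun x => A%:E * (p x)%:E) \+
    (fun x => (B * K)%:E * (normal_pdf m (2 * s) x)%:E))%E.
    by apply/funext => x /=; rewrite EFinD !EFinM.
  by apply: integrableD => //; apply: integrableZl => //;
    exact: integrable_normal_pdf.
Qed.

Lemma normal_pdf_quadratic_bounded (A B : R) : 0 <= A -> 0 <= B ->
  exists K : R, forall x, (A + B * (x - m) ^+ 2) * p x <= K.
Proof.
move=> A0 B0; have [K K0 pK] := normal_pdf_sqr_le.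
exists (A * normal_peak s + B * (K * normal_peak (2 * s))) => x.
rewrite mulrDl -mulrA; apply: lerD; rewrite ler_wpM2l// ?normal_pdf_ub//.
apply: le_trans (pK x) _; rewrite ler_wpM2l// normal_pdf_ub//.
by rewrite mulf_neq0.
Qed.

(* Integration by parts: p' = - ((x - m) / s^2) p. *)
Lemma normal_pdf_stein (g g' : R -> R) (A B : R) : 0 <= A -> 0 <= B ->
  (forall x : R, is_derive x 1 g (g' x)) -> continuous g' ->
  (forall x, `|g' x| <= A) -> (forall x, `|g x| * `|x - m| <= A + B * (x - m) ^+ 2) ->
  \int[mu]_x (g' x * p x) = \int[mu]_x ((g x * ((x - m) / s ^+ 2)) * p x).
Proof.
move=> A0 B0 dg cg' g'A gB.
have cg : continuous g.
  move=> x; apply/differentiable_continuous/derivable1_diffP.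
  by have [] := dg x.
have cxm : continuous (fun x : R => (x - m) / s ^+ 2).
  move=> x; apply: cvgM; last exact: cvg_cst.
  by apply: cvgB; [exact: cvg_id|exact: cvg_cst].
have int1 : mu.-integrable setT (EFin \o (fun x => g' x * p x)).
  apply: (@normal_pdf_quadratic_integrable g' A 0) => //.
    exact: continuous_measurable_fun.
  by move=> x; rewrite mul0r addr0.
have cgx : continuous (fun x : R => g x * ((x - m) / s ^+ 2)).
  by move=> x; apply: cvgM; [exact: cg|exact: cxm].
have int2 : mu.-integrable setT
    (EFin \o (fun x => g x * ((x - m) / s ^+ 2) * p x)).
  apply: (@normal_pdf_quadratic_integrable _ (A / s ^+ 2) (B / s ^+ 2)).
  - exact: continuous_measurable_fun.
  - by rewrite divr_ge0// ltW.
  - by rewrite divr_ge0// ltW.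
  - move=> x; rewrite mulrA normrM normrM normfV (gtr0_norm s2_gt0).
    by rewrite [B / _ * _]mulrAC -mulrDl ler_wpM2r// invr_ge0 ltW.
have [K pK] := normal_pdf_quadratic_bounded A0 B0.
apply/eqP; rewrite -subr_eq0 -RintegralB//; apply/eqP.
apply: (@Rintegral_derivative_eq0 _ _ (fun x => g x * p x) m K).
- move=> x; have dp := is_derive_normal_pdf x; have dgx := dg x.
  by apply: is_derive_eq; rewrite /GRing.scale/=; ring.
- move=> x; have cp := @continuous_normal_pdf R m s s0.
  by apply: cvgB; apply: cvgM; [exact: cg'|exact: cp|exact: cgx|exact: cp].
- by apply: eq_integrable (integrableB _ int1 int2) => // x _.
- move=> x; rewrite normrM (ger0_norm (normal_pdf_ge0 _ _ _)) mulrAC.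
  by apply: le_trans (pK x); rewrite ler_wpM2r ?normal_pdf_ge0.
Qed.

Let abs_quadratic (y : R) : `|y| <= 1 + 1 * y ^+ 2.
Proof.
by rewrite mul1r -(real_normK (num_real y)); have := normr_ge0 y; nra.
Qed.

Let integrable_center : mu.-integrable setT (EFin \o (fun x => (x - m) * p x)).
Proof.
apply: (@normal_pdf_quadratic_integrable _ 1 1) => //.
exact: measurable_funB.
Qed.

Let center_mean : \int[mu]_x ((x - m) * p x) = 0.
Proof.
have : \int[mu]_x (0 * p x) = \int[mu]_x (1 * ((x - m) / s ^+ 2) * p x).
  apply: (@normal_pdf_stein (cst 1) (cst 0) 1 1) => //.
  - by move=> x; exact: cvg_cst.
  - by move=> x; rewrite normr0.
  - by move=> x; rewrite normr1 mul1r.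
under eq_Rintegral do rewrite mul0r.
rewrite Rintegral_cst// mul0r.
under eq_Rintegral do rewrite mul1r mulrAC.
rewrite RintegralZr// => /esym/eqP.
by rewrite mulf_eq0 invr_eq0 (gt_eqF s2_gt0) orbF => /eqP.
Qed.

Lemma normal_mean_integrable : mu.-integrable setT (EFin \o (fun x => x * p x)).
Proof.
have ip : mu.-integrable setT (EFin \o (fun x => m * p x)).
  have := integrableZl measurableT m (@integrable_normal_pdf R m s).
  by apply: eq_integrable.
apply: eq_integrable (integrableD measurableT integrable_center ip) => // x _.
by rewrite /= -EFinD -mulrDl subrK.
Qed.

Lemma normal_mean : \int[mu]_x (x * p x) = m.
Proof.
have ip := @integrable_normal_pdf R m s.
have imp : mu.-integrable setT (EFin \o (fun x => m * p x)).
  have := integrableZl measurableT m ip.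
  by apply: eq_integrable.
transitivity (\int[mu]_x ((x - m) * p x + m * p x)).
  by apply: eq_Rintegral => x _; rewrite -mulrDl subrK.
rewrite RintegralD// center_mean add0r RintegralZl//.
by rewrite /Rintegral integral_normal_pdf mulr1.
Qed.

Lemma normal_variance_integrable :
  mu.-integrable setT (EFin \o (fun x => (x - m) ^+ 2 * p x)).
Proof.
apply: (@normal_pdf_quadratic_integrable _ 0 1) => //.
  by apply: measurable_funX; exact: measurable_funB.
by move=> x; rewrite add0r mul1r ger0_norm ?sqr_ge0.
Qed.

Lemma normal_variance : \int[mu]_x ((x - m) ^+ 2 * p x) = s ^+ 2.
Proof.
have : \int[mu]_x (1 * p x) = \int[mu]_x ((x - m) * ((x - m) / s ^+ 2) * p x).
  apply: (@normal_pdf_stein (fun x => x - m) (cst 1) 1 1) => //.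
  - by move=> x; apply: is_derive_eq; rewrite subr0.
  - by move=> x; exact: cvg_cst.
  - by move=> x; rewrite normr1.
  - by move=> x; rewrite -normrM -expr2 mul1r ger0_norm ?sqr_ge0// lerDr.
under eq_Rintegral do rewrite mul1r.
rewrite {1}/Rintegral integral_normal_pdf/=.
under eq_Rintegral do rewrite mulrA -expr2 mulrAC.
rewrite RintegralZr//; last exact: normal_variance_integrable.
by move=> /esym/(congr1 ( *%R^~ (s ^+ 2))); rewrite mul1r divfK ?gt_eqF.
Qed.

Lemma normal_cos_integrable (t : R) :
  mu.-integrable setT (EFin \o (fun x => cos (t * (x - m)) * p x)).
Proof.
apply: (@normal_pdf_quadratic_integrable _ 1 0) => //.
  apply: (measurableT_comp (f := @cos R)).
    by apply: continuous_measurable_fun; exact: continuous_cos.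
  by apply: measurable_funM => //; exact: measurable_funB.
by move=> x; rewrite mul0r addr0 ler_norml cos_geN1 cos_le1.
Qed.

(* By Stein's identity phi(t) = E[cos (t (x - m))] solves phi' = - s^2 t phi. *)
Lemma normal_cos (t : R) :
  \int[mu]_x (cos (t * (x - m)) * p x) = expR (- (s ^+ 2 * t ^+ 2 / 2)).
Proof.
have aux (a b c : R) : - a * b * c = - s ^+ 2 * (a * (b / s ^+ 2) * c) by field.
pose phi t := \int[mu]_x (cos (t * (x - m)) * p x).
have dphi : forall u : R, is_derive u 1 phi (- (s ^+ 2 * u) * phi u).
  move=> u.
  pose f (u x : R) := cos (u * (x - m)) * p x.
  have df1 (v x : R) : is_derive v 1 (f ^~ x) (- sin (v * (x - m)) * (x - m) * p x).
    rewrite /f; apply: is_derive_eq; rewrite /GRing.scale/=; ring.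
  have d1 (v x : R) : partial1of2 f v x = - sin (v * (x - m)) * (x - m) * p x.
    by rewrite partial1of2E; have [] := df1 v x.
  have I : `](u - 1), (u + 1)[%classic u.
    by rewrite /= in_itv/= ltrBlDr ltrDl ltr01.
  have H1 := @normal_cos_integrable.
  have H2 (v x : R) : `](u - 1), (u + 1)[%classic v -> setT x -> derivable (f ^~ x) v 1.
    by move=> _ _; have [] := df1 v x.
  (* Dominates the derivative in v uniformly, as the sine is at most 1 in absolute value. *)
  pose G x := `|(x - m) * p x|.
  have G0 x : 0 <= G x by rewrite normr_ge0.
  have iG : mu.-integrable setT (EFin \o G).
    by have := integrable_norm integrable_center.
  have H3 (v x : R) : `](u - 1), (u + 1)[%classic v -> setT x ->
      `|partial1of2 f v x| <= G x.
    move=> _ _; rewrite d1 -mulrA normrM /G normrN ler_piMl//.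
    by rewrite ler_norml sin_geN1 sin_le1.
  have D := @derivable_under_integral _ _ _ mu f setT measurableT u _ _ I
    (fun x _ => H1 x) H2 G G0 iG H3.
  have E := @differentiation_under_integral _ _ _ mu f setT measurableT u _ _ I
    (fun x _ => H1 x) H2 G G0 iG H3.
  apply: DeriveDef => //; rewrite -derive1E E.
  under eq_Rintegral do rewrite d1.
  have S : \int[mu]_x ((u * cos (u * (x - m))) * p x) =
    \int[mu]_x (sin (u * (x - m)) * ((x - m) / s ^+ 2) * p x).
    apply: (@normal_pdf_stein (fun x => sin (u * (x - m)))
       (fun x => u * cos (u * (x - m))) (`|u| + 1) 1) => //.
    - by move=> x; apply: is_derive_eq; rewrite /GRing.scale/=; ring.
    - move=> x; apply: cvgM; first exact: cvg_cst.
      apply: (@continuous_comp _ _ _ (fun x => u * (x - m)) (@cos R)).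
        apply: cvgM; first exact: cvg_cst.
        by apply: cvgB; [exact: cvg_id|exact: cvg_cst].
      exact: continuous_cos.
    - move=> x; rewrite normrM (@le_trans _ _ `|u|)// ?lerDl//.
      by rewrite ler_piMr// ler_norml cos_geN1 cos_le1.
    - move=> x; rewrite -addrA (@le_trans _ _ `|x - m|)//.
        by rewrite ler_piMl// ler_norml sin_geN1 sin_le1.
      by apply: le_trans (abs_quadratic _) _; rewrite lerDr.
  have iS : mu.-integrable setT
      (EFin \o (fun x => sin (u * (x - m)) * ((x - m) / s ^+ 2) * p x)).
    apply: (@normal_pdf_quadratic_integrable _ (1 / s ^+ 2) (1 / s ^+ 2)).
    - apply: measurable_funM.
        apply: (measurableT_comp (f := @sin R)).
          by apply: continuous_measurable_fun; exact: continuous_sin.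
        by apply: measurable_funM => //; exact: measurable_funB.
      by apply: measurable_funM => //; exact: measurable_funB.
    - by rewrite divr_ge0// ltW.
    - by rewrite divr_ge0// ltW.
    - move=> x; rewrite normrM normrM normfV (gtr0_norm s2_gt0).
      apply: (@le_trans _ _ (`|x - m| / s ^+ 2)).
        by rewrite ler_piMl ?divr_ge0 ?(ltW s2_gt0)// ler_norml sin_geN1 sin_le1.
      rewrite [1 / _ * _]mulrAC -mulrDl ler_wpM2r//; first by rewrite invr_ge0 ltW.
  transitivity (- s ^+ 2 *
      \int[mu]_x (sin (u * (x - m)) * ((x - m) / s ^+ 2) * p x)).
    rewrite -(@RintegralZl _ _ _ mu setT _ (- s ^+ 2) measurableT iS).
    by apply: eq_Rintegral => x _; exact: aux.
  rewrite -S.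
  under eq_Rintegral do rewrite -mulrA.
  by rewrite RintegralZl// /phi; ring.
(* Dividing phi by the expected solution gives a function with zero derivative, equal to its value 1
   at 0. *)
pose psi u := phi u * expR (s ^+ 2 * u ^+ 2 / 2).
have dpsi (u : R) : is_derive u 1 psi 0.
  have := dphi u => ?.
  apply: is_derive_eq; rewrite /GRing.scale/= mulr0; by field.
have := is_derive_0_is_cst t 0 dpsi.
rewrite /psi expr0n/= mulr0 mul0r expR0 mulr1 /phi.
under [X in _ = X -> _]eq_Rintegral do rewrite mul0r cos0 mul1r.
rewrite {2}/Rintegral integral_normal_pdf/= => h.
apply: (mulIf (lt0r_neq0 (expR_gt0 (s ^+ 2 * t ^+ 2 / 2)))).
by rewrite h -expRD addNr expR0.
Qed.

End NormalMoments.

Section GaussianLaw.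
Context {d} {T : measurableType d} {R : realType} (P : probability T R).
Variable Y : T -> R.
Hypothesis mY : measurable_fun setT Y.

Lemma dirac_law_Rintegral (m : R) (f : R -> R) : measurable_fun setT f ->
  (forall A : set R, measurable A -> P (Y @^-1` A) = \d_m A) ->
  P.-integrable setT (EFin \o (f \o Y)) /\ \int[P]_w f (Y w) = f m.
Proof.
move=> mf Ym.
have Yae : {ae P, forall w, Y w = m}.
  have mm : measurable (~` [set m] : set R) by exact: measurableC.
  exists (Y @^-1` (~` [set m])); split => //.
    by rewrite -[X in measurable X]setTI; exact: mY.
  by rewrite Ym// diracE memNset//=; exact.
have mfY : measurable_fun setT (EFin \o (f \o Y)).
  by apply/measurable_EFinP; exact: measurableT_comp.
have E (g : R -> R) : measurable_fun setT g ->
    (\int[P]_w (g (Y w))%:E = (g m)%:E)%E.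
  move=> mg; transitivity (\int[P]_w (cst (g m)%:E) w)%E; last first.
    by rewrite integral_cst//= probability_setT mule1.
  apply: ae_eq_integral => //.
    by apply/measurable_EFinP; exact: measurableT_comp.
  by case: Yae => N [mN N0 YN]; exists N; split => // w /= h; apply: YN => /= Yw;
    apply: h => _; rewrite Yw.
split; last by rewrite /Rintegral E.
apply/integrableP; split => //=; rewrite (E (fun x => `|f x|)) ?ltry//.
exact: measurableT_comp.
Qed.

(** Both branches of [gaussian_law] are treated: for sigma = 0 and mean 0 the last formula reads cos
    0 = exp 0, otherwise the moments of the normal density apply. *)
Lemma gaussian_law_moments : gaussian_law P Y ->
  [/\ P.-integrable setT (EFin \o Y),
      P.-integrable setT (EFin \o (fun w => Y w ^+ 2)) &
      \int[P]_w Y w = 0 ->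
        \int[P]_w cos (Y w) = expR (- (\int[P]_w (Y w ^+ 2)) / 2)].
Proof.
have mcos : measurable_fun setT (@cos R).
  by apply: continuous_measurable_fun; exact: continuous_cos.
have msqr : measurable_fun setT (fun x : R => x ^+ 2) by exact: measurable_funX.
case=> m [s]; have [_|s0] := eqVneq s 0 => Ylaw.
  have H f mf := @dirac_law_Rintegral m f mf Ylaw.
  split.
  - exact: (H idfun (@measurable_id _ _ _)).1.
  - exact: (H _ msqr).1.
  - move=> Y0; have [_ E] := H idfun (@measurable_id _ _ _).
    have m0 : m = 0 by rewrite -Y0; apply/esym; exact: E.
    have [_ ->] := H _ mcos.
    by have [_ ->] := H _ msqr; rewrite m0 cos0 expr0n/= oppr0 mul0r expR0.
have p0 := normal_pdf_ge0 m s.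
have mp := measurable_normal_pdf m s.
have I f mf := @law_integrable _ _ _ P Y mY _ p0 mp Ylaw f mf.
have E f mf := @law_Rintegral _ _ _ P Y mY _ p0 mp Ylaw f mf.
have i1 := normal_mean_integrable m s0.
split.
- exact: (I idfun (@measurable_id _ _ _) i1).
- apply: (I (fun x => x ^+ 2)) => //.
  apply: (@normal_pdf_quadratic_integrable _ m s s0 _ (2 * m ^+ 2) 2) => //.
    by rewrite mulr_ge0 ?sqr_ge0.
  move=> x; rewrite ger0_norm ?sqr_ge0//.
  (* 2 m^2 + 2 (x - m)^2 - x^2 = (x - 2 m)^2. *)
  by have := sqr_ge0 (x - 2 * m); nra.
- move=> Y0.
  have m0 : m = 0.
    rewrite -Y0 -[LHS](normal_mean m s0); apply/esym.
    exact: (E idfun (@measurable_id _ _ _) i1).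
  rewrite (E _ mcos); last first.
    have := normal_cos_integrable m s0 1.
    by apply: eq_integrable => // x _; rewrite /= mul1r m0 subr0.
  rewrite (E (fun x => x ^+ 2))//; last first.
    have := normal_variance_integrable m s0.
    by apply: eq_integrable => // x _; rewrite /= m0 subr0.
  have V := normal_variance m s0; have C := normal_cos m s0 1.
  transitivity (\int[lebesgue_measure]_x (cos (1 * (x - m)) * normal_pdf m s x)).
    by apply: eq_Rintegral => x _; rewrite m0 subr0 mul1r.
  have W : \int[lebesgue_measure]_x (x ^+ 2 * normal_pdf m s x) = s ^+ 2.
    by rewrite -[RHS]V; apply: eq_Rintegral => x _; rewrite m0 subr0.
  by rewrite W C expr1n mulr1 mulNr.
Qed.

Lemma gaussian_law_normal : gaussian_law P Y -> \int[P]_w Y w = 0 ->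
  \int[P]_w (Y w ^+ 2) != 0 ->
  exists s : R, [/\ s != 0, s ^+ 2 = \int[P]_w (Y w ^+ 2) &
  forall A : set R, measurable A -> P (Y @^-1` A) = normal_prob 0 s A].
Proof.
have msqr : measurable_fun setT (fun x : R => x ^+ 2) by exact: measurable_funX.
case=> m [s]; have [_|s0] := eqVneq s 0 => Ylaw Y0.
  have H f mf := @dirac_law_Rintegral m f mf Ylaw.
  have [_ E] := H idfun (@measurable_id _ _ _).
  have m0 : m = 0 by rewrite -Y0; apply/esym; exact: E.
  by have [_ ->] := H _ msqr; rewrite m0 expr0n/= eqxx.
have E f mf := @law_Rintegral _ _ _ P Y mY _ (normal_pdf_ge0 m s)
  (measurable_normal_pdf m s) Ylaw f mf.
have m0 : m = 0.
  rewrite -Y0 -[LHS](normal_mean m s0); apply/esym.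
  exact: (E idfun (@measurable_id _ _ _) (normal_mean_integrable m s0)).
move=> _; exists s; split => //; last by rewrite m0 in Ylaw.
rewrite -(normal_variance m s0) (E (fun x => x ^+ 2))//; last first.
  have := normal_variance_integrable m s0.
  by apply: eq_integrable => // x _; rewrite /= m0 subr0.
by apply: eq_Rintegral => x _; rewrite m0 subr0.
Qed.

End GaussianLaw.

(** * Decorrelation of Gaussian cosine polynomials *)

Section CoshKernel.
Context {R : realType} {n : nat}.
Implicit Types (t s : 'I_n -> R) (M : 'I_n -> 'I_n -> R).
Implicit Types F G : seq (R * ('I_n -> R)).

Definition dot t s : R := \sum_i t i * s i.
Definition bilin M t s : R := \sum_i \sum_j t i * M i j * s j.

Definition power_form (b : ('I_n -> R) -> ('I_n -> R) -> R) F G k : R :=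
  \sum_(c <- F) \sum_(e <- G) c.1 * e.1 * b c.2 e.2 ^+ k.

(* The entries of the k-th tensor power of the vectors of F, summed with the
   weights of F. *)
Let tensor F k (a : {ffun 'I_k -> 'I_n}) : R :=
  \sum_(c <- F) c.1 * \prod_l c.2 (a l).

Let power_bilinE M F G k : power_form (bilin M) F G k =
  \sum_(a : {ffun 'I_k -> 'I_n}) \sum_(b : {ffun 'I_k -> 'I_n})
    (\prod_l M (a l) (b l)) * (tensor F a * tensor G b).
Proof.
have E c e : c.1 * e.1 * bilin M c.2 e.2 ^+ k =
    \sum_(a : {ffun 'I_k -> 'I_n}) \sum_(b : {ffun 'I_k -> 'I_n})
    (\prod_l M (a l) (b l)) *
    ((c.1 * \prod_l c.2 (a l)) * (e.1 * \prod_l e.2 (b l))) :> R.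
  rewrite -[k in LHS]card_ord -prodr_const bigA_distr_bigA big_distrr/=.
  apply: eq_bigr => a _; rewrite bigA_distr_bigA big_distrr/=.
  apply: eq_bigr => b _; rewrite !big_split/=; ring.
rewrite /power_form.
under eq_bigr do under eq_bigr do rewrite E.
under eq_bigr do rewrite exchange_big/=.
rewrite exchange_big/=; apply: eq_bigr => a _.
under eq_bigr do rewrite exchange_big/=.
rewrite exchange_big/=; apply: eq_bigr => b _.
rewrite /tensor big_distrlr/= big_distrr/=; apply: eq_bigr => c _.
by rewrite big_distrr.
Qed.

Let power_dotE F k :
  power_form dot F F k = \sum_(a : {ffun 'I_k -> 'I_n}) tensor F a ^+ 2.
Proof.
have E c e : c.1 * e.1 * dot c.2 e.2 ^+ k =
    \sum_(a : {ffun 'I_k -> 'I_n})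
    (c.1 * \prod_l c.2 (a l)) * (e.1 * \prod_l e.2 (a l)) :> R.
  rewrite -[k in LHS]card_ord -prodr_const bigA_distr_bigA big_distrr/=.
  by apply: eq_bigr => a _; rewrite !big_split/=; ring.
rewrite /power_form.
under eq_bigr do under eq_bigr do rewrite E.
under eq_bigr do rewrite exchange_big/=.
rewrite exchange_big/=; apply: eq_bigr => a _.
by rewrite expr2 /tensor big_distrlr.
Qed.

Lemma power_dot_ge0 F k : 0 <= power_form dot F F k.
Proof. by rewrite power_dotE sumr_ge0// => a _; exact: sqr_ge0. Qed.

(** The inequality |u v| <= (u^2 + v^2) / 2 separates the two tensors in each pair of words (a, b);
    the word that no longer occurs ranges over n^k values, which turns m^k into (n m)^k. *)
Lemma power_bilin_le M (m : R) F G k : (forall i j, `|M i j| <= m) ->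
  `|power_form (bilin M) F G k| <=
  (n%:R * m) ^+ k / 2 * (power_form dot F F k + power_form dot G G k).
Proof.
move=> Mm; rewrite power_bilinE !power_dotE.
apply: (@le_trans _ _
    (\sum_(a : {ffun 'I_k -> 'I_n}) \sum_(b : {ffun 'I_k -> 'I_n})
       m ^+ k / 2 * (tensor F a ^+ 2 + tensor G b ^+ 2))).
  apply: le_trans (ler_norm_sum _ _ _) _; apply: ler_sum => a _.
  apply: le_trans (ler_norm_sum _ _ _) _; apply: ler_sum => b _.
  rewrite normrM -mulrA ler_pM//.
    rewrite normr_prod -[k in leRHS]card_ord -prodr_const.
    by apply: ler_prod => l _; rewrite normr_ge0 Mm.
  rewrite ler_norml.
  have := sqr_ge0 (tensor F a - tensor G b).
  have := sqr_ge0 (tensor F a + tensor G b).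
  by move=> h1 h2; apply/andP; split; nra.
have cardE : #|{ffun 'I_k -> 'I_n}|%:R = n%:R ^+ k :> R.
  by rewrite card_ffun !card_ord natrX.
under eq_bigr do rewrite -big_distrr/= big_split/= sumr_const.
rewrite -big_distrr/= big_split/= sumr_const.
rewrite sumrMnl -mulrnDl -[X in _ * X <= _]mulr_natr.
rewrite (_ : #|_|%:R = n%:R ^+ k); last first.
  by rewrite -cardE; congr (_%:R); apply: eq_card.
by rewrite exprMn le_eqVlt; apply/orP; left; apply/eqP; field.
Qed.

Lemma cosh_series (z : R) :
  (fun N => \sum_(2 <= k < N | ~~ odd k) z ^+ k / k`!%:R) @ \oo -->
  (expR z + expR (- z)) / 2 - 1.
Proof.
have cvgE (x : R) : (fun N => \sum_(0 <= k < N) x ^+ k / k`!%:R) @ \oo --> expR x.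
  have := @is_cvg_series_exp_coeff R x.
  by rewrite /expR.
have : (fun N => (\sum_(0 <= k < N) z ^+ k / k`!%:R +
     \sum_(0 <= k < N) (- z) ^+ k / k`!%:R) / 2 - 1) @ \oo -->
  (expR z + expR (- z)) / 2 - 1.
  apply: cvgB; last exact: cvg_cst.
  by apply: cvgM; [apply: cvgD; exact: cvgE|exact: cvg_cst].
apply: cvg_trans; apply: near_eq_cvg; near=> N.
have N2 : (2 <= N)%N by near: N; exact: nbhs_infty_ge.
(* The terms of order 0 halve to 1 and cancel the - 1; those of order 1 cancel each other. *)
rewrite -big_split/= (@big_cat_nat _ _ _ 2)//= big_nat_recr//= big_nat1.
rewrite !expr0 !expr1 mulNr subrr addr0 fact0 !divr1.
rewrite [in RHS]big_mkcond/= mulrDl -[(1 + 1) / 2]/(2 / 2) divff// addrAC subrr add0r.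
rewrite mulr_suml; apply: eq_bigr => k _.
rewrite exprNn -signr_odd; case: (odd k) => /=.
  by rewrite expr1 mulN1r mulNr subrr mul0r.
by rewrite expr0 mul1r; field; rewrite pnatr_eq0 -lt0n fact_gt0.
Unshelve. all: by end_near. Qed.

(** The covariance of two cosine polynomials of standard Gaussian vectors with cross-covariance form
    b, once the weights carry the factors exp (- |t|^2 / 2). With b = [dot] it is the variance of
    one polynomial. *)
Definition cosh_form (b : ('I_n -> R) -> ('I_n -> R) -> R) F G : R :=
  \sum_(c <- F) \sum_(e <- G)
    c.1 * e.1 * ((expR (b c.2 e.2) + expR (- b c.2 e.2)) / 2 - 1).

Lemma cosh_form_series b F G :
  (fun N => \sum_(2 <= k < N | ~~ odd k) power_form b F G k / k`!%:R) @ \oo -->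
  cosh_form b F G.
Proof.
have -> : (fun N => \sum_(2 <= k < N | ~~ odd k) power_form b F G k / k`!%:R) =
  (fun N => \sum_(c <- F) \sum_(e <- G) c.1 * e.1 *
     \sum_(2 <= k < N | ~~ odd k) b c.2 e.2 ^+ k / k`!%:R).
  apply/funext => N; rewrite /power_form.
  under eq_bigr do rewrite mulr_suml.
  rewrite exchange_big/=; apply: eq_bigr => c _.
  under eq_bigr do rewrite mulr_suml.
  rewrite exchange_big/=; apply: eq_bigr => e _.
  by rewrite big_distrr/=; apply: eq_bigr => k _; rewrite mulrA.
rewrite /cosh_form.
apply: cvg_big => [|c _]; first exact: add_continuous.
apply: cvg_big => [|e _]; first exact: add_continuous.
by apply: cvgM; [exact: cvg_cst|exact: cosh_series].
Qed.

(* Each term z ^ k / k!, with k >= 2 even, gains the factor (n m)^k <= (n m)^2. *)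
Lemma cosh_form_bilin_le M (m : R) F G : (forall i j, `|M i j| <= m) ->
  0 <= m -> n%:R * m <= 1 ->
  `|cosh_form (bilin M) F G| <=
  (n%:R * m) ^+ 2 / 2 * (cosh_form dot F F + cosh_form dot G G).
Proof.
move=> Mm m0 nm1.
have nm0 : 0 <= n%:R * m by rewrite mulr_ge0.
have L := @cosh_form_series (bilin M) F G.
have RF := @cosh_form_series dot F F.
have RG := @cosh_form_series dot G G.
have RR : (fun N => (n%:R * m) ^+ 2 / 2 *
  (\sum_(2 <= k < N | ~~ odd k) power_form dot F F k / k`!%:R +
   \sum_(2 <= k < N | ~~ odd k) power_form dot G G k / k`!%:R)) @ \oo -->
  (n%:R * m) ^+ 2 / 2 * (cosh_form dot F F + cosh_form dot G G).
  by apply: cvgM; [exact: cvg_cst|exact: cvgD].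
suff H N : `|\sum_(2 <= k < N | ~~ odd k) power_form (bilin M) F G k / k`!%:R| <=
    (n%:R * m) ^+ 2 / 2 *
  (\sum_(2 <= k < N | ~~ odd k) power_form dot F F k / k`!%:R +
   \sum_(2 <= k < N | ~~ odd k) power_form dot G G k / k`!%:R).
  by apply: (ler_cvg_to (cvg_norm L) RR); exact: nearW.
rewrite -big_split/= big_distrr/=.
apply: le_trans (ler_norm_sum _ _ _) _; rewrite [leLHS]big_nat_cond [leRHS]big_nat_cond.
apply: ler_sum => k /andP[/andP[k2 _] _].
have k0 : 0 < (k`!%:R : R) by rewrite ltr0n fact_gt0.
rewrite -mulrDl normrM normfV (gtr0_norm k0) mulrA ler_wpM2r ?invr_ge0 ?(ltW k0)//.
apply: le_trans (power_bilin_le F G k Mm) _.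
rewrite ler_wpM2r ?addr_ge0 ?power_dot_ge0// ler_wpM2r//.
by apply: ler_wiXn2l.
Qed.
End CoshKernel.

Section ProbabilityTools.
Context {d} {T : measurableType d} {R : realType} (P : probability T R).

Lemma bounded_integrable (f : T -> R) (B : R) : measurable_fun setT f ->
  (forall w, `|f w| <= B) -> P.-integrable setT (EFin \o f).
Proof.
move=> mf fB; apply: (@le_integrable _ _ _ P setT measurableT _ (EFin \o cst B)).
- exact/measurable_EFinP.
- by move=> w _ /=; rewrite lee_fin (le_trans (fB w))// ler_norm.
- exact: finite_measure_integrable_cst.
Qed.

Lemma integrable_bigsum (I : Type) (s : seq I) (f : I -> T -> R) :
  (forall i, P.-integrable setT (EFin \o f i)) ->
  P.-integrable setT (EFin \o (fun w => \sum_(i <- s) f i w)).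
Proof.
move=> fi; have := @integrable_sum _ _ _ P setT measurableT I s xpredT
  (fun i w => (f i w)%:E) (fun i _ => fi i).
by apply: eq_integrable => // w _; rewrite /= sumEFin.
Qed.

Lemma Rintegral_sum (I : Type) (s : seq I) (f : I -> T -> R) :
  (forall i, P.-integrable setT (EFin \o f i)) ->
  \int[P]_w (\sum_(i <- s) f i w) = \sum_(i <- s) \int[P]_w f i w.
Proof.
move=> fi; elim: s => [|i s IH].
  under eq_Rintegral do rewrite big_nil.
  by rewrite big_nil Rintegral_cst// mul0r.
under eq_Rintegral do rewrite big_cons.
by rewrite big_cons RintegralD// ?IH//; exact: integrable_bigsum.
Qed.

Lemma Rintegral_prob_cst (r : R) : \int[P]_w r = r.
Proof. by rewrite Rintegral_cst//= probability_setT mulr1. Qed.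

Lemma integrableZ (f : T -> R) (r : R) : P.-integrable setT (EFin \o f) ->
  P.-integrable setT (EFin \o (fun w => r * f w)).
Proof.
by move=> fi; apply: eq_integrable (integrableZl measurableT r fi).
Qed.

Lemma integrableDR (f g : T -> R) : P.-integrable setT (EFin \o f) ->
  P.-integrable setT (EFin \o g) ->
  P.-integrable setT (EFin \o (fun w => f w + g w)).
Proof.
by move=> fi gi; apply: eq_integrable (integrableD measurableT fi gi).
Qed.

Lemma bounded_convergence (f_ : nat -> T -> R) (f : T -> R) (B : R) :
  (forall n, measurable_fun setT (f_ n)) -> (forall n w, `|f_ n w| <= B) ->
  (forall w, f_ n w @[n --> \oo] --> f w) ->
  [/\ measurable_fun setT f, forall w, `|f w| <= B &
      \int[P]_w f_ n w @[n --> \oo] --> \int[P]_w f w].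
Proof.
move=> mf fB cf; have mf' : measurable_fun setT f.
  by apply: (measurable_fun_cvg mf) => w _; exact: cf.
have fB' w : `|f w| <= B.
  apply: (ler_cvg_to (cvg_norm (cf w)) (cvg_cst B)).
  by apply: nearW => n; exact: fB.
split => //; apply: fine_cvg; rewrite fineK; last first.
  have fi := bounded_integrable mf' fB'.
  exact: integrable_fin_num.
apply: (@dominated_cvg _ _ _ P setT measurableT _ _ (EFin \o cst B)) => //.
- by move=> n; exact/measurable_EFinP.
- by move=> w _; apply: cvg_EFin; [exact: nearW|exact: cf].
- exact: finite_measure_integrable_cst.
- by move=> n w _ /=; rewrite lee_fin.
Qed.

Lemma Rintegral_abs_le (f : T -> R) (B : R) : measurable_fun setT f ->
  (forall w, `|f w| <= B) -> `|\int[P]_w f w| <= B.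
Proof.
move=> mf fB; have fi := bounded_integrable mf fB.
apply: le_trans (le_normr_Rintegral measurableT fi) _.
rewrite -[leRHS]Rintegral_prob_cst; apply: le_Rintegral => //.
- exact: integrable_norm.
- exact: finite_measure_integrable_cst.
Qed.

End ProbabilityTools.

Section CosinePolynomials.
Context {R : realType} {n : nat}.
Implicit Types (t s u : 'I_n -> R) (F G : seq (R * ('I_n -> R))).

Definition cospoly F u : R := \sum_(c <- F) c.1 * cos (dot c.2 u).
Definition sinpoly F u : R := \sum_(c <- F) c.1 * sin (dot c.2 u).

Lemma dotDl t s u : dot (fun i => t i + s i) u = dot t u + dot s u.
Proof. by rewrite /dot -big_split; apply: eq_bigr => i _; rewrite mulrDl. Qed.

Lemma dotDr t s u : dot u (fun i => t i + s i) = dot u t + dot u s.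
Proof. by rewrite /dot -big_split; apply: eq_bigr => i _; rewrite mulrDr. Qed.

Lemma dotC t s : dot t s = dot s t.
Proof. by apply: eq_bigr => i _; rewrite mulrC. Qed.

Lemma dotNl t u : dot (fun i => - t i) u = - dot t u.
Proof. by rewrite /dot -sumrN; apply: eq_bigr => i _; rewrite mulNr. Qed.

Lemma dot0l u : dot (fun=> 0) u = 0.
Proof. by rewrite /dot big1// => i _; rewrite mul0r. Qed.

Lemma bilinNr (M : 'I_n -> 'I_n -> R) t s :
  bilin M t (fun i => - s i) = - bilin M t s.
Proof.
rewrite /bilin -sumrN; apply: eq_bigr => i _; rewrite -sumrN.
by apply: eq_bigr => j _; rewrite mulrN.
Qed.

Lemma bilin0r (M : 'I_n -> 'I_n -> R) t : bilin M t (fun=> 0) = 0.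
Proof. by rewrite /bilin big1// => i _; rewrite big1// => j _; rewrite mulr0. Qed.

Lemma bilin0l (M : 'I_n -> 'I_n -> R) t : bilin M (fun=> 0) t = 0.
Proof. by rewrite /bilin big1// => i _; rewrite big1// => j _; rewrite !mul0r. Qed.
End CosinePolynomials.

Section Gebelein.
Context {d} {T : measurableType d} {R : realType} (P : probability T R).
Context {n : nat}.
Variables (U V : T -> 'I_n -> R) (M : 'I_n -> 'I_n -> R).
Hypothesis mU : forall i, measurable_fun setT (U ^~ i).
Hypothesis mV : forall i, measurable_fun setT (V ^~ i).
Hypothesis UV : forall t s : 'I_n -> R,
  \int[P]_w cos (dot t (U w) + dot s (V w)) =
  expR (- (dot t t + dot s s + 2 * bilin M t s) / 2).

Lemma measurable_dot (W : T -> 'I_n -> R) (t : 'I_n -> R) :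
  (forall i, measurable_fun setT (W ^~ i)) ->
  measurable_fun setT (fun w => dot t (W w)).
Proof.
by move=> mW; apply: measurable_sum => i; apply: measurable_funM.
Qed.

Lemma measurable_cos : measurable_fun setT (@cos R).
Proof. by apply: continuous_measurable_fun; exact: continuous_cos. Qed.

Lemma integrable_cos (f : T -> R) : measurable_fun setT f ->
  P.-integrable setT (EFin \o (fun w => cos (f w))).
Proof.
move=> mf; apply: (@bounded_integrable _ _ _ P _ 1) => [|w].
  exact: (measurableT_comp measurable_cos).
by rewrite ler_norml cos_geN1 cos_le1.
Qed.

Lemma measurable_cospoly (W : T -> 'I_n -> R) F :
  (forall i, measurable_fun setT (W ^~ i)) ->
  measurable_fun setT (fun w => cospoly F (W w)).
Proof.
move=> mW; apply: measurable_sum => c; apply: measurable_funM => //.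
by apply: (measurableT_comp measurable_cos); exact: measurable_dot.
Qed.

Let weighted (F : seq (R * ('I_n -> R))) :=
  [seq (c.1 * expR (- dot c.2 c.2 / 2), c.2) | c <- F].

Let Rintegral_cospoly (W : T -> 'I_n -> R) F :
  (forall i, measurable_fun setT (W ^~ i)) ->
  (forall t, \int[P]_w cos (dot t (W w)) = expR (- dot t t / 2)) ->
  \int[P]_w cospoly F (W w) = \sum_(c <- weighted F) c.1.
Proof.
move=> mW HW; rewrite Rintegral_sum; last first.
  by move=> c; apply/integrableZ/integrable_cos/measurable_dot.
rewrite big_map; apply: eq_bigr => c _; rewrite RintegralZl ?HW//.
exact/integrable_cos/measurable_dot.
Qed.

(** The product-to-sum formula averages exp b and exp (- b) into cosh b. The 1 in cosh b = 1 + (cosh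
    b - 1) yields the product of the means, the rest is the covariance. *)
Let Rintegral_cospolyM (W W' : T -> 'I_n -> R) b F G :
  (forall i, measurable_fun setT (W ^~ i)) ->
  (forall i, measurable_fun setT (W' ^~ i)) ->
  (forall t s, \int[P]_w cos (dot t (W w) + dot s (W' w)) =
     expR (- (dot t t + dot s s + 2 * b t s) / 2)) ->
  (forall t s, b t (fun i => - s i) = - b t s) ->
  \int[P]_w (cospoly F (W w) * cospoly G (W' w)) =
  (\sum_(c <- weighted F) c.1) * (\sum_(c <- weighted G) c.1) +
  cosh_form b (weighted F) (weighted G).
Proof.
move=> mW mW' HW bN.
have H t s : \int[P]_w (cos (dot t (W w)) * cos (dot s (W' w))) =
    expR (- dot t t / 2) * expR (- dot s s / 2) *
    ((expR (b t s) + expR (- b t s)) / 2).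
  transitivity (\int[P]_w (2^-1 * (cos (dot t (W w) + dot s (W' w)) +
      cos (dot t (W w) + dot (fun i => - s i) (W' w))))).
    apply: eq_Rintegral => w _; rewrite dotNl cosD cosB. by field.
  have i1 u : P.-integrable setT
      (EFin \o (fun w => cos (dot t (W w) + dot u (W' w)))).
    by apply: integrable_cos; apply: measurable_funD; exact: measurable_dot.
  rewrite RintegralZl//; last exact: integrableDR.
  rewrite RintegralD// !HW bN dotNl dotC dotNl opprK.
  rewrite (_ : - (dot t t + dot s s + 2 * b t s) / 2 =
    - dot t t / 2 + - dot s s / 2 + - b t s); last by field.
  rewrite (_ : - (dot t t + dot s s + 2 * - b t s) / 2 =
    - dot t t / 2 + - dot s s / 2 + b t s); last by field.
  by rewrite !expRD; field.
have iM (c e : R * ('I_n -> R)) : P.-integrable setT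
    (EFin \o (fun w => cos (dot c.2 (W w)) * cos (dot e.2 (W' w)))).
  apply: (@bounded_integrable _ _ _ P _ 1) => [|w].
    by apply: measurable_funM; apply: (measurableT_comp measurable_cos);
      exact: measurable_dot.
  by rewrite normrM mulr_ile1// ler_norml cos_geN1 cos_le1.
transitivity (\int[P]_w (\sum_(c <- F) \sum_(e <- G)
    c.1 * e.1 * (cos (dot c.2 (W w)) * cos (dot e.2 (W' w))))).
  apply: eq_Rintegral => w _; rewrite /cospoly big_distrlr/=.
  by apply: eq_bigr => c _; apply: eq_bigr => e _; ring.
rewrite Rintegral_sum; last first.
  by move=> c; apply: integrable_bigsum => e; exact: integrableZ.
rewrite big_distrlr/= /cosh_form -big_split/= big_map; apply: eq_bigr => c _.
rewrite Rintegral_sum; last by move=> e; exact: integrableZ.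
rewrite -big_split/= big_map; apply: eq_bigr => e _.
by rewrite RintegralZl// H/=; ring.
Qed.

(** Gebelein's inequality: the covariance is [cosh_form (bilin M)], and the two diagonal forms that
    bound it are variances of functions bounded by 1, hence at most 1. *)
Lemma gebelein_cospoly (m : R) F G : (forall i j, `|M i j| <= m) ->
  0 <= m -> (forall w, `|cospoly F (U w)| <= 1) ->
  (forall w, `|cospoly G (V w)| <= 1) ->
  `|\int[P]_w (cospoly F (U w) * cospoly G (V w)) -
    \int[P]_w cospoly F (U w) * \int[P]_w cospoly G (V w)| <=
  2 * (n%:R * m) ^+ 2.
Proof.
move=> Mm m0 F1 G1.
have mF := measurable_cospoly F mU; have mG := measurable_cospoly G mV.
have mFG : measurable_fun setT (fun w => cospoly F (U w) * cospoly G (V w)).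
  exact: measurable_funM.
(* For n m > 1 the trivial bound 2 on the covariance suffices; this case is the origin of the factor
   2. *)
have [nm1|nm1] := lerP (n%:R * m) 1; last first.
  apply: (@le_trans _ _ 2); last by nra.
  apply: le_trans (ler_normB _ _) _; rewrite [leRHS]mulr2n; apply: lerD.
    by apply: Rintegral_abs_le => // w; rewrite normrM mulr_ile1.
  by rewrite normrM mulr_ile1// Rintegral_abs_le.
have U1 t : \int[P]_w cos (dot t (U w)) = expR (- dot t t / 2).
  have := UV t (fun=> 0); rewrite dot0l bilin0r mulr0 !addr0 => <-.
  by apply: eq_Rintegral => w _; rewrite dot0l addr0.
have V1 t : \int[P]_w cos (dot t (V w)) = expR (- dot t t / 2).
  have := UV (fun=> 0) t; rewrite dot0l bilin0l mulr0 add0r addr0 => <-.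
  by apply: eq_Rintegral => w _; rewrite dot0l add0r.
(* A vector paired with itself has [dot] as cross form: apply the one-vector formula at the
   frequency t + s. *)
have dbl (W : T -> 'I_n -> R) :
  (forall t, \int[P]_w cos (dot t (W w)) = expR (- dot t t / 2)) ->
  forall t s, \int[P]_w cos (dot t (W w) + dot s (W w)) =
     expR (- (dot t t + dot s s + 2 * dot t s) / 2).
  move=> W1 t s; transitivity (expR (- dot (fun i => t i + s i) (fun i => t i + s i) / 2)).
    by rewrite -W1; apply: eq_Rintegral => w _; rewrite dotDl.
  by rewrite dotDl !dotDr (dotC s t); congr expR; field.
have dotN (t s : 'I_n -> R) : dot t (fun i => - s i) = - dot t s.
  by rewrite dotC dotNl dotC.
have var1 (W : T -> 'I_n -> R) H :
    (forall i, measurable_fun setT (W ^~ i)) ->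
    (forall t, \int[P]_w cos (dot t (W w)) = expR (- dot t t / 2)) ->
    (forall w, `|cospoly H (W w)| <= 1) ->
    cosh_form dot (weighted H) (weighted H) <= 1.
  move=> mW W1 H1.
  have := Rintegral_cospolyM H H mW mW (dbl W W1) dotN.
  move=> /esym/(canRL (addKr _)) ->; rewrite -expr2.
  have hh : `|\int[P]_w (cospoly H (W w) * cospoly H (W w))| <= 1.
    apply: Rintegral_abs_le.
      by apply: measurable_funM; exact: measurable_cospoly.
    by move=> w; rewrite normrM mulr_ile1.
  rewrite addrC lerBlDr (le_trans (ler_norm _))// (le_trans hh)//.
  by rewrite lerDl sqr_ge0.
rewrite (Rintegral_cospolyM F G mU mV UV (@bilinNr _ _ M)).
rewrite (Rintegral_cospoly F mU U1) (Rintegral_cospoly G mV V1) addrAC subrr add0r.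
apply: le_trans (cosh_form_bilin_le _ _ Mm m0 nm1) _.
have := var1 _ F mU U1 F1; have := var1 _ G mV V1 G1.
by have := sqr_ge0 (n%:R * m); nra.
Qed.

End Gebelein.

(** * Signs as limits of trigonometric polynomials *)

Section TrigonometricPolynomials.
Context {R : realType} {n : nat}.
Implicit Types (f g : ('I_n -> R) -> R).

(** Both parities are tracked because the sign approximants are sine polynomials, whereas the
    decorrelation inequality holds for cosine polynomials; a product of two odd functions leads from
    the former to the latter. *)
Definition even_trig f := exists F, forall u, f u = cospoly F u.
Definition odd_trig f := exists F, forall u, f u = sinpoly F u.

Lemma even_trigD f g : even_trig f -> even_trig g ->
  even_trig (fun u => f u + g u).
Proof.
move=> [F fF] [G gG]; exists (F ++ G) => u.
by rewrite fF gG /cospoly big_cat.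
Qed.

Lemma odd_trigD f g : odd_trig f -> odd_trig g ->
  odd_trig (fun u => f u + g u).
Proof.
move=> [F fF] [G gG]; exists (F ++ G) => u.
by rewrite fF gG /sinpoly big_cat.
Qed.

Lemma even_trigZ r f : even_trig f -> even_trig (fun u => r * f u).
Proof.
move=> [F fF]; exists [seq (r * c.1, c.2) | c <- F] => u.
rewrite fF /cospoly big_map big_distrr/=.
by apply: eq_bigr => c _; rewrite mulrA.
Qed.

Lemma odd_trigZ r f : odd_trig f -> odd_trig (fun u => r * f u).
Proof.
move=> [F fF]; exists [seq (r * c.1, c.2) | c <- F] => u.
rewrite fF /sinpoly big_map big_distrr/=.
by apply: eq_bigr => c _; rewrite mulrA.
Qed.

Lemma even_trig_cos t : even_trig (fun u => cos (dot t u)).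
Proof. by exists [:: (1, t)] => u; rewrite /cospoly big_seq1 mul1r. Qed.

Lemma odd_trig_sin t : odd_trig (fun u => sin (dot t u)).
Proof. by exists [:: (1, t)] => u; rewrite /sinpoly big_seq1 mul1r. Qed.

Lemma even_trig_cst r : even_trig (fun=> r).
Proof.
have [F H] := even_trigZ r (even_trig_cos (fun=> 0)).
by exists F => u; rewrite -H dot0l cos0 mulr1.
Qed.

(** Product-to-sum formulas: sums of frequencies get the weight r1, differences the weight r2; the
    parities of the factors decide the signs. *)
Let prodseq (r1 r2 : R) (F G : seq (R * ('I_n -> R))) :=
  [seq (r1 * (c.1 * e.1), (fun i => c.2 i + e.2 i)) | c <- F, e <- G] ++
  [seq (r2 * (c.1 * e.1), (fun i => c.2 i - e.2 i)) | c <- F, e <- G].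

Lemma even_trigM f g : even_trig f -> even_trig g ->
  even_trig (fun u => f u * g u).
Proof.
move=> [F fF] [G gG]; exists (prodseq 2^-1 2^-1 F G) => u.
rewrite fF gG /cospoly big_cat !big_allpairs_dep/= -big_split/= big_distrlr/=.
apply: eq_bigr => c _; rewrite -big_split/=; apply: eq_bigr => e _.
by rewrite !dotDl dotNl cosD cosB; field.
Qed.

Lemma odd_trigM f g : odd_trig f -> odd_trig g ->
  even_trig (fun u => f u * g u).
Proof.
move=> [F fF] [G gG]; exists (prodseq (- 2^-1) 2^-1 F G) => u.
rewrite fF gG /cospoly /sinpoly big_cat !big_allpairs_dep/= -big_split/= big_distrlr/=.
apply: eq_bigr => c _; rewrite -big_split/=; apply: eq_bigr => e _.
by rewrite !dotDl dotNl cosD cosB; field.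
Qed.

Lemma odd_even_trigM f g : odd_trig f -> even_trig g ->
  odd_trig (fun u => f u * g u).
Proof.
move=> [F fF] [G gG]; exists (prodseq 2^-1 2^-1 F G) => u.
rewrite fF gG /cospoly /sinpoly big_cat !big_allpairs_dep/= -big_split/= big_distrlr/=.
apply: eq_bigr => c _; rewrite -big_split/=; apply: eq_bigr => e _.
by rewrite !dotDl dotNl sinD sinB; field.
Qed.

End TrigonometricPolynomials.

Section SignApproximation.
Context {R : realType}.

(* The odd cubic that maps [-1, 1] into itself with attracting fixed points
   -1 and 1 and repelling fixed point 0; its iterates converge to the sign. *)
Definition sign_step (y : R) : R := 2^-1 * (3 * y + - 1 * (y * (y * y))).

Lemma sign_step_norm (y : R) : `|y| <= 1 -> `|sign_step y| <= 1.
Proof.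
rewrite !ler_norml /sign_step => /andP[h1 h2]; apply/andP; split; last first.
  have -> : 2^-1 * (3 * y + - 1 * (y * (y * y))) =
    1 - (1 - y) ^+ 2 * (2 + y) / 2 by field.
  by rewrite gerBl divr_ge0// mulr_ge0 ?sqr_ge0//; lra.
have -> : 2^-1 * (3 * y + - 1 * (y * (y * y))) =
  - 1 + (1 + y) ^+ 2 * (2 - y) / 2 by field.
by rewrite lerDl divr_ge0// mulr_ge0 ?sqr_ge0//; lra.
Qed.

Lemma iter_sign_step_norm k (y : R) : `|y| <= 1 -> `|iter k sign_step y| <= 1.
Proof. by move=> y1; elim: k => //= k; exact: sign_step_norm. Qed.

Lemma sign_stepN (y : R) : sign_step (- y) = - sign_step y.
Proof. by rewrite /sign_step; ring. Qed.

Lemma iter_sign_stepN k (y : R) : iter k sign_step (- y) = - iter k sign_step y.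
Proof. by elim: k => //= k ->; exact: sign_stepN. Qed.

(** One step multiplies the distance to 1 by 1 - z (1 + z) / 2, which is at most 1 - y / 2 since the
    iterates stay above y; the convergence is geometric. *)
Let iter_sign_step_pos k (y : R) : 0 <= y <= 1 ->
  y <= iter k sign_step y <= 1 /\ 1 - iter k sign_step y <= (1 - y / 2) ^+ k.
Proof.
move=> /andP[y0 y1]; elim: k => [|k [/andP[h1 h2] h3]] /=.
  by rewrite lexx y1 expr0; split => //; lra.
set z := iter k sign_step y in h1 h2 h3 *.
have E : 1 - sign_step z = (1 - z) * (1 - z * (1 + z) / 2).
  by rewrite /sign_step; field.
have z1 : sign_step z <= 1.
  by rewrite -subr_ge0 E mulr_ge0//; [lra|nra].
split.
  apply/andP; split=> //; rewrite (le_trans h1)// -subr_ge0.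
  have -> : sign_step z - z = z * (1 - z) * (1 + z) / 2.
    by rewrite /sign_step; field.
  by rewrite divr_ge0// !mulr_ge0//; lra.
rewrite E exprSr ler_pM//; [lra|nra|nra].
Qed.

Lemma cvg_iter_sign_step (y : R) : `|y| <= 1 ->
  iter k sign_step y @[k --> \oo] --> Num.sg y.
Proof.
have H (x : R) : 0 < x -> x <= 1 -> iter k sign_step x @[k --> \oo] --> (1 : R).
  move=> x0 x1; have x01 : 0 <= x <= 1 by rewrite ltW.
  have G : (1 - x / 2) ^+ k @[k --> \oo] --> (0 : R).
    by apply: cvg_expr; rewrite ger0_norm; lra.
  apply: (@squeeze_cvgr _ _ _ _ (fun k => 1 - (1 - x / 2) ^+ k) (fun=> 1)).
  - apply: nearW => k; have [/andP[_ ->] h] := iter_sign_step_pos k x01.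
    by rewrite andbT; lra.
  - by rewrite -[X in _ --> X]subr0; apply: cvgB => //; exact: cvg_cst.
  - exact: cvg_cst.
rewrite ler_norml => /andP[h1 h2].
have [y0|y0|->] := ltgtP y 0.
- rewrite ltr0_sg//.
  rewrite (_ : (fun k => _) = (fun k => - iter k sign_step (- y))).
    by apply: cvgN; apply: H; [rewrite oppr_gt0|rewrite lerNl].
  by apply/funext => k; rewrite iter_sign_stepN opprK.
- by rewrite gtr0_sg//; exact: H.
- rewrite sgr0; apply: cvg_near_cst; apply: nearW => k.
  by elim: k => //= k ->; rewrite /sign_step; ring.
Qed.

(** [sign_step] is written with sums and scalar multiples alone, so that the closure lemmas match
    its shape. *)
Lemma even_trig_sign_step n k (f : ('I_n -> R) -> R) : even_trig f ->
  even_trig (fun u => iter k sign_step (f u)).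
Proof.
move=> ef; elim: k => //= k IH.
apply: even_trigZ; apply: even_trigD; first exact: even_trigZ.
by apply: even_trigZ; apply: even_trigM => //; exact: even_trigM.
Qed.

Lemma odd_trig_sign_step n k (f : ('I_n -> R) -> R) : odd_trig f ->
  odd_trig (fun u => iter k sign_step (f u)).
Proof.
move=> ef; elim: k => //= k IH.
apply: odd_trigZ; apply: odd_trigD; first exact: odd_trigZ.
by apply: odd_trigZ; apply: odd_even_trigM => //; exact: odd_trigM.
Qed.

(** Once k exceeds |x|, the argument lies in ]-pi, pi[, where the sine has the sign of its argument;
    the sequence is eventually constant. *)
Lemma cvg_sg_sin (x : R) : Num.sg (sin (x / k.+1%:R)) @[k --> \oo] --> Num.sg x.
Proof.
apply: cvg_near_cst; near=> k.
have k0 : 0 < (k.+1%:R : R) by [].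
have xk : `|x| < pi * k.+1%:R.
  have pi1 : 1 <= (pi : R) by rewrite (le_trans _ (pi_ge2 R))// ler1n.
  rewrite (@lt_le_trans _ _ (k.+1%:R))//; last by rewrite ler_peMl.
  rewrite (@le_lt_trans _ _ k%:R) ?ltr_nat//.
  by near: k; exact: nbhs_infty_ger.
have [x0|x0|->] := ltgtP x 0.
- rewrite (ltr0_sg x0) ltr0_sg// -oppr_gt0 -sinN sin_gt0_pi//.
  rewrite -mulNr divr_gt0 ?oppr_gt0//= ltr_pdivrMr//.
  by rewrite -(ltr0_norm x0).
- rewrite (gtr0_sg x0) gtr0_sg// sin_gt0_pi//.
  rewrite divr_gt0//= ltr_pdivrMr//.
  by rewrite -(gtr0_norm x0).
- by rewrite mul0r sin0.
Unshelve. all: by end_near. Qed.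

(** For large k both arguments, taken in absolute value, lie in [0, pi], where the cosine decreases.
    The division by 2 keeps the quantity in [-1, 1], the domain of [sign_step]. *)
Lemma cvg_sg_cos (x c : R) : 0 <= c ->
  Num.sg ((cos (x / k.+1%:R) - cos (c / k.+1%:R)) / 2) @[k --> \oo] -->
  Num.sg (c - `|x|).
Proof.
move=> c0; apply: cvg_near_cst; near=> k.
have k0 : 0 < (k.+1%:R : R) by [].
have pi1 : 1 <= (pi : R) by rewrite (le_trans _ (pi_ge2 R))// ler1n.
have xk : `|x| / k.+1%:R <= pi.
  rewrite ler_pdivrMr// (@le_trans _ _ (k.+1%:R))//; last by rewrite ler_peMl.
  rewrite (@le_trans _ _ k%:R) ?ler_nat//.
  by near: k; exact: nbhs_infty_ger.
have ck : c / k.+1%:R <= pi.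
  rewrite ler_pdivrMr// (@le_trans _ _ (k.+1%:R))//; last by rewrite ler_peMl.
  rewrite (@le_trans _ _ k%:R) ?ler_nat//.
  by near: k; exact: nbhs_infty_ger.
have -> : cos (x / k.+1%:R) = cos (`|x| / k.+1%:R).
  have [x0|x0] := leP 0 x; first by rewrite ger0_norm.
  by rewrite ltr0_norm// mulNr cosN.
have x0 : 0 <= `|x| / k.+1%:R by rewrite divr_ge0.
have ck0 : 0 <= c / k.+1%:R by rewrite divr_ge0.
have I1 : `|x| / k.+1%:R \in `[0, pi] by rewrite in_itv/= x0.
have I2 : c / k.+1%:R \in `[0, pi] by rewrite in_itv/= ck0.
have [h|h|h] := ltgtP c `|x|.
- rewrite [RHS]ltr0_sg ?subr_lt0// ltr0_sg// pmulr_llt0 ?invr_gt0// subr_lt0.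
  by rewrite ltr_cos// ltr_pM2r// invr_gt0.
- rewrite [RHS]gtr0_sg ?subr_gt0// gtr0_sg// pmulr_lgt0 ?invr_gt0// subr_gt0.
  by rewrite ltr_cos// ltr_pM2r// invr_gt0.
- by rewrite -h subrr mul0r subrr.
Unshelve. all: by end_near. Qed.

End SignApproximation.

Section IteratedLimits.
Context {d} {T : measurableType d} {R : realType} (P : probability T R).
Implicit Types (f g : T -> R).

Definition cov f g : R :=
  \int[P]_w (f w * g w) - \int[P]_w f w * \int[P]_w g w.

Lemma bounded_convergence2 (f_ : nat -> nat -> T -> R) (fl : nat -> T -> R) f :
  (forall k l, measurable_fun setT (f_ k l)) ->
  (forall k l w, `|f_ k l w| <= 1) ->
  (forall k w, f_ k l w @[l --> \oo] --> fl k w) ->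
  (forall w, fl k w @[k --> \oo] --> f w) ->
  [/\ measurable_fun setT f, forall w, `|f w| <= 1,
    forall k, \int[P]_w f_ k l w @[l --> \oo] --> \int[P]_w fl k w &
    \int[P]_w fl k w @[k --> \oo] --> \int[P]_w f w].
Proof.
move=> mf f1 cf1 cf2.
have H k := bounded_convergence P (mf k) (f1 k) (cf1 k).
have [m2 f2 c2] := bounded_convergence P
  (fun k => let: And3 m _ _ := H k in m) (fun k => let: And3 _ b _ := H k in b) cf2.
by split => // k; have [] := H k.
Qed.

(** The inner limit turns iterates into the sign of a periodic function, the outer one removes the
    periodicity. The products are bounded by 1 too, so every integral in the covariance passes to
    both limits. *)
Lemma cov_limit2 (f_ g_ : nat -> nat -> T -> R) (fl gl : nat -> T -> R) f g
    (B : R) :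
  (forall k l, measurable_fun setT (f_ k l)) ->
  (forall k l, measurable_fun setT (g_ k l)) ->
  (forall k l w, `|f_ k l w| <= 1) -> (forall k l w, `|g_ k l w| <= 1) ->
  (forall k w, f_ k l w @[l --> \oo] --> fl k w) ->
  (forall k w, g_ k l w @[l --> \oo] --> gl k w) ->
  (forall w, fl k w @[k --> \oo] --> f w) ->
  (forall w, gl k w @[k --> \oo] --> g w) ->
  (forall k l, `|cov (f_ k l) (g_ k l)| <= B) ->
  `|cov f g| <= B.
Proof.
move=> mf mg f1 g1 cf1 cg1 cf2 cg2 covB.
have [_ _ Cf1 Cf2] := bounded_convergence2 mf f1 cf1 cf2.
have [_ _ Cg1 Cg2] := bounded_convergence2 mg g1 cg1 cg2.
have [_ _ C1 C2] := @bounded_convergence2 (fun k l w => f_ k l w * g_ k l w)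
  (fun k w => fl k w * gl k w) (fun w => f w * g w)
  (fun k l => measurable_funM (mf k l) (mg k l))
  (fun k l w => ltac:(by rewrite normrM mulr_ile1))
  (fun k w => cvgM (cf1 k w) (cg1 k w))
  (fun w => cvgM (cf2 w) (cg2 w)).
have c1 k : `|cov (fl k) (gl k)| <= B.
  apply: (ler_cvg_to (cvg_norm (cvgB (C1 k) (cvgM (Cf1 k) (Cg1 k)))) (cvg_cst B)).
  by apply: nearW => l; exact: covB.
apply: (ler_cvg_to (cvg_norm (cvgB C2 (cvgM Cf2 Cg2))) (cvg_cst B)).
by apply: nearW => k; exact: c1.
Qed.
End IteratedLimits.

Section SignDecorrelation.
Context {R : realType}.

(** As l grows this tends to the square wave sgn (sin (x / (k + 1))), whose period grows with k;
    letting k grow then leaves sgn x. *)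
Definition sg_approx (k l : nat) (x : R) : R :=
  iter l sign_step (sin (x / k.+1%:R)).

Lemma sg_approx_norm k l x : `|sg_approx k l x| <= 1.
Proof. by apply: iter_sign_step_norm; rewrite ler_norml sin_geN1 sin_le1. Qed.

Lemma cvg_sg_approx k (x : R) :
  sg_approx k l x @[l --> \oo] --> Num.sg (sin (x / k.+1%:R)).
Proof. by apply: cvg_iter_sign_step; rewrite ler_norml sin_geN1 sin_le1. Qed.

Lemma dot_div n (a u : 'I_n -> R) (r : R) :
  dot a u / r = dot (fun i => a i / r) u.
Proof.
by rewrite /dot mulr_suml; apply: eq_bigr => i _; rewrite mulrAC.
Qed.

Lemma odd_trig_sg_approx n k l (a : 'I_n -> R) :
  odd_trig (fun u => sg_approx k l (dot a u)).
Proof.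
have [F H] := odd_trig_sign_step l (odd_trig_sin (fun i => a i / k.+1%:R)).
by exists F => u; rewrite -H /sg_approx dot_div.
Qed.

Definition sg_prod_approx n (a b : 'I_n -> R) k l (u : 'I_n -> R) : R :=
  sg_approx k l (dot a u) * sg_approx k l (dot b u).

Lemma sg_prod_approxE n (a b : 'I_n -> R) k l :
  exists F, forall u, sg_prod_approx a b k l u = cospoly F u.
Proof. by apply: odd_trigM; exact: odd_trig_sg_approx. Qed.

Lemma sg_prod_approx_norm n (a b : 'I_n -> R) k l u :
  `|sg_prod_approx a b k l u| <= 1.
Proof. by rewrite normrM mulr_ile1// sg_approx_norm. Qed.

(* The indicator of c < |x| is (z ^ 2 - z) / 2 for z the sign of c - |x|. *)
Definition exceed_approx n (a : 'I_n -> R) (c : R) k l (u : 'I_n -> R) : R :=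
  let z := iter l sign_step
    (2^-1 * (cos (dot (fun i => a i / k.+1%:R) u) + - cos (c / k.+1%:R))) in
  2^-1 * (z * z + - 1 * z).

Lemma exceed_approxE n (a : 'I_n -> R) c k l :
  exists F, forall u, exceed_approx a c k l u = cospoly F u.
Proof.
apply: even_trigZ.
have H : even_trig (fun u => iter l sign_step
    (2^-1 * (cos (dot (fun i => a i / k.+1%:R) u) + - cos (c / k.+1%:R)))).
  apply: even_trig_sign_step; apply: even_trigZ; apply: even_trigD.
    exact: even_trig_cos.
  exact: even_trig_cst.
apply: even_trigD; last exact: even_trigZ.
exact: even_trigM.
Qed.

Let cos_diff_norm (x y : R) : `|2^-1 * (cos x + - cos y)| <= 1.
Proof.
have := cos_geN1 x; have := cos_geN1 y; have := cos_le1 x; have := cos_le1 y.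
by rewrite ler_norml; move=> h1 h2 h3 h4; apply/andP; split; lra.
Qed.

Lemma exceed_approx_norm n (a : 'I_n -> R) c k l u :
  `|exceed_approx a c k l u| <= 1.
Proof.
rewrite /exceed_approx; set z := iter _ _ _.
have : `|z| <= 1 by apply: iter_sign_step_norm; exact: cos_diff_norm.
rewrite !ler_norml => /andP[h1 h2].
by apply/andP; split; nra.
Qed.

Lemma cvg_exceed_approx n (a : 'I_n -> R) (c : R) u : 0 <= c ->
  exists2 fl : nat -> R, forall k, exceed_approx a c k l u @[l --> \oo] --> fl k &
  fl k @[k --> \oo] --> ((c < `|dot a u|)%R%:R : R).
Proof.
move=> c0; pose z k : R := Num.sg ((cos (dot a u / k.+1%:R) - cos (c / k.+1%:R)) / 2).
exists (fun k => 2^-1 * (z k * z k + - 1 * z k)).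
  move=> k; have cz : iter l sign_step (2^-1 * (cos (dot (fun i => a i / k.+1%:R) u) +
      - cos (c / k.+1%:R))) @[l --> \oo] --> z k.
    rewrite /z dot_div [X in Num.sg X]mulrC.
    by apply: cvg_iter_sign_step; exact: cos_diff_norm.
  apply: cvgM; first exact: cvg_cst.
  by apply: cvgD; apply: cvgM => //; exact: cvg_cst.
have cz := @cvg_sg_cos _ (dot a u) c c0.
(* At |x| = c the sign z is 0 and so is (z^2 - z) / 2, in agreement with the strict inequality. *)
have -> : (c < `|dot a u|)%R%:R = 2^-1 * (Num.sg (c - `|dot a u|) * Num.sg (c - `|dot a u|) +
    - 1 * Num.sg (c - `|dot a u|)) :> R.
  have [h|h|h] := ltgtP c `|dot a u|.
  - by rewrite ltr0_sg ?subr_lt0//= mulr1n; field.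
  - by rewrite gtr0_sg ?subr_gt0//= mulr0n; field.
  - by rewrite h subrr sgr0/= mulr0n; field.
apply: cvgM; first exact: cvg_cst.
by apply: cvgD; apply: cvgM => //; exact: cvg_cst.
Qed.

Context {d} {T : measurableType d} (P : probability T R) {n : nat}.
Variables (U V : T -> 'I_n -> R) (M : 'I_n -> 'I_n -> R) (m : R).
Hypothesis mU : forall i, measurable_fun setT (U ^~ i).
Hypothesis mV : forall i, measurable_fun setT (V ^~ i).
Hypothesis UV : forall t s : 'I_n -> R,
  \int[P]_w cos (dot t (U w) + dot s (V w)) =
  expR (- (dot t t + dot s s + 2 * bilin M t s) / 2).
Hypothesis Mm : forall i j, `|M i j| <= m.
Hypothesis m0 : 0 <= m.

Let cov_cospoly (f g : ('I_n -> R) -> R) :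
  (exists F, forall u, f u = cospoly F u) ->
  (exists G, forall u, g u = cospoly G u) ->
  (forall u, `|f u| <= 1) -> (forall u, `|g u| <= 1) ->
  `|cov P (f \o U) (g \o V)| <= 2 * (n%:R * m) ^+ 2.
Proof.
move=> [F fF] [G gG] f1 g1.
rewrite (_ : f \o U = (fun w => cospoly F (U w))); last by apply/funext => w /=.
rewrite (_ : g \o V = (fun w => cospoly G (V w))); last by apply/funext => w /=.
apply: (gebelein_cospoly mU mV UV Mm m0) => w; [rewrite -fF|rewrite -gG].
  exact: f1.
exact: g1.
Qed.

Let measurable_trig (W : T -> 'I_n -> R) (f : ('I_n -> R) -> R) :
  (forall i, measurable_fun setT (W ^~ i)) ->
  (exists F, forall u, f u = cospoly F u) -> measurable_fun setT (f \o W).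
Proof.
move=> mW [F fF]; rewrite (_ : f \o W = fun w => cospoly F (W w)).
  exact: measurable_cospoly.
by apply/funext => w /=.
Qed.

Lemma cov_sg_prod (a b a' b' : 'I_n -> R) :
  `|cov P (fun w => Num.sg (dot a (U w)) * Num.sg (dot b (U w)))
          (fun w => Num.sg (dot a' (V w)) * Num.sg (dot b' (V w)))|
  <= 2 * (n%:R * m) ^+ 2.
Proof.
apply: (@cov_limit2 _ _ _ P (fun k l => sg_prod_approx a b k l \o U)
  (fun k l => sg_prod_approx a' b' k l \o V)
  (fun k w => Num.sg (sin (dot a (U w) / k.+1%:R)) *
              Num.sg (sin (dot b (U w) / k.+1%:R)))
  (fun k w => Num.sg (sin (dot a' (V w) / k.+1%:R)) *
              Num.sg (sin (dot b' (V w) / k.+1%:R)))).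
- by move=> k l; apply: measurable_trig => //; exact: sg_prod_approxE.
- by move=> k l; apply: measurable_trig => //; exact: sg_prod_approxE.
- by move=> k l w; exact: sg_prod_approx_norm.
- by move=> k l w; exact: sg_prod_approx_norm.
- by move=> k w; apply: cvgM; exact: cvg_sg_approx.
- by move=> k w; apply: cvgM; exact: cvg_sg_approx.
- by move=> w; apply: cvgM; exact: cvg_sg_sin.
- by move=> w; apply: cvgM; exact: cvg_sg_sin.
- move=> k l; apply: cov_cospoly; try exact: sg_prod_approxE;
    exact: sg_prod_approx_norm.
Qed.

Lemma cov_exceed (a a' : 'I_n -> R) (c : R) : 0 <= c ->
  `|cov P (fun w => (c < `|dot a (U w)|)%R%:R) (fun w => (c < `|dot a' (V w)|)%R%:R)|
  <= 2 * (n%:R * m) ^+ 2.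
Proof.
move=> c0.
have /choice[fl Hf] w : exists fl : nat -> R,
    (forall k, exceed_approx a c k l (U w) @[l --> \oo] --> fl k) /\
    fl k @[k --> \oo] --> ((c < `|dot a (U w)|)%R%:R : R).
  by have [fl] := cvg_exceed_approx a (U w) c0; exists fl.
have /choice[gl Hg] w : exists gl : nat -> R,
    (forall k, exceed_approx a' c k l (V w) @[l --> \oo] --> gl k) /\
    gl k @[k --> \oo] --> ((c < `|dot a' (V w)|)%R%:R : R).
  by have [gl] := cvg_exceed_approx a' (V w) c0; exists gl.
apply: (@cov_limit2 _ _ _ P (fun k l => exceed_approx a c k l \o U)
  (fun k l => exceed_approx a' c k l \o V) (fun k w => fl w k) (fun k w => gl w k)).
- by move=> k l; apply: measurable_trig => //; exact: exceed_approxE.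
- by move=> k l; apply: measurable_trig => //; exact: exceed_approxE.
- by move=> k l w; exact: exceed_approx_norm.
- by move=> k l w; exact: exceed_approx_norm.
- by move=> k w; have [H _] := Hf w; exact: H.
- by move=> k w; have [H _] := Hg w; exact: H.
- by move=> w; have [_] := Hf w.
- by move=> w; have [_] := Hg w.
- move=> k l; apply: cov_cospoly; try exact: exceed_approxE;
    exact: exceed_approx_norm.
Qed.

End SignDecorrelation.

(** * Sheppard's formula *)

Section AdditiveUnit.
Context {R : realType}.

(** Cauchy's functional equation: nonnegativity and additivity make h monotone, additivity and h 1 =
    1 fix its values at k / (n + 1), and monotonicity squeezes the remaining ones. *)
Lemma additive_unit_interval (h : R -> R) :
  (forall x, 0 <= x <= 1 -> 0 <= h x) ->
  (forall x y, 0 <= x -> 0 <= y -> x + y <= 1 -> h (x + y) = h x + h y) ->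
  h 1 = 1 -> forall x, 0 <= x <= 1 -> h x = x.
Proof.
move=> h0 hD h1 x /andP[x0]; rewrite le_eqVlt => /predU1P[->//|x1].
have hmono y z : 0 <= y -> y <= z -> z <= 1 -> h y <= h z.
  move=> y0 yz z1; rewrite -(subrKC y z) hD ?subrKC ?subr_ge0//.
  rewrite lerDl h0// subr_ge0 yz/=.
  by rewrite (le_trans _ z1)// gerBl.
have hmul (n k : nat) : (k <= n.+1)%N ->
    h (k%:R * n.+1%:R^-1) = k%:R * h n.+1%:R^-1.
  elim: k => [|k IH] kn.
    rewrite !mul0r; have := hD 0 0 (lexx _) (lexx _).
    by rewrite addr0 => /(_ ler01)/eqP; rewrite addrC -subr_eq subrr => /eqP <-.
  rewrite -natr1 !mulrDl !mul1r hD//.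
  - by rewrite IH// ltnW.
  - by rewrite -[X in _ + X]mul1r -mulrDl ler_pdivrMr// mul1r natr1 ler_nat.
have hk (n k : nat) : (k <= n.+1)%N -> h (k%:R / n.+1%:R) = k%:R / n.+1%:R.
  move=> kn; rewrite hmul//; congr (_ * _).
  have := hmul n n.+1 (leqnn _); rewrite divff ?pnatr_eq0// h1 => H.
  by apply: (@mulfI _ n.+1%:R); rewrite ?pnatr_eq0// -H divff ?pnatr_eq0.
apply/eqP; rewrite -subr_eq0 -normr_le0; apply/ler_addgt0Pr => e e0.
rewrite add0r; pose n := Num.truncn e^-1.
have en : n.+1%:R^-1 <= e.
  rewrite -[leRHS]invrK lef_pV2 ?posrE ?invr_gt0//.
  by apply: ltW; rewrite truncnS_gt.
apply: le_trans en; pose k := Num.truncn (x * n.+1%:R).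
have xn0 : 0 <= x * n.+1%:R by rewrite mulr_ge0.
have /andP[k1 k2] := truncn_itv xn0; rewrite -/k in k1 k2.
have kn : (k < n.+1)%N.
  rewrite -(ltr_nat R) (le_lt_trans k1)// -[ltRHS]mul1r ltr_pM2r//.
have kx : k%:R / n.+1%:R <= x by rewrite ler_pdivrMr.
have xk : x <= k.+1%:R / n.+1%:R by rewrite ler_pdivlMr// ltW.
have l1 : h (k%:R / n.+1%:R) <= h x by apply: hmono => //; rewrite ?divr_ge0// ltW.
have l2 : h x <= h (k.+1%:R / n.+1%:R).
  by apply: hmono => //; rewrite ler_pdivrMr// mul1r ler_nat.
rewrite hk ?(ltnW kn)// in l1; rewrite hk// in l2.
rewrite -natr1 mulrDl mul1r in xk l2.
move: l1 l2 kx xk; set q := k%:R / _; set i := n.+1%:R^-1 => l1 l2 kx xk.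
by rewrite ler_norml; apply/andP; split; clear -l1 l2 kx xk; lra.
Qed.
End AdditiveUnit.

Section SignCharacteristic.
Context {R : realType}.

(** The expectations of cosines determine those of all [sg_prod_approx], and the iterated limit
    preserves the equality. This stands in for an equality of joint laws when rotation invariance is
    needed. *)
Lemma sg_prod_char d d' (T : measurableType d) (T' : measurableType d')
    (P : probability T R) (Q : probability T' R) (n : nat)
    (U : T -> 'I_n -> R) (V : T' -> 'I_n -> R) (a b : 'I_n -> R) :
  (forall i, measurable_fun setT (U ^~ i)) ->
  (forall i, measurable_fun setT (V ^~ i)) ->
  (forall t, \int[P]_w cos (dot t (U w)) = \int[Q]_w cos (dot t (V w))) ->
  \int[P]_w (Num.sg (dot a (U w)) * Num.sg (dot b (U w))) =
  \int[Q]_w (Num.sg (dot a (V w)) * Num.sg (dot b (V w))).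
Proof.
move=> mU mV UV.
have cospolyE F : \int[P]_w cospoly F (U w) = \int[Q]_w cospoly F (V w).
  rewrite !Rintegral_sum => [|c|c].
  - apply: eq_bigr => c _; rewrite !RintegralZl ?UV//.
      exact/integrable_cos/measurable_dot.
    exact/integrable_cos/measurable_dot.
  - exact/integrableZ/integrable_cos/measurable_dot.
  - exact/integrableZ/integrable_cos/measurable_dot.
have lim d0 (T0 : measurableType d0) (P0 : probability T0 R) (W : T0 -> 'I_n -> R) :
    (forall i, measurable_fun setT (W ^~ i)) ->
    exists2 fl : nat -> R,
    forall k, \int[P0]_w sg_prod_approx a b k l (W w) @[l --> \oo] --> fl k &
    fl k @[k --> \oo] --> \int[P0]_w (Num.sg (dot a (W w)) * Num.sg (dot b (W w))).
  move=> mW.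
  have := @bounded_convergence2 _ _ _ P0 (fun k l => sg_prod_approx a b k l \o W)
    (fun k w => Num.sg (sin (dot a (W w) / k.+1%:R)) *
              Num.sg (sin (dot b (W w) / k.+1%:R)))
    (fun w => Num.sg (dot a (W w)) * Num.sg (dot b (W w))).
  case.
  - move=> k l; have [F FE] := sg_prod_approxE a b k l.
    rewrite (_ : _ \o _ = fun w => cospoly F (W w)).
      exact: measurable_cospoly.
    by apply/funext => w /=.
  - by move=> k l w; exact: sg_prod_approx_norm.
  - by move=> k w; apply: cvgM; exact: cvg_sg_approx.
  - by move=> w; apply: cvgM; exact: cvg_sg_sin.
  - by move=> _ _ h1 h2; eexists; [exact: h1|exact: h2].
have [f1 F1 F2] := lim _ _ P U mU; have [f2 G1 G2] := lim _ _ Q V mV.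
have E : f1 = f2.
  apply/funext => k; apply: (cvg_unique _ (F1 k)) => //.
  rewrite (_ : (fun l => \int[P]_w sg_prod_approx a b k l (U w)) =
    (fun l => \int[Q]_w sg_prod_approx a b k l (V w))); first exact: G1.
  apply/funext => l; have [F FE] := sg_prod_approxE a b k l.
  under eq_Rintegral do rewrite FE.
  by rewrite cospolyE; apply: eq_Rintegral => w _; rewrite FE.
by apply: (cvg_unique _ F2) => //; rewrite E.
Qed.
End SignCharacteristic.

Section Sheppard.
Context {d} {T : measurableType d} {R : realType} (P : probability T R).

Lemma Rintegral_ae_eq (f g : T -> R) :
  measurable_fun setT f -> measurable_fun setT g ->
  {ae P, forall w, f w = g w} -> \int[P]_w f w = \int[P]_w g w.
Proof.
move=> mf mg fg; rewrite /Rintegral; congr fine.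
apply: ae_eq_integral => //; [exact/measurable_EFinP|exact/measurable_EFinP|].
by apply: filterS fg => w ->.
Qed.

Definition vec2 (x y : R) : 'I_2 -> R := fun i => if i == 0 then x else y.

Lemma dot_vec2 (t : 'I_2 -> R) (x y : R) :
  dot t (vec2 x y) = t 0 * x + t 1 * y.
Proof. by rewrite /dot !big_ord_recl big_ord0 addr0; congr (_ + t _ * _); exact: val_inj. Qed.

Lemma measurable_sg : measurable_fun setT (@Num.sg R).
Proof.
apply: nondecreasing_measurable => // x y xy.
have [x0|x0|x0] := sgrP x; have [y0|y0|y0] := sgrP y; rewrite ?lexx ?ler01//;
  lra.
Qed.

Variables (X Y : T -> R) (rho : R).
Hypotheses (mX : measurable_fun setT X) (mY : measurable_fun setT Y).
Hypothesis rho1 : -1 < rho < 1.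
Hypothesis XY : forall t s : R, \int[P]_w cos (t * X w + s * Y w) =
  expR (- (t ^+ 2 + s ^+ 2 + 2 * rho * t * s) / 2).
Hypothesis XY0 : forall t s : R, (t != 0) || (s != 0) ->
  P [set w | t * X w + s * Y w = 0] = 0%E.

Let theta := acos rho.
Let rhoI : -1 <= rho <= 1. Proof. by case/andP: rho1 => *; rewrite !ltW. Qed.
Let cos_theta : cos theta = rho. Proof. exact: acosK. Qed.
Let sin_theta : 0 < sin theta.
Proof.
case/andP: rho1 => r1 r2; apply: sin_gt0_pi; apply/andP; split.
  by apply: acos_gt0; rewrite ltW.
by apply: acos_ltpi; rewrite r1 ltW.
Qed.

(* Rotation of X by the angle phi in the plane spanned by X and Y, where Y is
   X rotated by theta. *)
Let rot (phi : R) (w : T) : R :=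
  (sin (theta - phi) / sin theta) * X w + (sin phi / sin theta) * Y w.

(** X and (Y - cos theta X) / sin theta are uncorrelated with unit variance, so phi is a polar angle
    in orthonormal coordinates. *)
Let rotE phi w : rot phi w =
  cos phi * X w + sin phi * ((Y w - cos theta * X w) / sin theta).
Proof. by rewrite /rot sinB; field; rewrite gt_eqF. Qed.

Let measurable_rot phi : measurable_fun setT (rot phi).
Proof. by apply: measurable_funD; exact: measurable_funM. Qed.

Let rot_char phi psi (t s : R) : \int[P]_w cos (t * rot phi w + s * rot psi w) =
  expR (- (t ^+ 2 + s ^+ 2 + 2 * t * s * cos (phi - psi)) / 2).
Proof.
transitivity (\int[P]_w cos
  ((t * sin (theta - phi) + s * sin (theta - psi)) / sin theta * X w +
   (t * sin phi + s * sin psi) / sin theta * Y w)).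
  apply: eq_Rintegral => w _; congr cos; rewrite /rot; field.
  by rewrite gt_eqF.
rewrite XY; congr (expR (- _ / 2)); rewrite !sinB cosB -cos_theta.
have := cos2Dsin2 theta; have := cos2Dsin2 phi; have := cos2Dsin2 psi.
have /gt_eqF/negbT : 0 < sin theta := sin_theta.
move: (cos theta) (sin theta) (cos phi) (sin phi) (cos psi) (sin psi).
move=> c r a b a' b' r0 h1 h2 h3.
have -> : ((t * (r * a - c * b) + s * (r * a' - c * b')) / r) ^+ 2 +
   ((t * b + s * b') / r) ^+ 2 +
   2 * c * ((t * (r * a - c * b) + s * (r * a' - c * b')) / r) *
   ((t * b + s * b') / r) =
   (t * a + s * a') ^+ 2 + (1 - c ^+ 2) / r ^+ 2 * (t * b + s * b') ^+ 2.
  by field.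
rewrite (_ : 1 - c ^+ 2 = r ^+ 2); last by rewrite -h3 addrAC subrr add0r.
rewrite divff ?expf_neq0// mul1r.
have -> : (t * a + s * a') ^+ 2 + (t * b + s * b') ^+ 2 =
  t ^+ 2 * (a ^+ 2 + b ^+ 2) + s ^+ 2 * (a' ^+ 2 + b' ^+ 2) +
  2 * t * s * (a * a' + b * b') by ring.
by rewrite h1 h2 !mulr1.
Qed.

Let A phi := \int[P]_w (Num.sg (rot 0 w) * Num.sg (rot phi w)).

(** Rotation invariance: [rot_char] involves the two angles only through the cosine of their
    difference. *)
Let A_shift phi psi :
  \int[P]_w (Num.sg (rot phi w) * Num.sg (rot psi w)) = A (psi - phi).
Proof.
have dot1 (x y : R) : dot (vec2 1 0) (vec2 x y) = x :> R.
  by rewrite dot_vec2 /vec2/= mul1r mul0r addr0.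
have dot2 (x y : R) : dot (vec2 0 1) (vec2 x y) = y :> R.
  by rewrite dot_vec2 /vec2/= mul1r mul0r add0r.
have := @sg_prod_char R _ _ _ _ P P 2 (fun w => vec2 (rot phi w) (rot psi w))
  (fun w => vec2 (rot 0 w) (rot (psi - phi) w)) (vec2 1 0) (vec2 0 1).
have E (phi' psi' : R) :
    \int[P]_w (Num.sg (dot (vec2 1 0) (vec2 (rot phi' w) (rot psi' w))) *
      Num.sg (dot (vec2 0 1) (vec2 (rot phi' w) (rot psi' w)))) =
    \int[P]_w (Num.sg (rot phi' w) * Num.sg (rot psi' w)).
  by apply: eq_Rintegral => w _; congr (Num.sg _ * Num.sg _); [exact: dot1|exact: dot2].
rewrite !E; apply.
- by move=> i; rewrite /vec2; case: (i == 0); exact: measurable_rot.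
- by move=> i; rewrite /vec2; case: (i == 0); exact: measurable_rot.
- move=> t; under eq_Rintegral do rewrite dot_vec2.
  under [RHS]eq_Rintegral do rewrite dot_vec2.
  by rewrite !rot_char sub0r cosN -cosN opprB.
Qed.

Let rot_neq0 phi : {ae P, forall w, rot phi w != 0}.
Proof.
exists [set w | rot phi w = 0]; split.
- by rewrite -[X in measurable X]setTI; exact: (measurable_rot phi _ (measurable_set1 0)).
(* If both coefficients vanished, then sin phi = 0 and sin theta cos phi = 0, against cos^2 + sin^2
   = 1. *)
- apply: XY0; rewrite -negb_and; apply/negP => /andP[].
  rewrite !mulf_eq0 !invr_eq0 !(gt_eqF sin_theta) !orbF sinB => /eqP h1 /eqP h2.
  have := cos2Dsin2 phi; move: h1; rewrite h2 mulr0 subr0 => /eqP.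
  rewrite mulf_eq0 (gt_eqF sin_theta)/= => /eqP ->.
  by rewrite !expr0n/= addr0 => /eqP; rewrite eq_sym oner_eq0.
- by move=> w /= /negP; rewrite negbK => /eqP.
Qed.

(** For angles with a + b <= pi the coefficients are nonnegative: the middle variable lies in the
    cone spanned by the two outer ones and cannot oppose a sign that they share. *)
Let rot_interp a b w :
  sin (a + b) * rot a w = sin b * rot 0 w + sin a * rot (a + b) w.
Proof.
rewrite !rotE cos0 sin0; set z := _ / _; rewrite mul1r mul0r addr0.
have := cos2Dsin2 a; rewrite sinD cosD; move: (cos a) (sin a) (cos b) (sin b).
move=> ca sa cb sb h.
have -> : sb * X w = sb * (ca ^+ 2 + sa ^+ 2) * X w by rewrite h mulr1.
by ring.
Qed.

Let rot0 w : rot 0 w = X w.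
Proof. by rewrite rotE cos0 sin0 mul1r mul0r addr0. Qed.

Let rot_theta w : rot theta w = Y w.
Proof.
by rewrite /rot subrr sin0 mul0r mul0r add0r divff ?mul1r// gt_eqF.
Qed.

Let rot_pi w : rot pi w = - rot 0 w.
Proof. by rewrite !rotE cospi sinpi cos0 sin0; ring. Qed.

(** For signs x, y, z equal to 1 or -1, x y + y z - x z differs from 1 only if x = z = - y, which
    [rot_interp] excludes. *)
Let sg_rot_identity a b w : 0 <= a -> 0 <= b -> a + b <= pi ->
  rot 0 w != 0 -> rot a w != 0 -> rot (a + b) w != 0 ->
  Num.sg (rot 0 w) * Num.sg (rot a w) + Num.sg (rot a w) * Num.sg (rot (a + b) w)
  - Num.sg (rot 0 w) * Num.sg (rot (a + b) w) = 1.
Proof.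
move=> a0 b0 ab; have := rot_interp a b w; have := rot_pi w.
(* The interpolation degenerates when sin (a + b) = 0. At a + b = pi the last variable is the
   opposite of the first, at a + b = 0 all three coincide. *)
move=> rpi; have [abpi|abpi] := eqVneq (a + b) pi.
  rewrite abpi rpi sgrN => _ x0 _ _.
  have h : Num.sg (rot 0 w) ^+ 2 = 1 by rewrite sqr_sg x0.
  by rewrite -h; ring.
have abltpi : a + b < pi by rewrite lt_neqAle abpi.
have [ab0|ab0] := eqVneq (a + b) 0.
  have aE : a = 0 by lra.
  rewrite ab0 aE => _ x0 _ _.
  have h : Num.sg (rot 0 w) ^+ 2 = 1 by rewrite sqr_sg x0.
  by rewrite -h; ring.
have sab : 0 < sin (a + b) by rewrite sin_gt0_pi// abltpi andbT lt_neqAle eq_sym ab0 addr_ge0.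
have sa : 0 <= sin a by rewrite sin_ge0_pi// a0/=; lra.
have sb : 0 <= sin b by rewrite sin_ge0_pi// b0/=; lra.
move: (rot 0 w) (rot a w) (rot (a + b) w) => x y z E x0 y0 z0.
have [hx|hx|hx] := sgrP x; have [hy|hy|hy] := sgrP y; have [hz|hz|hz] := sgrP z;
  rewrite ?hx ?hy ?hz ?eqxx// in x0 y0 z0 *; try lra; exfalso; nra.
Qed.

Let A_add a b : 0 <= a -> 0 <= b -> a + b <= pi ->
  1 - A (a + b) = (1 - A a) + (1 - A b).
Proof.
move=> a0 b0 ab.
have isg phi psi : P.-integrable setT
    (EFin \o (fun w => Num.sg (rot phi w) * Num.sg (rot psi w))).
  apply: (@bounded_integrable _ _ _ P _ 1).
    by apply: measurable_funM; apply: (measurableT_comp measurable_sg).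
  by move=> w; rewrite normrM mulr_ile1// normr_sg lern1 leq_b1.
have : \int[P]_w (Num.sg (rot 0 w) * Num.sg (rot a w) +
     Num.sg (rot a w) * Num.sg (rot (a + b) w) +
     - 1 * (Num.sg (rot 0 w) * Num.sg (rot (a + b) w))) = 1.
  rewrite -[RHS](Rintegral_prob_cst P); apply: Rintegral_ae_eq => //.
    apply: measurable_funD; [apply: measurable_funD|apply: measurable_funM => //];
      by apply: measurable_funM; apply: (measurableT_comp measurable_sg).
  apply: filterS3 (rot_neq0 0) (rot_neq0 a) (rot_neq0 (a + b)) => w h1 h2 h3.
  by rewrite mulN1r sg_rot_identity.
rewrite RintegralD//; last 2 first.
- exact: integrableDR.
- exact: integrableZ.
rewrite RintegralD// RintegralZl// !A_shift !subr0 [a + b - a]addrAC subrr add0r.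
by lra.
Qed.

(** The probability (1 - A phi) / 2 that [rot 0] and [rot phi] have different signs is additive in
    phi and equals 1 at pi, so it is phi / pi. At theta = acos rho this gives the expectation 1 - 2
    theta / pi, and sin (pi / 2 - theta) = cos theta. *)
Lemma sheppard :
  sin (pi / 2 * \int[P]_w (Num.sg (X w) * Num.sg (Y w))) = rho.
Proof.
pose h x := (1 - A (pi * x)) / 2.
have A1 phi : `|A phi| <= 1.
  apply: Rintegral_abs_le.
    by apply: measurable_funM; apply: (measurableT_comp measurable_sg).
  by move=> w; rewrite normrM mulr_ile1// normr_sg lern1 leq_b1.
have pi0 : 0 < (pi : R) := pi_gt0 R.
have Api : A pi = - 1.
  rewrite -[RHS](Rintegral_prob_cst P); apply: Rintegral_ae_eq => //.
    by apply: measurable_funM; apply: (measurableT_comp measurable_sg).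
  apply: filterS (rot_neq0 0) => w h1.
  by rewrite rot_pi sgrN mulrN -expr2 sqr_sg h1.
have H x : 0 <= x <= 1 -> h x = x.
  apply: additive_unit_interval.
  - move=> {}x _; rewrite divr_ge0// subr_ge0.
    by rewrite (le_trans (ler_norm _)).
  - move=> {}x y x0 y0 xy; rewrite /h mulrDr A_add ?mulr_ge0 ?(ltW pi0)//.
      by rewrite mulrDl.
    by rewrite -mulrDr ler_piMr// ltW.
  - by rewrite /h mulr1 Api; field.
have Hth : h (theta / pi) = theta / pi.
  apply: H; rewrite divr_ge0 ?(ltW pi0) ?acos_ge0//= ler_pdivrMr// mul1r.
  exact: acos_lepi.
have : A theta = 1 - 2 * theta / pi.
  move: Hth; rewrite /h (mulrC pi) divfK ?gt_eqF// => E.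
  by rewrite -mulrA -E; field.
rewrite /A; under eq_Rintegral do rewrite rot0 rot_theta.
move=> ->; have -> : pi / 2 * (1 - 2 * theta / pi) = pi / 2 - theta.
  have aux (p t : R) : 0 < p -> p / 2 * (1 - 2 * t / p) = p / 2 - t.
    by move=> /lt0r_neq0 p0; field.
  exact: aux.
by rewrite -cosBpihalf addrAC subrr add0r cosN cos_theta.
Qed.

End Sheppard.

(** * Independence and Laplace noise *)

Section ProductExpectation.
Context {d} {T : measurableType d} {R : realType} (P : probability T R).
Variables Y Z : T -> R.
Hypotheses (mY : measurable_fun setT Y) (mZ : measurable_fun setT Z).
Hypothesis YZ : forall A B : set R, measurable A -> measurable B ->
  P (Y @^-1` A `&` Z @^-1` B) = (P (Y @^-1` A) * P (Z @^-1` B))%E.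

(** Independence on rectangles identifies the joint law with the product of the marginals; Fubini's
    theorem factors the integral. *)
Lemma indep_RintegralM : P.-integrable setT (EFin \o Y) ->
  P.-integrable setT (EFin \o Z) ->
  P.-integrable setT (EFin \o (fun w => Y w * Z w)) ->
  \int[P]_w (Y w * Z w) = \int[P]_w Y w * \int[P]_w Z w.
Proof.
move=> iY iZ iYZ.
pose Y' : {mfun T >-> R} := mfun_Sub (mem_set mY : Y \in mfun).
pose Z' : {mfun T >-> R} := mfun_Sub (mem_set mZ : Z \in mfun).
pose nuY := distribution P Y'; pose nuZ := distribution P Z'.
have mYZ : measurable_fun setT (fun w => (Y w, Z w)).
  exact: measurable_fun_pair.
pose nu : {measure set (R * R) -> \bar R} :=
  measure_function_pushforward__canonical__measure_function_Measure P mYZ.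
have E X : measurable X -> (nuY \x nuZ)%E X = nu X.
  by apply: product_measure_unique => A B mA mB; exact: YZ.
pose f (z : R * R) := (z.1 * z.2)%:E.
have mf : measurable_fun setT f.
  by apply/measurable_EFinP; apply: measurable_funM.
have intnu : nu.-integrable setT f by apply: integrable_pushforward.
have intprod : (nuY \x nuZ)%E.-integrable setT f.
  apply/integrableP; split => //; have /integrableP[_] := intnu.
  by rewrite (eq_measure_integral (nuY \x nuZ)%E)// => A mA _; rewrite -E.
have iEnu : (\int[nu]_z f z = \int[P]_w (Y w * Z w)%:E)%E.
  by rewrite integral_pushforward.
have iY' : nuY.-integrable setT EFin by exact: integrable_pushforward.
have iZ' : nuZ.-integrable setT EFin by exact: integrable_pushforward.
have EY : (\int[nuY]_y y%:E = \int[P]_w (Y w)%:E)%E by rewrite integral_pushforward.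
have EZ : (\int[nuZ]_y y%:E = \int[P]_w (Z w)%:E)%E by rewrite integral_pushforward.
have fZ : (\int[P]_w (Z w)%:E)%E \is a fin_num by exact: integrable_fin_num.
have fY : (\int[P]_w (Y w)%:E)%E \is a fin_num by exact: integrable_fin_num.
rewrite /Rintegral -fineM// -iEnu; congr fine.
rewrite (eq_measure_integral (nuY \x nuZ)%E) => [|A mA _]; last by rewrite -E.
rewrite -(integral12_prod_meas1 intprod) -EY -(fineK fZ) -integralZr//.
apply: eq_integral => y _; rewrite /fubini_F /f/=.
under eq_integral do rewrite EFinM.
by rewrite integralZl// EZ fineK.
Qed.
End ProductExpectation.

Section GeneratedSigma.
Context {d} {T : measurableType d} {R : realType} (P : probability T R).

Definition generators (I : choiceType) (D : set I) (Y : I -> {RV P >-> R}) : set (set T) :=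
  \bigcup_(i in D) preimage_set_system setT (Y i) measurable.

(** Expressed over [g_sigma_algebraType], so that the closure properties of measurable functions
    apply to functions of the family. *)
Definition sigma_measurable (I : choiceType) (D : set I)
    (Y : I -> {RV P >-> R}) (Z : T -> R) :=
  measurable_fun setT (Z : g_sigma_algebraType (generators D Y) -> R).

Lemma generators_measurable (I : choiceType) (D : set I)
    (Y : I -> {RV P >-> R}) : generators D Y `<=` measurable.
Proof.
by move=> A [i _ [B mB <-]]; apply: (measurable_funP (Y i)).
Qed.

Lemma sigma_measurable_preimage (I : choiceType) (D : set I)
    (Y : I -> {RV P >-> R}) Z (B : set R) : sigma_measurable D Y Z ->
  measurable B -> <<s generators D Y >> (Z @^-1` B).
Proof. by move=> mZ mB; have := mZ measurableT _ mB; rewrite setTI. Qed.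

Lemma sigma_measurableW (I : choiceType) (D : set I)
    (Y : I -> {RV P >-> R}) Z : sigma_measurable D Y Z -> measurable_fun setT Z.
Proof.
move=> mZ _ B mB; rewrite setTI.
have := sigma_measurable_preimage mZ mB.
by apply: smallest_sub; [exact: sigma_algebra_measurable|exact: generators_measurable].
Qed.

Lemma sigma_measurable_RV (I : choiceType) (D : set I)
    (Y : I -> {RV P >-> R}) i : D i -> sigma_measurable D Y (Y i).
Proof.
move=> Di _ B mB; apply: sub_sigma_algebra; exists i => //.
by exists B.
Qed.

Lemma indep_generated_RintegralM (I J : choiceType) (D : set I) (E : set J)
    (Y : I -> {RV P >-> R}) (Z : J -> {RV P >-> R}) (f g : T -> R) :
  independent_systems P (generated_sigma D Y) (generated_sigma E Z) ->
  sigma_measurable D Y f -> sigma_measurable E Z g ->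
  P.-integrable setT (EFin \o f) -> P.-integrable setT (EFin \o g) ->
  P.-integrable setT (EFin \o (fun w => f w * g w)) ->
  \int[P]_w (f w * g w) = \int[P]_w f w * \int[P]_w g w.
Proof.
move=> ind mf mg; apply: indep_RintegralM.
- exact: sigma_measurableW mf.
- exact: sigma_measurableW mg.
- by move=> A B mA mB; apply: ind; exact: sigma_measurable_preimage.
Qed.

Section Lone.
Variables (I : choiceType) (D : set I) (Y : I -> {RV P >-> R}).
Variables (J : {fset I}) (a : I).
Hypotheses (ind : mutually_independent D Y) (Da : D a) (JD : [set` J] `<=` D).
Hypothesis aJ : a \notin J.

(** Mutual independence speaks of cylinders. These form a pi-system containing the generators, and
    the two sides are finite measures in E that agree on it, so they agree on the generated
    sigma-algebra. *)
Lemma lone_independent (A : set R) (E : set T) : measurable A ->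
  <<s generators [set` J] Y >> E ->
  P (Y a @^-1` A `&` E) = (P (Y a @^-1` A) * P E)%E.
Proof.
move=> mA; have mYA : measurable (Y a @^-1` A).
  by rewrite -[X in measurable X]setTI; exact: measurable_funP.
pose C : set (set T) := [set E | exists2 B : I -> set R,
  (forall i, measurable (B i)) & E = \bigcap_(i in [set` J]) (Y i @^-1` B i)].
have Cm : C `<=` measurable.
  move=> _ [B mB ->]; rewrite bigcap_fset; apply: bigsetI_measurable => i _.
  by rewrite -[X in measurable X]setTI; exact: measurable_funP.
have sub : generators [set` J] Y `<=` C.
  move=> _ [j Jj [B mB <-]]; exists (fun i => if i == j then B else setT).
    by move=> i; case: ifP.
  rewrite setTI; apply/seteqP; split=> [w Yw i _ /=|w /(_ j Jj)/=].
    by case: eqVneq => // ->.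
  by rewrite eqxx.
move=> GE; have CE : <<s C >> E by apply: sub_sigma_algebra2 GE.
pose m1 : {measure set T -> \bar R} := mrestr P mYA.
have r0 : 0 <= fine (P (Y a @^-1` A)) by exact: fine_ge0.
pose m2 : {measure set T -> \bar R} := mscale (NngNum r0) P.
have fA : P (Y a @^-1` A) \is a fin_num by exact: fin_num_measure.
have m1E X : m1 X = P (Y a @^-1` A `&` X) by rewrite setIC.
have m2E X : m2 X = (P (Y a @^-1` A) * P X)%E by rewrite -[in RHS](fineK fA).
rewrite -m1E -m2E.
apply: (@g_sigma_algebra_measure_unique _ _ _ C Cm (fun=> setT)) => //.
- move=> _; exists (fun=> setT) => //.
  by rewrite bigcapT.
- by rewrite bigcup_const//; exists 0%N.
- move=> _ _ [B1 mB1 ->] [B2 mB2 ->]; exists (fun i => B1 i `&` B2 i).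
    by move=> i; exact: measurableI.
  by rewrite -bigcapI.
- move=> _ [B mB ->]; rewrite m1E m2E.
  have aJD : [set` finmap.fsetU (finmap.fset1 a) J] `<=` D.
    by move=> i /=; rewrite !inE => /orP[/eqP ->//|iJ]; exact: JD.
  pose B' i := if i == a then A else B i.
  have mB' i : measurable (B' i) by rewrite /B'; case: ifP.
  have := ind aJD mB'.
  rewrite bigcap_fsetU1 big_fsetU1//=.
  have -> : B' a = A by rewrite /B' eqxx.
  have Bi i : i \in J -> B' i = B i.
    by rewrite /B'; case: eqVneq => // -> ; rewrite (negbTE aJ).
  have -> : \bigcap_(i in [set` J]) (Y i @^-1` B' i) =
            \bigcap_(i in [set` J]) (Y i @^-1` B i).
    by apply: eq_bigcapr => i /= iJ; rewrite Bi.
  move=> ->; congr (_ * _)%E.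
  by rewrite (ind JD mB); apply: eq_big_seq => i iJ; rewrite Bi.
- by move=> k; rewrite m1E setIT -ge0_fin_numE.
Qed.

Lemma lone_RintegralM (Z : T -> R) : sigma_measurable [set` J] Y Z ->
  P.-integrable setT (EFin \o Y a) -> P.-integrable setT (EFin \o Z) ->
  P.-integrable setT (EFin \o (fun w => Y a w * Z w)) ->
  \int[P]_w (Y a w * Z w) = \int[P]_w Y a w * \int[P]_w Z w.
Proof.
move=> mZ; apply: indep_RintegralM.
- exact: measurable_funP.
- exact: sigma_measurableW mZ.
- move=> A B mA mB; apply: lone_independent => //.
  exact: sigma_measurable_preimage.
Qed.
End Lone.
End GeneratedSigma.

Section LaplaceMoments.
Context {R : realType}.
Local Notation mu := (@lebesgue_measure R).

Lemma laplace_pdf_ge0 (x : R) : 0 <= laplace_pdf x.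
Proof. by rewrite mulr_ge0 ?invr_ge0 ?expR_ge0. Qed.

Let continuous_expN (r : R) : continuous (fun x : R => expR (- (`|x| * r))).
Proof.
move=> x; apply: continuous_comp; last exact: continuous_expR.
apply: cvgN; apply: cvgM; last exact: cvg_cst.
exact: norm_continuous.
Qed.

Lemma measurable_laplace_pdf : measurable_fun setT (@laplace_pdf R).
Proof.
apply: measurable_funM => //; apply: continuous_measurable_fun.
rewrite (_ : (fun x => _) = (fun x : R => expR (- (`|x| * 1)))) //.
by apply/funext => x; rewrite mulr1.
Qed.

(** By symmetry it is enough to integrate over the half-line, where the function is twice the
    exponential density of rate 1/2. *)
Let integrable_expN : mu.-integrable setT (EFin \o (fun x : R => expR (- (`|x| * 2^-1)))).
Proof.
have mf := continuous_measurable_fun (@continuous_expN 2^-1).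
apply/integrableP; split; first exact/measurable_EFinP.
under eq_integral do rewrite /= ger0_norm ?expR_ge0//.
rewrite ge0_symfun_integralT; first last.
- by move=> x /=; rewrite normrN.
- exact: continuous_expN.
- by move=> x; exact: expR_ge0.
apply: lte_mul_pinfty; [by []|by []|].
apply: (@le_lt_trans _ _ (2%:E * 1)%E); last by rewrite ltry.
rewrite -(@integral_exponential_pdf R 2^-1) ?invr_gt0//.
rewrite -ge0_integralZl//; last 2 first.
- by apply/measurable_EFinP; exact: measurable_exponential_pdf.
- by move=> x _; rewrite lee_fin exponential_pdf_ge0.
rewrite [leRHS](_ : _ = \int[mu]_x (2 * exponential_pdf 2^-1 x)%:E)%E//.
have m2 : measurable_fun setT (fun x => 2 * exponential_pdf (2^-1 : R) x).
  by apply: measurable_funM => //; exact: measurable_exponential_pdf.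
apply: (@le_trans _ _ (\int[mu]_(x in [set x : R | (0 <= x)%R]) (2 * exponential_pdf 2^-1 x)%:E)%E).
  rewrite le_eqVlt; apply/orP; left; apply/eqP; apply: eq_integral => x.
  rewrite inE/= => x0; rewrite exponential_pdfE// ger0_norm//.
  by rewrite mulrA divff// mul1r mulrC mulNr.
apply: ge0_subset_integral => //=.
- by rewrite -set_itvcy.
- exact/measurable_EFinP.
- by move=> x _; rewrite lee_fin mulr_ge0// exponential_pdf_ge0.
Qed.

Lemma laplace_quartic_integrable (f : R -> R) (A B : R) :
  measurable_fun setT f -> 0 <= A -> 0 <= B ->
  (forall x, `|f x| <= A + B * x ^+ 4) ->
  mu.-integrable setT (EFin \o (fun x => f x * laplace_pdf x)).
Proof.
(* With u = |x| / 2, half of the exponential decay absorbs x^4 = 16 u^4 through u^4 exp (- u) <= 4!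
   = 24, and 16 * 24 = 384. *)
move=> mf A0 B0 fAB; pose K := A + B * 384.
have K0 : 0 <= K by apply: addr_ge0 (mulr_ge0 B0 (ler0n _ _)).
have iK := integrableZl measurableT K integrable_expN.
apply: le_integrable iK => //.
  by apply/measurable_EFinP; apply: measurable_funM => //;
    exact: measurable_laplace_pdf.
move=> x _; rewrite /= lee_fin normrM (ger0_norm (laplace_pdf_ge0 _)).
rewrite [leRHS]ger0_norm ?mulr_ge0 ?expR_ge0//.
apply: (@le_trans _ _ ((A + B * x ^+ 4) * laplace_pdf x)).
  by rewrite ler_wpM2r ?laplace_pdf_ge0.
set u := `|x| * 2^-1; have u0 : 0 <= u by rewrite mulr_ge0.
have -> : laplace_pdf x = 2^-1 * (expR (- u) * expR (- u)).
  by rewrite /laplace_pdf -expRD /u; congr (_ * expR _); field.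
have e0 : 0 < expR (- u) := expR_gt0 _.
have e1 : expR (- u) <= 1 by rewrite -[leRHS]expR0 ler_expR oppr_le0.
have -> : x ^+ 4 = 16 * u ^+ 4.
  by rewrite /u exprMn -normrX (ger0_norm (exprn_even_ge0 x (isT : ~~ odd 4))); field.
have u4 : u ^+ 4 * expR (- u) <= 24.
  have := expR_ge1Dxn 3 u0; rewrite expRN ler_pdivrMr ?expR_gt0//.
  by rewrite (_ : 4`! = 24)%N//; lra.
have u40 : 0 <= u ^+ 4 by rewrite exprn_ge0.
rewrite mulrA mulrA ler_wpM2r ?expR_ge0//.
rewrite (_ : _ * 2^-1 * _ = 2^-1 * (A * expR (- u) + B * (16 * (u ^+ 4 * expR (- u))))); last by ring.
have h1 : A * expR (- u) <= A by rewrite ler_piMr.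
have h2 : B * (16 * (u ^+ 4 * expR (- u))) <= B * 384.
  by rewrite ler_wpM2l//; lra.
rewrite /K; have : 0 <= A * expR (- u) by rewrite mulr_ge0// ltW.
have : 0 <= B * 384 := mulr_ge0 B0 (ler0n _ _).
lra.
Qed.

Lemma laplace_mean : \int[mu]_x (x * laplace_pdf x) = 0.
Proof.
pose f (x : R) := (x * laplace_pdf x)%:E.
have intf : mu.-integrable setT f.
  apply: (@laplace_quartic_integrable idfun 1 1) => //.
    exact: measurable_id.
  move=> x /=.
  rewrite mul1r -(ger0_norm (exprn_even_ge0 x (isT : ~~ odd 4))) normrX.
  have := normr_ge0 x; move: (`|x|) => y y0.
  by have := sqr_ge0 (y ^+ 2 - 1); nra.
have fN x : f (- x) = (- f x)%E.
  by rewrite /f /laplace_pdf normrN mulNr EFinN.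
have E : (\int[mu]_x f x = \int[mu]_x f (- x)%R)%E.
  transitivity (\int[pushforward mu (-%R : _ -> measurableTypeR R)]_x f x)%E.
    by apply: eq_measure_integral => A mA _; exact/esym/lebesgue_measureN.
  have mf := measurable_int mu intf.
  have mN : measurable_fun setT (-%R : R -> measurableTypeR R) by exact: oppr_measurable.
  rewrite integral_pushforward//.
  rewrite preimage_setT (_ : _ \o _ = (-%E \o f)%E); first exact: integrableN.
  by apply/funext => x /=; rewrite fN.
move: E; under [in RHS]eq_integral do rewrite fN.
rewrite integralN; last exact: integrable_add_def.
rewrite /Rintegral -/f; case: (\int[mu]_x f x)%E (integrable_fin_num measurableT intf) => // r _.
by move=> [] /= E; lra.
Qed.

End LaplaceMoments.

Section LaplaceVariables.
Context {d} {T : measurableType d} {R : realType} (P : probability T R).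
Local Notation mu := (@lebesgue_measure R).

(** Left unevaluated: the final constant is expressed through the moments of orders 2 and 4. *)
Definition laplace_moment (k : nat) : R := \int[mu]_x (x ^+ k * laplace_pdf x).

Lemma laplace_law_moment (Y : {RV P >-> R}) (k : nat) : (k <= 4)%N ->
  laplace_law P Y -> P.-integrable setT (EFin \o (fun w => Y w ^+ k)) /\
  \int[P]_w (Y w ^+ k) = laplace_moment k.
Proof.
move=> k4 lY; have mk : measurable_fun setT (fun x : R => x ^+ k) by exact: measurable_funX.
have ik : mu.-integrable setT (EFin \o (fun x => x ^+ k * laplace_pdf x)).
  apply: (@laplace_quartic_integrable _ _ 1 1) => // x.
  have -> : x ^+ 4 = `|x| ^+ 4.
    by rewrite -normrX ger0_norm// (exprn_even_ge0 x (isT : ~~ odd 4)).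
  rewrite mul1r normrX; have [x1|x1] := leP `|x| 1.
    by rewrite (le_trans (exprn_ile1 _ (normr_ge0 x) x1))// lerDl exprn_ge0.
  apply: (@le_trans _ _ (`|x| ^+ 4)); last by rewrite lerDr.
  by rewrite ler_weXn2l// ltW.
split.
  exact: (law_integrable (measurable_funPT Y) laplace_pdf_ge0 measurable_laplace_pdf lY mk ik).
exact: (law_Rintegral (measurable_funPT Y) laplace_pdf_ge0 measurable_laplace_pdf lY mk ik).
Qed.

Lemma laplace_law_mean (Y : {RV P >-> R}) : laplace_law P Y -> \int[P]_w Y w = 0.
Proof.
move=> lY; have [_] := @laplace_law_moment Y 1 isT lY.
rewrite /laplace_moment; under eq_Rintegral do rewrite expr1.
under [X in _ = X -> _]eq_Rintegral do rewrite expr1.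
by rewrite laplace_mean.
Qed.

Lemma integrableM4 (a b c e : T -> R) :
  measurable_fun setT a -> measurable_fun setT b ->
  measurable_fun setT c -> measurable_fun setT e ->
  P.-integrable setT (EFin \o (fun w => a w ^+ 4)) ->
  P.-integrable setT (EFin \o (fun w => b w ^+ 4)) ->
  P.-integrable setT (EFin \o (fun w => c w ^+ 4)) ->
  P.-integrable setT (EFin \o (fun w => e w ^+ 4)) ->
  P.-integrable setT (EFin \o (fun w => a w * b w * c w * e w)).
Proof.
move=> ma mb mc me ia ib ic ie.
have := integrableDR (integrableDR ia ib) (integrableDR ic ie).
apply: le_integrable => //.
  by apply/measurable_EFinP; do 3 apply: measurable_funM => //.
move=> w _ /=; rewrite lee_fin; move: (a w) (b w) (c w) (e w) => x y z t.
have p4 (u : R) : u ^+ 4 = (u ^+ 2) ^+ 2 by rewrite -exprM.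
rewrite [leRHS]ger0_norm ?p4 ?addr_ge0 ?sqr_ge0//.
have h1 : `|x * y| <= (x ^+ 2 + y ^+ 2) / 2.
  by rewrite ler_norml; have := sqr_ge0 (x - y); have := sqr_ge0 (x + y);
   move=> *; apply/andP; split; nra.
have h2 : `|z * t| <= (z ^+ 2 + t ^+ 2) / 2.
  by rewrite ler_norml; have := sqr_ge0 (z - t); have := sqr_ge0 (z + t);
   move=> *; apply/andP; split; nra.
rewrite -mulrA normrM; apply: (le_trans (ler_pM _ _ h1 h2)) => //.
have := sqr_ge0 (x ^+ 2 - z ^+ 2); have := sqr_ge0 (x ^+ 2 - t ^+ 2).
have := sqr_ge0 (y ^+ 2 - z ^+ 2); have := sqr_ge0 (y ^+ 2 - t ^+ 2).
have := sqr_ge0 (x ^+ 2); have := sqr_ge0 (y ^+ 2).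
have := sqr_ge0 (z ^+ 2); have := sqr_ge0 (t ^+ 2).
move: (x ^+ 2) (y ^+ 2) (z ^+ 2) (t ^+ 2) => p q r s; nra.
Qed.
End LaplaceVariables.

(** * The Gaussian process *)

Section GaussianProcess.
Context {d} {T : measurableType d} {R : realType} (P : probability T R).
Variables (f : R -> R) (X : int -> {RV P >-> R}).
Hypothesis SG : stationary_gaussian f X.
Local Notation c := (autocov f).

Lemma gaussian_process_RV (t : int) : gaussian_law P (X t).
Proof.
have := process_gaussian SG (fun=> t) (fun _ : 'I_1 => 1).
rewrite (_ : (fun w => _) = X t) //.
by apply/funext => w; rewrite big_ord1 mul1r.
Qed.

Lemma process_integrable t : P.-integrable setT (EFin \o X t).
Proof. by have [] := gaussian_law_moments (measurable_funPT (X t)) (gaussian_process_RV t). Qed.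

Lemma process_sqr_integrable t : P.-integrable setT (EFin \o (fun w => X t w ^+ 2)).
Proof. by have [] := gaussian_law_moments (measurable_funPT (X t)) (gaussian_process_RV t). Qed.

Lemma integrableM2 (g h : T -> R) : measurable_fun setT g -> measurable_fun setT h ->
  P.-integrable setT (EFin \o (fun w => g w ^+ 2)) ->
  P.-integrable setT (EFin \o (fun w => h w ^+ 2)) ->
  P.-integrable setT (EFin \o (fun w => g w * h w)).
Proof.
move=> mg mh ig ih; have := integrableDR ig ih; apply: le_integrable => //.
  by apply/measurable_EFinP; apply: measurable_funM.
move=> w _ /=; rewrite lee_fin [leRHS]ger0_norm ?addr_ge0 ?sqr_ge0//.
move: (g w) (h w) => x y.
have := sqr_ge0 (x - y); have := sqr_ge0 (x + y); have := sqr_ge0 x; have := sqr_ge0 y.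
by move=> *; rewrite ler_norml; apply/andP; split; nra.
Qed.

Lemma process_mean t : \int[P]_w X t w = 0.
Proof. by have := process_centered SG t; rewrite unlock /Rintegral => ->. Qed.

Lemma process_product_integrable t u :
  P.-integrable setT (EFin \o (fun w => X t w * X u w)).
Proof. by apply: integrableM2 => //; exact: process_sqr_integrable. Qed.

Lemma process_covariance t u : \int[P]_w (X t w * X u w) = c (u - t).
Proof.
have := process_autocov SG t (u - t); rewrite subrKC unlock.
rewrite !(process_centered SG)/=.
rewrite /Rintegral unlock => E.
rewrite (_ : (\int[P]_w (X t w * X u w)%:E)%E = (c (u - t))%:E)// -E.
apply: eq_integral => w _; congr EFin; rewrite -[RHS]/((X t w - 0) * (X u w - 0)).
by rewrite !subr0.
Qed.

(** Evenness is read off the symmetry of the covariance of the process. *)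
Lemma autocovN h : c (- h) = c h.
Proof.
rewrite -[h in RHS]subr0 -process_covariance -sub0r -process_covariance.
by apply: eq_Rintegral => w _; rewrite mulrC.
Qed.

Section LinearCombination.
Variables (n : nat) (t : 'I_n -> int) (a : 'I_n -> R).
Definition lincomb (w : T) : R := \sum_k a k * X (t k) w.
Definition lincomb_var : R := \sum_k \sum_l a k * a l * c (t l - t k).

Lemma measurable_lincomb : measurable_fun setT lincomb.
Proof. by apply: measurable_sum => k; apply: measurable_funM. Qed.

Lemma lincomb_gaussian : gaussian_law P lincomb.
Proof. exact: (process_gaussian SG t a). Qed.

Lemma lincomb_mean : \int[P]_w lincomb w = 0.
Proof.
rewrite Rintegral_sum => [|k]; last exact/integrableZ/process_integrable.
rewrite big1// => k _; rewrite RintegralZl ?process_mean ?mulr0//.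
exact: process_integrable.
Qed.

Lemma lincomb_sqr_mean : \int[P]_w (lincomb w ^+ 2) = lincomb_var.
Proof.
transitivity (\int[P]_w (\sum_k \sum_l a k * a l * (X (t k) w * X (t l) w))).
  apply: eq_Rintegral => w _; rewrite expr2 /lincomb big_distrlr/=.
  by apply: eq_bigr => k _; apply: eq_bigr => l _; ring.
have I k l := @integrableZ _ _ _ P _ (a k * a l) (process_product_integrable (t k) (t l)).
rewrite Rintegral_sum => [|k]; last by apply: integrable_bigsum => l.
apply: eq_bigr => k _; rewrite Rintegral_sum//.
apply: eq_bigr => l _; rewrite RintegralZl ?process_covariance//.
exact: process_product_integrable.
Qed.

Lemma lincomb_cos : \int[P]_w cos (lincomb w) = expR (- lincomb_var / 2).
Proof.
have [_ _ H] := gaussian_law_moments measurable_lincomb lincomb_gaussian.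
by rewrite H ?lincomb_mean// lincomb_sqr_mean.
Qed.

Lemma lincomb_law : lincomb_var != 0 ->
  exists s : R, [/\ s != 0, s ^+ 2 = lincomb_var &
  forall A : set R, measurable A -> P (lincomb @^-1` A) = normal_prob 0 s A].
Proof.
rewrite -lincomb_sqr_mean; apply: gaussian_law_normal.
- exact: measurable_lincomb.
- exact: lincomb_gaussian.
- exact: lincomb_mean.
Qed.
End LinearCombination.
End GaussianProcess.

(* For X_j and X_(j+h) with correlation p, the whitened pair
   (X_j, (X_(j+h) - p X_j) / r) with r^2 = 1 - p^2 is standard. *)
Lemma whitening_identity {F : fieldType} (s r p x y z t0 t1 u0 u1 : F) :
  s != 0 -> r != 0 -> r ^+ 2 = 1 - p ^+ 2 ->
  let a1 := t0 / s - t1 * p / (s * r) in let a2 := t1 / (s * r) in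
  let b1 := u0 / s - u1 * p / (s * r) in let b2 := u1 / (s * r) in
  s ^+ 2 * (a1 ^+ 2 + a2 ^+ 2 + b1 ^+ 2 + b2 ^+ 2) +
  2 * (a1 * a2 * (s ^+ 2 * p) + a1 * b1 * (s ^+ 2 * x) + a1 * b2 * (s ^+ 2 * y) +
       a2 * b1 * (s ^+ 2 * z) + a2 * b2 * (s ^+ 2 * x) + b1 * b2 * (s ^+ 2 * p)) =
  t0 * t0 + t1 * t1 + (u0 * u0 + u1 * u1) +
  2 * (t0 * x * u0 + t0 * ((y - p * x) / r) * u1 +
      (t1 * ((z - p * x) / r) * u0 +
       t1 * ((x - p * z - p * y + p ^+ 2 * x) / r ^+ 2) * u1)).
Proof.
move=> s0 r0 r2 /=; have rr : (1 - p ^+ 2) / r ^+ 2 = 1 by rewrite -r2 divff// expf_neq0.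
(* The relation between r and p matters only in the coefficients of t1^2 and u1^2, as (1 - p^2) /
   r^2 = 1; what remains is a field identity. *)
transitivity (t0 ^+ 2 + t1 ^+ 2 * ((1 - p ^+ 2) / r ^+ 2) + u0 ^+ 2 +
    u1 ^+ 2 * ((1 - p ^+ 2) / r ^+ 2) +
    2 * (t0 * x * u0 + t0 * ((y - p * x) / r) * u1 +
      (t1 * ((z - p * x) / r) * u0 +
       t1 * ((x - p * z - p * y + p ^+ 2 * x) / r ^+ 2) * u1))).
  by clear rr r2; field; rewrite s0 r0.
by rewrite rr; ring.
Qed.

Section Whitening.
Context {d} {T : measurableType d} {R : realType} (P : probability T R).
Variables (f : R -> R) (X : int -> {RV P >-> R}).
Hypothesis SG : stationary_gaussian f X.
Local Notation c := (autocov f).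
Local Notation rho := (autocorr f).

(** Four terms accommodate two pairs (X_j, X_(j+h)); shorter combinations are padded with zero
    coefficients. *)
Lemma cos_lincomb4 (j1 j2 j3 j4 : int) (a1 a2 a3 a4 : R) :
  \int[P]_w cos (a1 * X j1 w + a2 * X j2 w + a3 * X j3 w + a4 * X j4 w) =
  expR (- (c 0 * (a1 ^+ 2 + a2 ^+ 2 + a3 ^+ 2 + a4 ^+ 2) +
    2 * (a1 * a2 * c (j2 - j1) + a1 * a3 * c (j3 - j1) + a1 * a4 * c (j4 - j1) +
         a2 * a3 * c (j3 - j2) + a2 * a4 * c (j4 - j2) + a3 * a4 * c (j4 - j3))) / 2).
Proof.
have := lincomb_cos SG (fun k : 'I_4 => nth 0 [:: j1; j2; j3; j4] k)
  (fun k => nth 0 [:: a1; a2; a3; a4] k).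
rewrite /lincomb_var !big_ord_recl !big_ord0/= !subrr.
have opp (x y : int) : c (y - x) = c (x - y) by rewrite -opprB (autocovN SG).
rewrite (opp j2 j1) (opp j3 j1) (opp j4 j1) (opp j3 j2) (opp j4 j2) (opp j4 j3).
move=> H; transitivity (\int[P]_w cos (lincomb X (fun k : 'I_4 => nth 0 [:: j1; j2; j3; j4] k)
  (fun k => nth 0 [:: a1; a2; a3; a4] k) w)).
  by apply: eq_Rintegral => w _; rewrite /lincomb !big_ord_recl big_ord0/= addr0 !addrA.
rewrite H {H}.
move: (c 0) (c (j2 - j1)) (c (j3 - j1)) (c (j4 - j1)) (c (j3 - j2)) (c (j4 - j2))
  (c (j4 - j3)) => *.
by congr expR; congr (_ / _); congr (- _); ring.
Qed.

Hypothesis c0 : 0 < c 0.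
Let sigma := Num.sqrt (c 0).
Let sigma_gt0 : 0 < sigma. Proof. by rewrite sqrtr_gt0. Qed.
Let sigma2 : sigma ^+ 2 = c 0. Proof. by rewrite sqr_sqrtr// ltW. Qed.

Lemma autocovE h : c h = c 0 * rho h.
Proof. by rewrite /autocorr mulrCA divff ?mulr1// gt_eqF. Qed.

Lemma cov_exceed_process (C : R) (i j : int) : 0 <= C ->
  `|cov P (fun w => (C < `|X i w|)%R%:R) (fun w => (C < `|X j w|)%R%:R)| <=
  2 * rho (j - i) ^+ 2.
Proof.
move=> C0.
pose U w : 'I_1 -> R := fun=> X i w / sigma.
pose V w : 'I_1 -> R := fun=> X j w / sigma.
pose M (k l : 'I_1) := rho (j - i).
have dotU w : dot (fun=> sigma) (U w) = X i w.
  by rewrite /dot big_ord1 mulrC divfK ?gt_eqF.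
have dotV w : dot (fun=> sigma) (V w) = X j w.
  by rewrite /dot big_ord1 mulrC divfK ?gt_eqF.
have mU k : measurable_fun setT (U ^~ k) by exact: measurable_funM.
have mV k : measurable_fun setT (V ^~ k) by exact: measurable_funM.
have UV t s : \int[P]_w cos (dot t (U w) + dot s (V w)) =
    expR (- (dot t t + dot s s + 2 * bilin M t s) / 2).
  transitivity (\int[P]_w cos (t 0 / sigma * X i w + s 0 / sigma * X j w +
      0 * X i w + 0 * X i w)).
    apply: eq_Rintegral => w _; rewrite /dot !big_ord1 /U /V !mul0r !addr0.
    by congr (cos (_ + _)); rewrite mulrCA mulrC.
  rewrite cos_lincomb4 (autocovE (j - i)) -sigma2 /dot /bilin !big_ord1.
  rewrite /M; congr expR; congr (_ / _); congr (- _); have := lt0r_neq0 sigma_gt0.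
  by move: (rho (j - i)) sigma (t 0) (s 0) => p sg a b s0; field.
have := @cov_exceed _ _ _ P 1 U V M `|rho (j - i)| mU mV UV
  (fun _ _ => lexx _) (normr_ge0 _) (fun=> sigma) (fun=> sigma) C C0.
rewrite mul1r real_normK ?num_real//; apply: le_trans.
rewrite le_eqVlt; apply/orP; left; apply/eqP; congr (`|_|); rewrite /cov.
by congr (_ - _ * _); apply: eq_Rintegral => w _; rewrite ?dotU ?dotV.
Qed.

(** The decorrelation inequality with n = 2 and m = 4 q / r^2 gives 2 (8 q / r^2)^2 = 128 q^2 / r^4,
    and q^2 <= 3 (x^2 + y^2 + z^2) turns 128 into 384. *)
Lemma cov_sg_process (i j h : int) : rho h ^+ 2 < 1 ->
  `|cov P (fun w => Num.sg (X i w) * Num.sg (X (i + h) w))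
          (fun w => Num.sg (X j w) * Num.sg (X (j + h) w))| <=
  384 / (1 - rho h ^+ 2) ^+ 2 *
  (rho (j - i) ^+ 2 + rho (j - i + h) ^+ 2 + rho (j - i - h) ^+ 2).
Proof.
move=> rh1; set p := rho h.
set x := rho (j - i); set y := rho (j - i + h); set z := rho (j - i - h).
pose r := Num.sqrt (1 - p ^+ 2).
have r2 : r ^+ 2 = 1 - p ^+ 2 by rewrite sqr_sqrtr// subr_ge0 ltW.
have r0 : 0 < r by rewrite sqrtr_gt0 subr_gt0.
have r1 : r <= 1 by rewrite -(@expr_le1 _ 2)// ?r2 ?(ltW r0)// gerBl sqr_ge0.
pose U k w : 'I_2 -> R :=
  vec2 (X k w / sigma) ((X (k + h) w - p * X k w) / (sigma * r)).
pose e2 : 'I_2 -> R := vec2 (p * sigma) (r * sigma).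
pose e1 : 'I_2 -> R := vec2 sigma 0.
have s0 := gt_eqF sigma_gt0; have r0' := gt_eqF r0.
have dot1 k w : dot e1 (U k w) = X k w.
  by rewrite dot_vec2 /e1 /vec2/= mul0r addr0; field; rewrite s0.
have dot2 k w : dot e2 (U k w) = X (k + h) w.
  by rewrite dot_vec2 /e2 /vec2/=; field; rewrite s0 r0'.
have mU k l : measurable_fun setT ((U k) ^~ l).
  rewrite /U /vec2; case: (l == 0); first exact: measurable_funM.
  by apply: measurable_funM => //; apply: measurable_funB => //; exact: measurable_funM.
pose M (k l : 'I_2) : R :=
  if k == 0 then (if l == 0 then x else (y - p * x) / r)
  else (if l == 0 then (z - p * x) / r else (x - p * z - p * y + p ^+ 2 * x) / r ^+ 2).
have UV t s : \int[P]_w cos (dot t (U i w) + dot s (U j w)) =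
    expR (- (dot t t + dot s s + 2 * bilin M t s) / 2).
  transitivity (\int[P]_w cos (
      (t 0 / sigma - t 1 * p / (sigma * r)) * X i w + t 1 / (sigma * r) * X (i + h) w +
      (s 0 / sigma - s 1 * p / (sigma * r)) * X j w + s 1 / (sigma * r) * X (j + h) w)).
    apply: eq_Rintegral => w _; rewrite !dot_vec2; congr cos; field.
    by rewrite s0 r0'.
  rewrite cos_lincomb4.
  rewrite (_ : i + h - i = h); last by ring.
  rewrite (_ : j + h - i = j - i + h); last by ring.
  rewrite (_ : j - (i + h) = j - i - h); last by ring.
  rewrite (_ : j + h - (i + h) = j - i); last by ring.
  rewrite (_ : j + h - j = h); last by ring.
  rewrite !(autocovE h) !(autocovE (j - i)) !(autocovE (j - i + h)) !(autocovE (j - i - h)).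
  rewrite -/x -/y -/z -/p -sigma2 /dot /bilin !big_ord_recl !big_ord0/=.
  rewrite (_ : lift ord0 ord0 = 1); last exact: val_inj.
  rewrite /M/=; congr expR; congr (_ / _); congr (- _).
  rewrite (whitening_identity _ _ _ _ _ _ _ (lt0r_neq0 sigma_gt0) (lt0r_neq0 r0) r2).
  by rewrite !addr0.
pose q := `|x| + `|y| + `|z|.
have q0 : 0 <= q by rewrite !addr_ge0.
have p1 : `|p| <= 1 by rewrite -(@expr_le1 _ 2)// real_normK ?num_real// ltW.
have p2 : `|p| * `|p| <= 1 by rewrite mulr_ile1.
(* An entry of M is a sum of at most four of x, y, z with coefficients at most 1 in absolute value,
   divided by 1, r or r^2; since r <= 1, the bound with r^2 covers all cases. *)
pose m := 4 * q / r ^+ 2.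
have r20 : 0 < r ^+ 2 by rewrite exprn_gt0.
have ri : r^-1 <= (r ^+ 2)^-1.
  by rewrite lef_pV2 ?posrE// expr2 ler_piMr// ltW.
have ri1 : 1 <= (r ^+ 2)^-1.
  by rewrite -[leLHS]invr1 lef_pV2 ?posrE// exprn_ile1// ltW.
have Mm k l : `|M k l| <= m.
  have H (u : R) (b : R) : `|u| <= 4 * q -> 0 <= b -> b <= (r ^+ 2)^-1 -> `|u * b| <= m.
    by move=> *; rewrite normrM (ger0_norm (x := b))// ler_pM.
  have nx : `|x| <= q by rewrite /q -addrA lerDl addr_ge0.
  have ny : `|y| <= q by rewrite /q addrAC lerDr addr_ge0.
  have nz : `|z| <= q by rewrite /q lerDr addr_ge0.
  have px (u : R) : `|p * u| <= `|u| by rewrite normrM ler_piMl.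
  have ppx : `|p ^+ 2 * x| <= `|x| by rewrite normrM expr2 normrM ler_piMl.
  rewrite /M; case: (k == 0); case: (l == 0).
  - by rewrite -[x]mulr1; apply: H => //; lra.
  - apply: H; rewrite ?invr_ge0 ?(ltW r0)//.
    by apply: le_trans (ler_normB _ _) _; have := px x; lra.
  - apply: H; rewrite ?invr_ge0 ?(ltW r0)//.
    by apply: le_trans (ler_normB _ _) _; have := px x; lra.
  - apply: H; rewrite ?invr_ge0 ?(ltW r20)//.
    apply: le_trans (ler_normD _ _) _.
    have := ler_normB (x - p * z) (p * y); have := ler_normB x (p * z).
    have := px z; have := px y; lra.
have m0 : 0 <= m by rewrite divr_ge0 ?(ltW r20)// mulr_ge0.
have := @cov_sg_prod _ _ _ P 2 (U i) (U j) M m (mU i) (mU j) UV Mm m0 e1 e2 e1 e2.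
move=> H; apply: (le_trans (le_trans _ H)).
  rewrite le_eqVlt; apply/orP; left; apply/eqP; congr (`|_|); rewrite /cov.
  by congr (_ - _ * _); apply: eq_Rintegral => w _; rewrite ?dot1 ?dot2.
rewrite -r2 /m.
have -> : 2 * (2 * (4 * q / r ^+ 2)) ^+ 2 = 128 / (r ^+ 2) ^+ 2 * q ^+ 2.
  by field; rewrite r0'.
have -> : 384 / (r ^+ 2) ^+ 2 * (x ^+ 2 + y ^+ 2 + z ^+ 2) =
   128 / (r ^+ 2) ^+ 2 * (3 * (x ^+ 2 + y ^+ 2 + z ^+ 2)) by field; rewrite r0'.
rewrite ler_wpM2l//; first by rewrite divr_ge0 ?sqr_ge0.
rewrite /q -(real_normK (num_real x)) -(real_normK (num_real y)) -(real_normK (num_real z)).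
move: (`|x|) (`|y|) (`|z|) => a b e.
have := sqr_ge0 (a - b); have := sqr_ge0 (a - e); have := sqr_ge0 (b - e).
by nra.
Qed.

End Whitening.

Section SmoothClass.
Context {R : realType}.
Variables (C0 C1 s : R) (f : R -> R).
Hypotheses (hs : 1 / 2 < s) (Hf : smoothness_class C0 C1 s f).
Local Notation rho := (autocorr f).

(** The weights |h|^(2 s) are at least 1 for h != 0, so the smoothness sum dominates every finite
    sum of rho^2 over nonzero lags. *)
Lemma sum_sqr_autocorr_neq0 (u : seq int) : uniq u -> 0 \notin u ->
  \sum_(i <- u) rho i ^+ 2 <= C1 ^+ 2.
Proof.
case: Hf => _ _ H uu u0; rewrite -lee_fin; apply: le_trans H.
apply: esum_ge; exists [set` u].
  split; first exact: finite_seq.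
  by move=> i /= iu; apply: contraNneq u0 => <-.
rewrite -fsbig_seq// -sumEFin big_seq [leRHS]big_seq.
apply: lee_sum => i iu; rewrite lee_fin real_normK ?num_real//.
rewrite ler_peMl ?sqr_ge0//.
have i1 : 1 <= (`|i|%N%:R : R).
  rewrite ler1n absz_gt0; by apply: contraNneq u0 => <-.
rewrite -[leLHS](powRr0 (`|i|%N%:R : R)).
by rewrite ler_powR//; have := hs; lra.
Qed.

Lemma sum_sqr_autocorr (u : seq int) : autocorr f 0 ^+ 2 <= 1 -> uniq u ->
  \sum_(i <- u) rho i ^+ 2 <= 1 + C1 ^+ 2.
Proof.
move=> r0 uu; have [u0|u0] := boolP (0 \in u); last first.
  by apply: le_trans (sum_sqr_autocorr_neq0 uu u0) _; rewrite lerDr.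
rewrite (bigD1_seq 0)//=; apply: lerD => //.
rewrite -big_filter; apply: sum_sqr_autocorr_neq0.
  by rewrite filter_uniq.
by rewrite mem_filter eqxx.
Qed.
End SmoothClass.

Section ProcessSheppard.
Context {d} {T : measurableType d} {R : realType} (P : probability T R).
Variables (f : R -> R) (X : int -> {RV P >-> R}).
Hypothesis SG : stationary_gaussian f X.
Local Notation c := (autocov f).
Local Notation rho := (autocorr f).
Hypothesis c0 : 0 < c 0.
Let sigma := Num.sqrt (c 0).
Let sigma_gt0 : 0 < sigma. Proof. by rewrite sqrtr_gt0. Qed.
Let sigma2 : sigma ^+ 2 = c 0. Proof. by rewrite sqr_sqrtr// ltW. Qed.

Lemma autocorr0 : rho 0 = 1.
Proof. by rewrite /autocorr divff// gt_eqF. Qed.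

Lemma lincomb2E (i j : int) (a b : R) w :
  lincomb X (fun k : 'I_2 => nth 0 [:: i; j] k) (fun k => nth 0 [:: a; b] k) w =
  a * X i w + b * X j w.
Proof. by rewrite /lincomb !big_ord_recl big_ord0/= addr0. Qed.

Lemma lincomb2_varE (i j : int) (a b : R) :
  lincomb_var f (fun k : 'I_2 => nth 0 [:: i; j] k) (fun k => nth 0 [:: a; b] k) =
  c 0 * (a ^+ 2 + b ^+ 2 + 2 * rho (j - i) * a * b).
Proof.
rewrite /lincomb_var !big_ord_recl !big_ord0/= !subrr.
rewrite -(opprB j i) (autocovN SG) (autocovE c0 (j - i)).
by move: (c 0) (rho (j - i)) => v p; ring.
Qed.

Lemma lincomb2_normal (i j : int) (a b : R) :
  let v := c 0 * (a ^+ 2 + b ^+ 2 + 2 * rho (j - i) * a * b) in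
  v != 0 -> exists s : R, [/\ s != 0, s ^+ 2 = v &
    forall A : set R, measurable A ->
    P ((fun w => a * X i w + b * X j w) @^-1` A) = normal_prob 0 s A].
Proof.
move=> v v0.
have := lincomb_law SG (t := fun k : 'I_2 => nth 0 [:: i; j] k) (a := fun k => nth 0 [:: a; b] k).
rewrite lincomb2_varE => /(_ v0) [s [s0 sv H]]; exists s; split => // A mA.
by rewrite -H//; congr (P _); apply/seteqP; split => w /=; rewrite lincomb2E.
Qed.

Lemma sheppard_process (i h : int) : rho h ^+ 2 < 1 ->
  sin (pi / 2 * \int[P]_w (Num.sg (X i w) * Num.sg (X (i + h) w))) = rho h.
Proof.
move=> rh1; have s0 := lt0r_neq0 sigma_gt0.
have mXs k : measurable_fun setT (fun w => X k w / sigma) by exact: measurable_funM.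
have rh : -1 < rho h < 1.
  by rewrite -ltr_norml -(@expr_lt1 _ 2)// real_normK ?num_real.
have := @sheppard _ _ _ P (fun w => X i w / sigma) (fun w => X (i + h) w / sigma)
  (rho h) (mXs i) (mXs (i + h)) rh.
under eq_Rintegral do rewrite !sgrM !(gtr0_sg (x := sigma^-1)) ?invr_gt0// !mulr1.
apply.
- move=> t u.
  transitivity (\int[P]_w cos (t / sigma * X i w + u / sigma * X (i + h) w +
      0 * X i w + 0 * X i w)).
    apply: eq_Rintegral => w _; rewrite !mul0r !addr0.
    by congr (cos (_ + _)); rewrite mulrCA mulrC.
  rewrite (cos_lincomb4 SG) (_ : i + h - i = h); last by ring.
  rewrite (autocovE c0 h) -sigma2.
  move: (rho h) sigma s0 => p sg s0.
  by congr expR; congr (_ / _); congr (- _); rewrite !mul0r !mulr0 !addr0; field.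
- move=> t u tu.
  have v0 : c 0 * ((t / sigma) ^+ 2 + (u / sigma) ^+ 2 +
      2 * rho (i + h - i) * (t / sigma) * (u / sigma)) != 0.
    rewrite (_ : i + h - i = h); last by ring.
    rewrite mulf_neq0 ?(lt0r_neq0 c0)//.
    (* Completing the square: as rho^2 < 1, the variance is positive unless t = u = 0, so the
       combination has a density and does not charge 0. *)
    have -> : (t / sigma) ^+ 2 + (u / sigma) ^+ 2 +
      2 * rho h * (t / sigma) * (u / sigma) =
      ((t + rho h * u) ^+ 2 + (1 - rho h ^+ 2) * u ^+ 2) / sigma ^+ 2.
      by move: (rho h) sigma s0 => p sg s0; field.
    rewrite mulf_neq0 ?invr_eq0 ?expf_neq0//.
    have [u0|u0] := eqVneq u 0.
      rewrite u0 eqxx orbF in tu.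
      by rewrite u0 mulr0 addr0 expr0n/= mulr0 addr0 expf_neq0.
    apply: lt0r_neq0; rewrite ltr_wpDl ?sqr_ge0// mulr_gt0 ?subr_gt0//.
    by rewrite exprn_even_gt0.
  have [s [_ _ H]] := lincomb2_normal v0.
  have E : [set w | t * (X i w / sigma) + u * (X (i + h) w / sigma) = 0] =
    (fun w => t / sigma * X i w + u / sigma * X (i + h) w) @^-1` [set 0].
    apply/seteqP; split => w /=; by rewrite ![_ / sigma]mulrC !mulrA ![_ / sigma]mulrC.
  by rewrite E H// /normal_prob integral_set1.
Qed.
End ProcessSheppard.

(** * The variance estimator *)

Section NormalCdf.
Context {R : realType}.
Local Notation mu := (@lebesgue_measure R).
Local Notation N := (@normal_prob R 0 1).
Implicit Types x y a b p q : R.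

Let N_fin (A : set R) : measurable A -> N A \is a fin_num.
Proof.
by move=> mA; exact: fin_num_measure.
Qed.

Lemma PhiB x y : x <= y -> Phi y - Phi x = fine (N `]x, y]).
Proof.
move=> xy; rewrite /Phi.
have -> : `]-oo, y]%classic = `]-oo, x]%classic `|` `]x, y]%classic :> set R.
  by rewrite -itv_bndbnd_setU// bnd_simp.
rewrite measureU//=.
  by rewrite fineD ?N_fin// addrAC subrr add0r.
apply/seteqP; split => // z [] /=; rewrite !in_itv/= => h1 /andP[h2 _].
by move: h2; rewrite ltNge h1.
Qed.

Let normal_pdf01 x y : `|x| <= `|y| -> normal_pdf 0 1 y <= normal_pdf 0 1 x.
Proof.
move=> xy; rewrite !normal_pdfE ?oner_neq0// /normal_fun !subr0.
rewrite ler_wpM2l ?normal_peak_ge0// ler_expR ler_wpM2r ?invr_ge0//.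
rewrite lerN2 -(real_normK (num_real x)) -(real_normK (num_real y)).
by rewrite lerXn2r ?nnegrE.
Qed.

Let mE x y : x <= y -> mu `]x, y]%classic = (y - x)%:E.
Proof.
move=> xy; rewrite lebesgue_measure_itv/= lte_fin; case: ltP => //.
by move=> yx; rewrite (le_anti (introT andP (conj xy yx))) subrr.
Qed.

Lemma PhiB_ge b x y : `|x| <= b -> `|y| <= b -> x <= y ->
  normal_pdf 0 1 b * (y - x) <= Phi y - Phi x.
Proof.
move=> xb yb xy; rewrite PhiB// -lee_fin fineK ?N_fin//.
rewrite EFinM -mE// -integral_cst//; apply: ge0_le_integral => //.
- by move=> z _; rewrite lee_fin normal_pdf_ge0.
- by apply/measurable_EFinP; apply: measurable_funTS; exact: measurable_normal_pdf.
- move=> z /=; rewrite in_itv/= => /andP[xz zy]; rewrite lee_fin.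
  have b0 : 0 <= b by apply: le_trans xb.
  apply: normal_pdf01; rewrite [leRHS]ger0_norm//.
  by move: xb yb; rewrite !ler_norml => /andP[h1 h2] /andP[h3 h4]; apply/andP; split; lra.
Qed.

Lemma PhiB_le x y : x <= y -> Phi y - Phi x <= normal_peak 1 * (y - x).
Proof.
move=> xy; rewrite PhiB// -lee_fin fineK ?N_fin//.
rewrite EFinM -mE// -integral_cst//; apply: ge0_le_integral => //.
- by move=> z _; rewrite lee_fin normal_pdf_ge0.
- by apply/measurable_EFinP; apply: measurable_funTS; exact: measurable_normal_pdf.
- by move=> z _; rewrite lee_fin normal_pdf_ub ?oner_neq0.
Qed.

Lemma normal_pdf01_gt0 b : 0 < normal_pdf 0 1 b.
Proof. by rewrite normal_pdfE ?oner_neq0// mulr_gt0 ?normal_peak_gt0 ?oner_neq0 ?expR_gt0. Qed.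

Lemma Phi_lt x y : x < y -> Phi x < Phi y.
Proof.
move=> xy; rewrite -subr_gt0.
apply: lt_le_trans (PhiB_ge (b := Num.max `|x| `|y|) _ _ (ltW xy)).
- by rewrite mulr_gt0 ?normal_pdf01_gt0 ?subr_gt0.
- by rewrite le_max lexx.
- by rewrite le_max lexx orbT.
Qed.

Lemma Phi_le x y : x <= y -> Phi x <= Phi y.
Proof. by rewrite le_eqVlt => /predU1P[->//|/Phi_lt/ltW]. Qed.

Lemma Phi_inj : injective (@Phi R).
Proof.
move=> x y xy; have [/Phi_lt|/Phi_lt|//] := ltgtP x y; by rewrite xy ltxx.
Qed.

(** The choice made by [xget] is over a nonempty set here, and injectivity of [Phi] determines
    it. *)
Lemma PhiK x : Phi_inv (Phi x) = x.
Proof.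
have : Phi (Phi_inv (Phi x)) = Phi x.
  by apply: (@xgetPex _ 0 [set y | Phi y = Phi x]); exists x.
exact: Phi_inj.
Qed.

Lemma continuous_Phi : continuous (@Phi R).
Proof.
move=> x; apply/cvgrPdist_le => e e0.
have pk : 0 < (normal_peak 1 : R) by apply: normal_peak_gt0; exact: oner_neq0.
have d0 : 0 < e / normal_peak 1 by rewrite divr_gt0.
near=> y.
have xyd : `|x - y| <= e / normal_peak 1.
  by near: y; apply: cvgr_dist_le.
apply: (@le_trans _ _ (normal_peak 1 * `|x - y|)); last first.
  by rewrite mulrC -ler_pdivlMr.
have [xy|/ltW xy] := leP x y.
  rewrite distrC ger0_norm ?subr_ge0 ?Phi_le// distrC ger0_norm ?subr_ge0//.
  exact: PhiB_le.
rewrite ger0_norm ?subr_ge0 ?Phi_le// ger0_norm ?subr_ge0//.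
exact: PhiB_le.
Unshelve. all: by end_near. Qed.

Lemma Phi_surj a b p : a <= b -> Phi a <= p <= Phi b ->
  exists2 q, a <= q <= b & Phi q = p.
Proof.
move=> ab pab; have [q qab qp] : exists2 q, q \in `[a, b] & Phi q = p.
  apply: IVT => //.
    by apply: continuous_subspaceT; exact: continuous_Phi.
  by rewrite min_l ?max_r ?Phi_le.
by exists q.
Qed.

Lemma normal_prob_gt x : normal_prob 0 1 `]x, +oo[ = (1 - Phi x)%:E.
Proof.
have E : (normal_prob 0 1 `]-oo, x] + normal_prob 0 1 `]x, +oo[ = 1)%E.
  rewrite -measureU//=.
    by rewrite itv_setU_setT probability_setT.
  apply/seteqP; split => // z [] /=; rewrite !in_itv/= andbT => h1.
  by rewrite ltNge h1.
rewrite /Phi; move: E; rewrite -(fineK (N_fin (measurable_itv `]-oo, x]))).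
rewrite -(fineK (N_fin (measurable_itv `]x, +oo[))).
by move: (fine _) (fine _) => u v [] E; rewrite -E /= addrAC subrr add0r.
Qed.
End NormalCdf.

Section Clamp.
Context {R : realType}.
Implicit Types l u p x y a b q : R.

Lemma clamp_range l u x : l <= u -> l <= clamp l u x <= u.
Proof. by move=> lu; rewrite /clamp le_max lexx orbT/= ge_max ge_min lexx orbT. Qed.

Lemma clamp_lipschitz l u p x : l <= p <= u -> `|clamp l u x - p| <= `|x - p|.
Proof.
move=> /andP[lp pu]; rewrite /clamp /Num.max /Num.min.
case: (ltP x u) => xu; case: ltP => hl //.
- by rewrite !ler0_norm; lra.
- by exfalso; lra.
- by rewrite !ger0_norm; lra.
Qed.

Lemma Phi_tail_le x y : x <= y -> 2 * (1 - Phi y) <= 2 * (1 - Phi x).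
Proof. by move=> /Phi_le h; rewrite ler_wpM2l// lerD2l lerN2. Qed.

Lemma Phi_tail_surj a b p : a <= b -> 2 * (1 - Phi b) <= p <= 2 * (1 - Phi a) ->
  exists2 q, a <= q <= b & Phi q = 1 - p / 2.
Proof.
move=> ab /andP[h1 h2]; apply: Phi_surj => //.
by move: (Phi a) (Phi b) h1 h2 => u l h1 h2; apply/andP; split; lra.
Qed.

(** On ]0, b] the tail q |-> 2 (1 - Phi q) decreases at a rate of at least twice the density at
    b. *)
Lemma Phi_tail_inv_lipschitz b q q' : 0 < q <= b -> 0 < q' <= b ->
  `|q - q'| <= `|2 * (1 - Phi q) - 2 * (1 - Phi q')| / (2 * normal_pdf 0 1 b).
Proof.
move=> /andP[q0 qb] /andP[q0' qb'].
have nb x : 0 < x -> x <= b -> `|x| <= b by move=> x0; rewrite gtr0_norm.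
rewrite ler_pdivlMr ?mulr_gt0 ?normal_pdf01_gt0// -mulrBr normrM (ger0_norm (x := 2))//.
rewrite mulrCA ler_pM2l//.
rewrite (_ : 1 - Phi q - (1 - Phi q') = Phi q' - Phi q); last first.
  by move: (Phi q) (Phi q') => u v; ring.
have [h|/ltW h] := leP q q'.
  have := PhiB_ge (nb _ q0 qb) (nb _ q0' qb') h.
  rewrite distrC (ger0_norm (x := q' - q)) ?subr_ge0//.
  rewrite (ger0_norm (x := Phi q' - Phi q)) ?subr_ge0 ?Phi_le//.
  by rewrite mulrC.
have := PhiB_ge (nb _ q0' qb') (nb _ q0 qb) h.
rewrite (ger0_norm (x := q - q')) ?subr_ge0// (distrC (Phi q')).
rewrite (ger0_norm (x := Phi q - Phi q')) ?subr_ge0 ?Phi_le//.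
by rewrite mulrC.
Qed.
End Clamp.

Section VarianceInversion.
Context {R : realType} (C0 : R) (hC0 : 1 <= C0).
(** A variance in [1 / C0, C0] means C0 / sigma in [a, b]: the clamping interval is the set of tail
    probabilities that the class allows. *)
Let a : R := C0 `^ (1 / 2).
Let b : R := C0 `^ (3 / 2).

Let C0_gt0 : 0 < C0. Proof. exact: lt_le_trans hC0. Qed.

Let a2 : a ^+ 2 = C0.
Proof. by rewrite /a div1r powR12_sqrt ?ltW// sqr_sqrtr// ltW. Qed.

Let bE : b = C0 * a.
Proof.
rewrite /a /b -{2}(powRr1 (ltW C0_gt0)) -powRD; last by rewrite (gt_eqF C0_gt0) implybT.
by congr (_ `^ _); field.
Qed.

Let a1 : 1 <= a.
Proof. by rewrite -(powRr0 C0) ler_powR. Qed.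

Let ab : a <= b. Proof. by rewrite ler_powR//; lra. Qed.

(** The product of C0^2 * 2 b, a Lipschitz constant of q |-> (C0 / q)^2 on [a, b], and of 1 / (2
    normal_pdf 0 1 b), that of the inverse tail. *)
Definition variance_lipschitz := C0 ^+ 2 * b / normal_pdf 0 1 b.

(** After clamping, the argument of [Phi_inv] is a genuine value of [Phi] on [a, b], so the default
    value 0 is never taken. *)
Let p_hat_range N z : exists2 q, a <= q <= b &
  p_hat C0 N z = 2 * (1 - Phi q) /\ var_hat C0 N z = (C0 / q) ^+ 2.
Proof.
have lu : 2 * (1 - Phi b) <= 2 * (1 - Phi a).
  exact: Phi_tail_le ab.
have h := clamp_range (N%:R^-1 * \sum_(1 <= i < N.+1) (z i).1) lu.
rewrite -/(p_hat C0 N z) in h.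
have [q qab qE] := Phi_tail_surj ab h.
exists q => //; split; first by rewrite qE subKr mulrC divfK.
by rewrite /var_hat -qE PhiK.
Qed.

Lemma var_hat_bounds N z : 0 <= var_hat C0 N z <= C0.
Proof.
have [q /andP[aq qb] [_ ->]] := p_hat_range N z; rewrite sqr_ge0/=.
have q0 : 0 < q by apply: lt_le_trans aq; apply: lt_le_trans a1.
rewrite expr_div_n ler_pdivrMr ?exprn_gt0// expr2 ler_pM2l// -a2.
by rewrite lerXn2r ?nnegrE// ?(le_trans _ a1)// ltW.
Qed.

Lemma var_hat_lipschitz N z v : C0^-1 <= v <= C0 ->
  `|var_hat C0 N z - v| <= variance_lipschitz *
    `|N%:R^-1 * \sum_(1 <= i < N.+1) (z i).1 - 2 * (1 - Phi (C0 / Num.sqrt v))|.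
Proof.
move=> /andP[v1 v2]; have v0 : 0 < v by apply: lt_le_trans v1; rewrite invr_gt0.
set sg := Num.sqrt v; have sg0 : 0 < sg by rewrite sqrtr_gt0.
have sgv : sg ^+ 2 = v by rewrite sqr_sqrtr// ltW.
pose q0 := C0 / sg; rewrite -/q0.
have q0_gt0 : 0 < q0 by rewrite divr_gt0.
have a0 : 0 <= a by rewrite (le_trans _ a1).
have aq0 : a <= q0.
  rewrite /q0 ler_pdivlMr// -[leRHS]a2 expr2 ler_wpM2l//.
  by rewrite -(@ler_pXn2r _ 2)// ?nnegrE ?(ltW sg0)// sgv a2.
have q0b : q0 <= b.
  rewrite /q0 ler_pdivrMr// bE -mulrA ler_peMr ?(ltW C0_gt0)//.
  rewrite -(@ler_pXn2r _ 2) ?nnegrE// ?mulr_ge0 ?(ltW sg0)// expr1n exprMn a2 sgv.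
  by rewrite -ler_pdivrMl// mulr1.
have [q /andP[aq qb] [pE ->]] := p_hat_range N z.
have q_gt0 : 0 < q by apply: lt_le_trans aq; apply: lt_le_trans a1.
set m := N%:R^-1 * _; set p0 := 2 * (1 - Phi q0).
have Pb : 0 < normal_pdf 0 1 b := normal_pdf01_gt0 b.
have L1 : `|p_hat C0 N z - p0| <= `|m - p0|.
  apply: clamp_lipschitz; apply/andP; split; [exact: Phi_tail_le q0b|exact: Phi_tail_le aq0].
have L2 : `|q - q0| <= `|p_hat C0 N z - p0| / (2 * normal_pdf 0 1 b).
  by rewrite pE; apply: Phi_tail_inv_lipschitz; rewrite ?q_gt0 ?q0_gt0.
have q1 : 1 <= q by rewrite (le_trans a1).
have q01 : 1 <= q0 by rewrite (le_trans a1).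
have vE : v = (C0 / q0) ^+ 2.
  by rewrite -sgv /q0 invf_div mulrCA divff ?mulr1// gt_eqF.
have -> : (C0 / q) ^+ 2 - v = C0 ^+ 2 * ((q0 - q) * ((q0 + q) / (q ^+ 2 * q0 ^+ 2))).
  by rewrite vE; field; rewrite !gt_eqF.
have qq : 1 <= q ^+ 2 * q0 ^+ 2 by rewrite -exprMn exprn_ege1// mulr_ege1.
have B : `|(q0 + q) / (q ^+ 2 * q0 ^+ 2)| <= 2 * b.
  rewrite ger0_norm ?divr_ge0 ?addr_ge0 ?(ltW q0_gt0) ?(ltW q_gt0)//; last first.
    by rewrite (le_trans _ qq).
  rewrite ler_pdivrMr ?(lt_le_trans _ qq)//.
  apply: (@le_trans _ _ (2 * b)); first by lra.
  by rewrite ler_peMr// mulr_ge0// (le_trans _ ab).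
rewrite normrM (ger0_norm (sqr_ge0 C0)) normrM distrC.
apply: (@le_trans _ _ (C0 ^+ 2 * (`|m - p0| / (2 * normal_pdf 0 1 b) * (2 * b)))).
  rewrite ler_wpM2l ?sqr_ge0// ler_pM// (le_trans L2)// ler_wpM2r//.
  by rewrite invr_ge0 mulr_ge0// ltW.
rewrite /variance_lipschitz le_eqVlt; apply/orP; left; apply/eqP.
move: (normal_pdf 0 1 b) Pb => P P0; field; exact: lt0r_neq0.
Qed.
End VarianceInversion.

(** * Second moments of the released averages *)

Section CorrelationGap.
Context {d} {T : measurableType d} {R : realType} (P : probability T R).
Variables (f : R -> R) (X : int -> {RV P >-> R}).
Hypothesis SG : stationary_gaussian f X.
Local Notation c := (autocov f).
Local Notation rho := (autocorr f).
Hypothesis c0 : 0 < c 0.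

Lemma sqr_sum_le (n : nat) (a : nat -> R) :
  (\sum_(0 <= i < n) a i) ^+ 2 <= n%:R * \sum_(0 <= i < n) a i ^+ 2.
Proof.
elim: n => [|n IH]; first by rewrite !big_geq// expr0n/= mul0r.
rewrite !big_nat_recr//= -natr1.
have [->|n0] := posnP n; first by rewrite !big_geq// !add0r mul1r.
move: IH (ltr0n R n); rewrite n0.
move: (\sum_(0 <= i < n) a i) (\sum_(0 <= i < n) a i ^+ 2) (a n) n%:R => S Q y N H N0.
have : 0 <= N * (Q + N * y ^+ 2 - 2 * S * y) by have := sqr_ge0 (S - N * y); nra.
by rewrite pmulr_rge0//; nra.
Qed.

Lemma autocorr_increment (e : R) (i j : int) : e ^+ 2 = 1 ->
  \int[P]_w ((X i w - e * X j w) ^+ 2) = 2 * c 0 * (1 - e * rho (j - i)).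
Proof.
move=> e1.
have iX k l := process_product_integrable SG k l.
transitivity (\int[P]_w (X i w * X i w + (- (2 * e)) * (X i w * X j w) + e ^+ 2 * (X j w * X j w))).
  by apply: eq_Rintegral => w _; ring.
rewrite RintegralD//; last 2 first.
- by apply: integrableDR => //; exact: integrableZ.
- exact: integrableZ.
rewrite RintegralD//; last exact: integrableZ.
rewrite !RintegralZl// !(process_covariance SG) !subrr (autocovE c0 (j - i)) e1.
by move: (c 0) (rho (j - i)) => v p; ring.
Qed.

(* Telescope X_0 - e^m X_(hm) into the increments e^i (X_(hi) - e X_(h(i+1))). *)
Lemma autocorr_multiple (e : R) (h : int) (m : nat) : e ^+ 2 = 1 ->
  1 - e ^+ m * rho (h *+ m) <= m%:R ^+ 2 * (1 - e * rho h).
Proof.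
move=> e1; have em k : (e ^+ k) ^+ 2 = 1 by rewrite -exprM mulnC exprM e1 expr1n.
have iX k l := process_product_integrable SG k l.
have I (a b : R) (k l : int) : P.-integrable setT (EFin \o (fun w => (a * X k w - b * X l w) ^+ 2)).
  rewrite (_ : (fun w => _) = (fun w => a ^+ 2 * (X k w * X k w) +
     (- (2 * a * b)) * (X k w * X l w) + b ^+ 2 * (X l w * X l w))); last first.
    by apply/funext => w; ring.
  by do 2?apply: integrableDR; exact: integrableZ.
have tele w : X 0 w - e ^+ m * X (h *+ m) w =
    \sum_(0 <= i < m) e ^+ i * (X (h *+ i) w - e * X (h *+ i.+1) w).
  elim: m => [|m IH]; first by rewrite big_geq// expr0 mulr0n mul1r subrr.
  by rewrite big_nat_recr//= -IH exprSr; ring.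
have le2 : \int[P]_w ((X 0 w - e ^+ m * X (h *+ m) w) ^+ 2) <=
    \int[P]_w (m%:R * \sum_(0 <= i < m) (X (h *+ i) w - e * X (h *+ i.+1) w) ^+ 2).
  apply: le_Rintegral => //.
  - have := I 1 (e ^+ m) 0 (h *+ m).
    by apply: eq_integrable => // w _; rewrite /= mul1r.
  - apply: integrableZ; apply: integrable_bigsum => i.
    have := I 1 e (h *+ i) (h *+ i.+1).
    by apply: eq_integrable => // w _; rewrite /= mul1r.
  - move=> w _; rewrite tele; apply: le_trans (sqr_sum_le _ _) _.
    rewrite ler_wpM2l//; apply: ler_sum => i _.
    by rewrite exprMn em mul1r.
have I1 i : P.-integrable setT (EFin \o (fun w => (X (h *+ i) w - e * X (h *+ i.+1) w) ^+ 2)).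
  have := I 1 e (h *+ i) (h *+ i.+1).
  by apply: eq_integrable => // w _; rewrite /= mul1r.
move: le2; rewrite (autocorr_increment _ _ (em m)) subr0 RintegralZl//; last first.
  exact: integrable_bigsum.
rewrite Rintegral_sum//.
have stepE i : h *+ i.+1 - h *+ i = h by rewrite mulrSr addrAC subrr add0r.
under eq_bigr do rewrite (autocorr_increment _ _ e1) stepE.
rewrite sumr_const_nat subn0 => le2.
rewrite -(@ler_pM2l _ (2 * c 0)) ?mulr_gt0//; apply: le_trans le2 _.
rewrite le_eqVlt; apply/orP; left; apply/eqP.
rewrite -[X in _ * X = _]mulr_natr.
by move: (c 0) (rho h) m%:R => v p M; ring.
Qed.

(* If e rho(h) were closer to 1, for e = 1 or -1, then rho(kh)^2 >= 1/4 for all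
   k <= M, against the summability of rho^2. *)
Lemma autocorr_gap (C1 : R) (M : nat) (h : int) : h != 0 ->
  4 * C1 ^+ 2 < M%:R ->
  (forall u : seq int, uniq u -> 0 \notin u -> \sum_(i <- u) rho i ^+ 2 <= C1 ^+ 2) ->
  (2 * M%:R ^+ 2)^-1 <= 1 - rho h ^+ 2.
Proof.
move=> h0 MC Hsum.
have M0 : 0 < (M%:R : R) by apply: le_lt_trans MC; rewrite mulr_ge0 ?sqr_ge0.
have G e : e ^+ 2 = 1 -> (2 * M%:R ^+ 2)^-1 <= 1 - e * rho h.
  move=> e1; rewrite leNgt; apply/negP => small.
  (* For k <= M the defect k^2 (1 - e rho(h)) is at most 1/2, hence e^k rho(kh) >= 1/2, and squaring
     removes the sign. *)
  have big k : (k <= M)%N -> 4^-1 <= rho (h *+ k) ^+ 2.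
    move=> kM; have := autocorr_multiple h k e1.
    have : k%:R ^+ 2 * (1 - e * rho h) <= 2^-1.
      apply: (@le_trans _ _ (k%:R ^+ 2 * (2 * M%:R ^+ 2)^-1)).
        by rewrite ler_wpM2l ?sqr_ge0// ltW.
      rewrite ler_pdivrMr ?mulr_gt0 ?exprn_gt0// mulrA mulVf// mul1r.
      by rewrite lerXn2r ?nnegrE// ler_nat.
    move=> h1 h2; have h3 : 2^-1 <= e ^+ k * rho (h *+ k) by lra.
    have -> : rho (h *+ k) ^+ 2 = (e ^+ k * rho (h *+ k)) ^+ 2.
      by rewrite [RHS]exprMn; have -> : (e ^+ k) ^+ 2 = 1; [rewrite -exprM mulnC exprM e1 expr1n|rewrite mul1r].
    by move: h3; move: (_ * _) => y h3; nra.
  (* These are M distinct nonzero lags, each contributing at least 1/4, and M / 4 > C1^2. *)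
  have := Hsum [seq h *+ k.+1 | k <- iota 0 M].
  rewrite map_inj_uniq ?iota_uniq; last first.
    by move=> k l /(mulrIn h0) [].
  rewrite big_map => /(_ isT _).
  have nz : 0 \notin [seq h *+ k.+1 | k <- iota 0 M].
    by apply/negP => /mapP[k _ /esym/eqP]; rewrite mulrn_eq0 (negbTE h0).
  move=> /(_ nz); apply/negP; rewrite -ltNge.
  apply: (@lt_le_trans _ _ (\sum_(k <- iota 0 M) (4^-1 : R))).
    rewrite -[X in iota 0 X](subn0 M) sumr_const_nat subn0 -[_ *+ M]mulr_natr; lra.
  rewrite big_seq [leRHS]big_seq; apply: ler_sum => k.
  by rewrite mem_iota add0n => /andP[_ kM]; exact: big.
(* One of 1 - rho and 1 + rho is at least 1, so their product 1 - rho^2 inherits the lower bound of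
   the other. *)
have := G 1 (expr1n _ _); have : (-1 : R) ^+ 2 = 1 by rewrite sqrrN expr1n.
move=> /G.
rewrite mul1r mulN1r opprK.
have : 0 < (2 * (M%:R : R) ^+ 2)^-1 by rewrite invr_gt0 mulr_gt0 ?exprn_gt0.
move: (rho h) (_^-1) => p D D0 h1 h2.
by nra.
Qed.
End CorrelationGap.

Section TailExpectation.
Context {d} {T : measurableType d} {R : realType} (P : probability T R).
Variables (f : R -> R) (X : int -> {RV P >-> R}).
Hypothesis SG : stationary_gaussian f X.
Local Notation c := (autocov f).
Hypothesis c0 : 0 < c 0.

(** [lincomb2_normal] provides a deviation that is known through its square, so s may be -1. *)
Lemma normal_prob_sqr1 (s : R) : s ^+ 2 = 1 -> normal_prob 0 s = normal_prob 0 1.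
Proof.
move=> s1; have s0 : s != 0.
  by apply/eqP => s0; move: s1; rewrite s0 expr0n/= => /eqP; rewrite eq_sym oner_eq0.
apply/funext => A; rewrite /normal_prob; apply: eq_integral => x _.
by rewrite !normal_pdfE ?oner_neq0// /normal_fun /normal_peak s1 expr1n.
Qed.

Lemma tail_expectation (i : int) (C : R) : 0 <= C ->
  \int[P]_w ((C < `|X i w|)%R%:R : R) = 2 * (1 - Phi (C / Num.sqrt (c 0))).
Proof.
move=> C_ge0; set sg := Num.sqrt (c 0).
have sg0 : 0 < sg by rewrite sqrtr_gt0.
have sg2 : sg ^+ 2 = c 0 by rewrite sqr_sqrtr// ltW.
(* e = 1 and e = -1 give the right and the left tail of X i; the summand with coefficient 0 only
   serves to match [lincomb2_normal]. *)
have tail (e : R) : e ^+ 2 = 1 ->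
    P ((fun w => e / sg * X i w + 0 * X i w) @^-1` `]C / sg, +oo[) = (1 - Phi (C / sg))%:E.
  move=> e1; have v1 : c 0 * ((e / sg) ^+ 2 + 0 ^+ 2 +
      2 * autocorr f (i - i) * (e / sg) * 0) = 1.
    by rewrite mulr0 expr0n/= !addr0 expr_div_n e1 sg2 div1r divff// gt_eqF.
  have := @lincomb2_normal _ _ _ P f X SG c0 i i (e / sg) 0; rewrite /= v1.
  move=> /(_ (oner_neq0 _))[s [_ s1 ->]]//.
  by rewrite (normal_prob_sqr1 s1) normal_prob_gt.
have mE e : measurable ((fun w => e / sg * X i w + 0 * X i w) @^-1` `]C / sg, +oo[).
  rewrite -[X in measurable X]setTI.
  have mf : measurable_fun setT (fun w => e / sg * X i w + 0 * X i w).
    by apply: measurable_funD; exact: measurable_funM.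
  exact: mf.
pose A := (fun w => 1 / sg * X i w + 0 * X i w) @^-1` `]C / sg, +oo[.
pose B := (fun w => -1 / sg * X i w + 0 * X i w) @^-1` `]C / sg, +oo[.
transitivity (\int[P]_w (\1_A w + \1_B w)).
  apply: eq_Rintegral => w _; rewrite !indicE.
  have memE (e : R) : (w \in (fun w => e / sg * X i w + 0 * X i w) @^-1` `]C / sg, +oo[) = (C < e * X i w).
    rewrite -[RHS](@ltr_pM2r _ sg^-1) ?invr_gt0// [in RHS]mulrAC.
    by apply/idP/idP; rewrite inE /= in_itv/= andbT mul0r addr0.
  rewrite /A /B !memE mul1r mulN1r -natrD.
  (* Since C >= 0, at most one of the two tails contains the point, and the sum of the indicators is
     that of C < |X i|. *)
  have [x0|x0] := leP 0 (X i w); congr (_%:R).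
    by rewrite ger0_norm//; case: ltP => ?; case: ltP => ? //; exfalso; lra.
  by rewrite ltr0_norm//; case: ltP => ?; case: ltP => ? //; exfalso; lra.
rewrite RintegralD//; last 2 first.
- by apply: integrable_indic => //; exact: mE.
- by apply: integrable_indic => //; exact: mE.
rewrite /Rintegral (integral_indic _ measurableT (mE 1)) (integral_indic _ measurableT (mE (-1))).
rewrite !setIT; have /= -> := congr1 fine (tail 1 (expr1n _ _)).
have /= -> := congr1 fine (tail (-1) (etrans (sqrrN _) (expr1n _ _))).
by rewrite mulr_natl.
Qed.
End TailExpectation.

Section SecondMoment.
Context {d} {T : measurableType d} {R : realType} (P : probability T R).

(* No measurability is needed: Phi_inv is not known to be measurable. *)
Lemma integral_dominated_le (f g : T -> \bar R) : (forall w, 0 <= f w)%E ->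
  (forall w, f w <= g w)%E -> (\int[P]_w f w <= \int[P]_w g w)%E.
Proof.
move=> f0 fg; rewrite !ge0_integralTE//; last by move=> w; exact: le_trans (fg w).
apply: ereal_sup_le => _ [u uf <-]; exists u => // w.
exact: le_trans (uf w) (fg w).
Qed.

Variables (I : eqType) (s : seq I) (A : I -> T -> R).
Hypothesis iA : forall j k, j \in s -> k \in s ->
  P.-integrable setT (EFin \o (fun w => A j w * A k w)).

(** Extension by 0 outside of [s]: linearity of the integral is stated for families integrable at
    every index. *)
Let Z j w : R := if j \in s then A j w else 0.

Let iZ j k : P.-integrable setT (EFin \o (fun w => Z j w * Z k w)).
Proof.
rewrite /Z; have [js|_] := boolP (j \in s); have [ks|_] := boolP (k \in s).
- exact: iA.
- by under [X in EFin \o X]funext do rewrite mulr0; exact: integrable0.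
- by under [X in EFin \o X]funext do rewrite mul0r; exact: integrable0.
- by under [X in EFin \o X]funext do rewrite mul0r; exact: integrable0.
Qed.

Let sqrE w : (\sum_(j <- s) A j w) ^+ 2 = \sum_(j <- s) \sum_(k <- s) Z j w * Z k w.
Proof.
by rewrite -big_distrlr/= -expr2; congr (_ ^+ 2); apply: eq_big_seq => j; rewrite /Z => ->.
Qed.

Lemma sqr_sum_integrable :
  P.-integrable setT (EFin \o (fun w => (\sum_(j <- s) A j w) ^+ 2)).
Proof.
under [X in EFin \o X]funext do rewrite sqrE.
by apply: integrable_bigsum => j; apply: integrable_bigsum.
Qed.

Lemma sqr_sum_expectation (K : I -> I -> R) (B : R) :
  (forall j k, j \in s -> k \in s -> \int[P]_w (A j w * A k w) <= K j k) ->
  (forall j, j \in s -> \sum_(k <- s) K j k <= B) ->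
  \int[P]_w ((\sum_(j <- s) A j w) ^+ 2) <= (size s)%:R * B.
Proof.
move=> AK KB; under eq_Rintegral do rewrite sqrE.
rewrite Rintegral_sum; last by move=> j; exact: integrable_bigsum.
under eq_bigr do rewrite Rintegral_sum//.
have -> : (size s)%:R * B = \sum_(j <- s) B.
  by rewrite big_const_seq count_predT iter_addr_0 mulr_natl.
rewrite big_seq [leRHS]big_seq; apply: ler_sum => j js; apply: le_trans (KB j js).
by rewrite big_seq [leRHS]big_seq; apply: ler_sum => k ks; rewrite /Z js ks AK.
Qed.

Lemma sqr_sum_orthogonal (B : R) : uniq s ->
  (forall j k, j \in s -> k \in s -> j != k -> \int[P]_w (A j w * A k w) = 0) ->
  (forall j, j \in s -> \int[P]_w (A j w ^+ 2) <= B) ->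
  \int[P]_w ((\sum_(j <- s) A j w) ^+ 2) <= (size s)%:R * B.
Proof.
move=> us A0 AB; apply: (@sqr_sum_expectation (fun j k => if k == j then B else 0)).
  move=> j k js ks; case: eqVneq => [->|kj].
    by under eq_Rintegral do rewrite -expr2; exact: AB.
  by rewrite A0// eq_sym.
move=> j js; rewrite (bigD1_seq j)//= eqxx big1 ?addr0// => k /negbTE ->//.
Qed.
End SecondMoment.

Section NoiseMoments.
Context {d} {T : measurableType d} {R : realType} (P : probability T R).
Variables (N : nat) (X : int -> {RV P >-> R}) (W : nat * nat -> {RV P >-> R}).
Hypothesis LN : laplace_noise N X W.
Local Notation D := (noise_index N).
Local Notation m2 := (@laplace_moment R 2).
Local Notation m4 := (@laplace_moment R 4).

Lemma noise_mean p : D p -> \int[P]_w W p w = 0.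
Proof. by move=> Dp; apply: laplace_law_mean; exact: (noise_law LN). Qed.

Lemma noise_moment k p : (k <= 4)%N -> D p ->
  P.-integrable setT (EFin \o (fun w => W p w ^+ k)) /\
  \int[P]_w (W p w ^+ k) = laplace_moment k.
Proof. by move=> k4 Dp; apply: laplace_law_moment => //; exact: (noise_law LN). Qed.

Lemma noise_integrable p : D p -> P.-integrable setT (EFin \o W p).
Proof. by move=> Dp; have [] := @noise_moment 1 p isT Dp. Qed.

Lemma noise_integrableM p q : D p -> D q ->
  P.-integrable setT (EFin \o (fun w => W p w * W q w)).
Proof.
move=> Dp Dq; apply: integrableM2 => //.
- by have [] := @noise_moment 2 p isT Dp.
- by have [] := @noise_moment 2 q isT Dq.
Qed.

Lemma noise_uncorrelated p q : D p -> D q -> p != q ->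
  \int[P]_w (W p w * W q w) = 0.
Proof.
move=> Dp Dq pq.
have Dq' : [set` finmap.fset1 q] `<=` D by move=> i /=; rewrite inE => /eqP ->.
rewrite (@lone_RintegralM _ _ _ P _ D W (finmap.fset1 q) p (noise_indep LN)) //.
- by rewrite noise_mean// mul0r.
- by rewrite inE.
- by apply: sigma_measurable_RV; rewrite /= inE.
- exact: noise_integrable.
- exact: noise_integrable.
- exact: noise_integrableM.
Qed.

Lemma noise_integrableM4 p q r t : D p -> D q -> D r -> D t ->
  P.-integrable setT (EFin \o (fun w => W p w * W q w * W r w * W t w)).
Proof.
move=> Dp Dq Dr Dt; apply: integrableM4 => //.
- by have [] := @noise_moment 4 p isT Dp.
- by have [] := @noise_moment 4 q isT Dq.
- by have [] := @noise_moment 4 r isT Dr.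
- by have [] := @noise_moment 4 t isT Dt.
Qed.

(* For j < k the index k + h occurs only once in W_j W_(j+h) W_k W_(k+h), which
   therefore has mean zero. *)
Lemma noise_lone4 p q r t : D p -> D q -> D r -> D t ->
  p != q -> p != r -> p != t ->
  \int[P]_w (W p w * (W q w * W r w * W t w)) = 0.
Proof.
move=> Dp Dq Dr Dt pq pr pt.
pose J : {fset nat * nat} := [fset q; r; t]%fset.
have DJ : [set` J] `<=` D.
  by move=> i /=; rewrite !inE => /orP[/orP[|]|] /eqP ->.
have inJ i : i \in J -> sigma_measurable [set` J] W (W i).
  by move=> iJ; exact: sigma_measurable_RV.
rewrite (@lone_RintegralM _ _ _ P _ D W J p (noise_indep LN)) //.
- by rewrite noise_mean// mul0r.
- by rewrite !inE !negb_or pq pr pt.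
- by apply: measurable_funM; [apply: measurable_funM|]; apply: inJ; rewrite !inE eqxx ?orbT.
- exact: noise_integrable.
- have : P.-integrable setT (EFin \o (fun w => W q w * W r w * W t w * 1)).
    apply: integrableM4 => //.
    + by have [] := @noise_moment 4 q isT Dq.
    + by have [] := @noise_moment 4 r isT Dr.
    + by have [] := @noise_moment 4 t isT Dt.
    + by apply: (@bounded_integrable _ _ _ P _ 1) => // w; rewrite expr1n normr1.
  by apply: eq_integrable => // w _; rewrite /= mulr1.
- have := noise_integrableM4 Dp Dq Dr Dt.
  by apply: eq_integrable => // w _ /=; rewrite !mulrA.
Qed.
End NoiseMoments.

Section NoiseSums.
Context {d} {T : measurableType d} {R : realType} (P : probability T R).
Variables (N : nat) (X : int -> {RV P >-> R}) (W : nat * nat -> {RV P >-> R}).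
Hypothesis LN : laplace_noise N X W.
Local Notation D := (noise_index N).
Local Notation m2 := (@laplace_moment R 2).
Local Notation m4 := (@laplace_moment R 4).

Lemma bounded_integrableM (f g : T -> R) : measurable_fun setT f ->
  (forall w, `|f w| <= 1) -> P.-integrable setT (EFin \o g) ->
  P.-integrable setT (EFin \o (fun w => f w * g w)).
Proof.
move=> mf f1 ig; apply: (le_integrable _ _ _ ig) => //.
  apply/measurable_EFinP; apply: measurable_funM => //.
  by apply/measurable_EFinP; exact: measurable_int ig.
by move=> w _; rewrite /= lee_fin normrM ler_piMl.
Qed.

Section ModulatedNoise.
Variables (s : seq nat) (p : nat -> nat * nat) (S : nat -> T -> R).
Hypotheses (us : uniq s) (injp : injective p) (Dp : forall j, j \in s -> D (p j)).
Hypotheses (mS : forall j, sigma_measurable setT X (S j)) (S1 : forall j w, `|S j w| <= 1).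

Let mS' j : measurable_fun setT (S j). Proof. exact: sigma_measurableW (mS j). Qed.

Let mSS j k : measurable_fun setT (fun w => S j w * S k w).
Proof. exact: measurable_funM. Qed.

Let SS1 j k w : `|S j w * S k w| <= 1.
Proof. by rewrite normrM mulr_ile1. Qed.

Let int_SWSW j k : j \in s -> k \in s ->
  P.-integrable setT (EFin \o (fun w => (S j w * W (p j) w) * (S k w * W (p k) w))).
Proof.
move=> js ks.
have := bounded_integrableM (mSS j k) (SS1 j k) (noise_integrableM LN (Dp js) (Dp ks)).
by apply: eq_integrable => // w _; rewrite /= mulrACA.
Qed.

Lemma modulated_noise_integrable :
  P.-integrable setT (EFin \o (fun w => (\sum_(j <- s) S j w * W (p j) w) ^+ 2)).
Proof. exact: (sqr_sum_integrable (A := fun j w => S j w * W (p j) w)). Qed.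

(** Independence of the noise from the process splits off the factors S, after which the cross terms
    vanish because distinct noise variables are uncorrelated. Signs S serve the products of released
    signs, S = 1 the pure noise of the other average. *)
Lemma modulated_noise_sqr :
  \int[P]_w ((\sum_(j <- s) S j w * W (p j) w) ^+ 2) <= (size s)%:R * m2.
Proof.
apply: (sqr_sum_orthogonal (A := fun j w => S j w * W (p j) w)) => //.
  move=> j k js ks jk.
  transitivity (\int[P]_w ((S j w * S k w) * (W (p j) w * W (p k) w))).
    by apply: eq_Rintegral => w _; rewrite mulrACA.
  rewrite (indep_generated_RintegralM (noise_indep_process LN)).
  - rewrite (noise_uncorrelated LN (Dp js) (Dp ks)) ?mulr0//.
    by apply: contraNneq jk => /injp ->.
  - by apply: measurable_funM; exact: mS.
  - by apply: measurable_funM; apply: sigma_measurable_RV; exact: Dp.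
  - exact: bounded_integrable.
  - by apply: (noise_integrableM LN); exact: Dp.
  - by apply: bounded_integrableM => //; apply: (noise_integrableM LN); exact: Dp.
move=> j js; have [i2 <-] := noise_moment LN (isT : (2 <= 4)%N) (Dp js).
apply: le_Rintegral => //.
  have := int_SWSW js js; by apply: eq_integrable => // w _.
move=> w _; rewrite exprMn -[leRHS]mul1r ler_wpM2r ?sqr_ge0//.
by rewrite -(real_normK (num_real _)) expr_le1.
Qed.
End ModulatedNoise.

Section NoiseProducts.
Variables (s : seq nat) (h : nat).
Hypotheses (us : uniq s) (h0 : (0 < h)%N).
Hypothesis (Ds : forall j, j \in s -> D (j, 2%N) /\ D ((j + h)%N, 2%N)).

Let A j w := W (j, 2%N) w * W ((j + h)%N, 2%N) w.

Let iA j k : j \in s -> k \in s -> P.-integrable setT (EFin \o (fun w => A j w * A k w)).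
Proof.
move=> /Ds[j1 j2] /Ds[k1 k2]; have := noise_integrableM4 LN j1 j2 k1 k2.
by apply: eq_integrable => // w _; rewrite /= /A !mulrA.
Qed.

Lemma noise_products_integrable :
  P.-integrable setT (EFin \o (fun w => (\sum_(j <- s) W (j, 2%N) w * W ((j + h)%N, 2%N) w) ^+ 2)).
Proof. exact: (sqr_sum_integrable (A := A)). Qed.

Lemma noise_products_sqr :
  \int[P]_w ((\sum_(j <- s) W (j, 2%N) w * W ((j + h)%N, 2%N) w) ^+ 2) <= (size s)%:R * m4.
Proof.
have A0 j k : j \in s -> k \in s -> (j < k)%N -> \int[P]_w (A j w * A k w) = 0.
  move=> /Ds[j1 j2] /Ds[k1 k2] jk.
  rewrite -[RHS](noise_lone4 LN k2 j1 j2 k1).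
  - by apply: eq_Rintegral => w _; rewrite /A; ring.
  - by rewrite xpair_eqE eqxx andbT gtn_eqF// ltn_addr.
  - by rewrite xpair_eqE eqxx andbT eqn_add2r gtn_eqF.
  - by rewrite xpair_eqE eqxx andbT -[X in _ == X]addn0 eqn_add2l gtn_eqF.
apply: (sqr_sum_orthogonal (A := A)) => //.
  move=> j k js ks; rewrite neq_ltn => /orP[|] jk; first exact: A0.
  by under eq_Rintegral do rewrite mulrC; exact: A0.
move=> j js; have [j1 j2] := Ds js.
have [i1 e1] := noise_moment LN (isT : (4 <= 4)%N) j1.
have [i2 e2] := noise_moment LN (isT : (4 <= 4)%N) j2.
(* 2 x y <= x^2 + y^2 bounds the diagonal term by the mean of two fourth moments. *)
apply: (@le_trans _ _ (\int[P]_w (2^-1 * (W (j, 2%N) w ^+ 4 + W ((j + h)%N, 2%N) w ^+ 4)))).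
  apply: le_Rintegral => //.
  - by have := iA js js; apply: eq_integrable => // w _.
  - by apply: integrableZ; exact: integrableDR.
  move=> w _; rewrite /A exprMn -[4%N]/(2 * 2)%N !exprM.
  move: (W _ w ^+ 2) (W _ w ^+ 2) => x y; have := sqr_ge0 (x - y); nra.
rewrite RintegralZl//; last exact: integrableDR.
by rewrite RintegralD// e1 e2; move: m4 => x; lra.
Qed.
End NoiseProducts.
End NoiseSums.

Section WeaklyDependentSums.
Context {d} {T : measurableType d} {R : realType} (P : probability T R).
Variables (g : nat -> T -> R) (m B : R) (kappa : int -> R).
Hypotheses (mg : forall i, measurable_fun setT (g i)) (g1 : forall i w, `|g i w| <= 1).
Hypotheses (gm : forall i, \int[P]_w g i w = m).
Hypothesis covg : forall i j, `|cov P (g i) (g j)| <= kappa (j%:Z - i%:Z).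
Hypothesis kappaB : forall u, uniq u -> \sum_(i <- u) kappa i <= B.
Variables (s : seq nat).
Hypothesis us : uniq s.

Let ig i : P.-integrable setT (EFin \o g i).
Proof. exact: (@bounded_integrable _ _ _ P _ 1). Qed.

Let igg i j : P.-integrable setT (EFin \o (fun w => g i w * g j w)).
Proof.
apply: (@bounded_integrable _ _ _ P _ 1); first exact: measurable_funM.
by move=> w; rewrite normrM mulr_ile1.
Qed.

Let expand i j w : (g i w - m) * (g j w - m) =
  g i w * g j w + (- m) * g i w + (- m) * g j w + m ^+ 2.
Proof. by ring. Qed.

Let icst r : P.-integrable setT (EFin \o (fun=> r)).
Proof. exact: finite_measure_integrable_cst. Qed.

Let icentered i j : P.-integrable setT (EFin \o (fun w => (g i w - m) * (g j w - m))).
Proof.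
under [X in EFin \o X]funext do rewrite expand.
by apply: integrableDR => //; apply: integrableDR; [apply: integrableDR => //|]; exact: integrableZ.
Qed.

Lemma centered_sum_integrable :
  P.-integrable setT (EFin \o (fun w => (\sum_(i <- s) (g i w - m)) ^+ 2)).
Proof. exact: (sqr_sum_integrable (A := fun i w => g i w - m)). Qed.

(** For fixed i the lags j - i are pairwise distinct, so each row of the covariance matrix sums
    kappa over distinct integers and is at most B. *)
Lemma centered_sum_sqr :
  \int[P]_w ((\sum_(i <- s) (g i w - m)) ^+ 2) <= (size s)%:R * B.
Proof.
apply: (@sqr_sum_expectation _ _ _ P _ s (fun i w => g i w - m) _
  (fun i j => kappa (j%:Z - i%:Z))) => //.
  move=> i j _ _; apply: le_trans (covg i j); apply: le_trans (ler_norm _).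
  under eq_Rintegral do rewrite expand.
  have iZ k := integrableZ (- m) (ig k).
  rewrite RintegralD//; last by do 2!apply: integrableDR => //.
  rewrite RintegralD//; last by apply: integrableDR.
  rewrite RintegralD// !RintegralZl// Rintegral_prob_cst !gm /cov !gm.
  by move: (\int[P]_w _) => y; lra.
move=> i _; rewrite -(big_map (fun j : nat => j%:Z - i%:Z) xpredT kappa).
apply: kappaB; rewrite map_inj_uniq// => j k /addIr.
by case.
Qed.
End WeaklyDependentSums.

Section SignalSums.
Context {d} {T : measurableType d} {R : realType} (P : probability T R).
Variables (f : R -> R) (X : int -> {RV P >-> R}) (C0 C1 s : R).
Hypothesis SG : stationary_gaussian f X.
Hypotheses (hs : 1 / 2 < s) (Hf : smoothness_class C0 C1 s f).
Local Notation c := (autocov f).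
Local Notation rho := (autocorr f).
Hypothesis c0 : 0 < c 0.

Let sum_rho u : uniq u -> \sum_(i <- u) rho i ^+ 2 <= 1 + C1 ^+ 2.
Proof.
by apply: (sum_sqr_autocorr hs Hf); rewrite (autocorr0 c0) expr1n.
Qed.

Variables (t : seq nat).
Hypothesis ut : uniq t.

Let exceed (i : nat) w : R := (C0 < `|X i%:Z w|)%R%:R.
Let p : R := 2 * (1 - Phi (C0 / Num.sqrt (c 0))).

Lemma measurable_exceed i : measurable_fun setT (exceed i).
Proof.
apply: (measurableT_comp (f := fun b : bool => b%:R : R)) => //.
by apply: measurable_fun_ltr => //; exact: measurableT_comp.
Qed.

Lemma exceed_sum : 0 <= C0 ->
  P.-integrable setT (EFin \o (fun w => (\sum_(i <- t) (exceed i w - p)) ^+ 2)) /\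
  \int[P]_w ((\sum_(i <- t) (exceed i w - p)) ^+ 2) <= (size t)%:R * (2 * (1 + C1 ^+ 2)).
Proof.
move=> C0_ge0.
have e1 i w : `|exceed i w| <= 1 by rewrite /exceed; case: (_ < _); rewrite ?normr1 ?normr0.
split; first exact: centered_sum_integrable measurable_exceed e1 _.
apply: (@centered_sum_sqr _ _ _ P exceed p _ (fun i => 2 * rho i ^+ 2)) => //.
- exact: measurable_exceed.
- by move=> i; exact: (tail_expectation SG c0).
- by move=> i j; exact: (cov_exceed_process SG c0).
- by move=> u uu; rewrite -mulr_sumr ler_wpM2l// sum_rho.
Qed.

Section SignProducts.
Variables (h : int) (delta : R).
Hypotheses (delta0 : 0 < delta) (gap : delta <= 1 - rho h ^+ 2).

Let sgn2 (i : nat) w : R := Num.sg (X i%:Z w) * Num.sg (X (i%:Z + h) w).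
Let mu : R := \int[P]_w (Num.sg (X 0 w) * Num.sg (X (0 + h) w)).

Let rho1 : rho h ^+ 2 < 1.
Proof. by rewrite -subr_gt0 (lt_le_trans delta0). Qed.

Let sg1 (x : R) : `|Num.sg x| <= 1.
Proof. by rewrite normr_sg; case: (x != 0). Qed.

Let m_sg i : measurable_fun setT (fun w => Num.sg (X i w)).
Proof. by apply: (measurableT_comp (@measurable_sg R)). Qed.

Lemma sign_product_norm i j w : `|Num.sg (X i w) * Num.sg (X j w)| <= 1.
Proof. by rewrite normrM mulr_ile1. Qed.

(** Stationarity is given for covariances alone. Sheppard's formula transfers it to the means, as pi
    / 2 times each mean lies in [- pi / 2, pi / 2], where the sine is injective. *)
Lemma sign_product_mean_stationary (i : int) :
  \int[P]_w (Num.sg (X i w) * Num.sg (X (i + h) w)) = mu.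
Proof.
have mean1 k l : `|\int[P]_w (Num.sg (X k w) * Num.sg (X l w))| <= 1.
  by apply: Rintegral_abs_le; [exact: measurable_funM|exact: sign_product_norm].
have pi2 : 0 < pi / 2 :> R by rewrite divr_gt0 ?pi_gt0.
apply: (mulfI (lt0r_neq0 pi2)); apply: sin_inj; last first.
  by rewrite !(sheppard_process SG c0).
all: rewrite in_itv/= -ler_norml normrM gtr0_norm// ler_piMr// ?mean1 ?ltW//.
Qed.

Lemma sign_products_sum :
  P.-integrable setT (EFin \o (fun w => (\sum_(i <- t) (sgn2 i w - mu)) ^+ 2)) /\
  \int[P]_w ((\sum_(i <- t) (sgn2 i w - mu)) ^+ 2) <=
  (size t)%:R * (384 / delta ^+ 2 * (3 * (1 + C1 ^+ 2))).
Proof.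
have ms i : measurable_fun setT (sgn2 i) by exact: measurable_funM.
have s1 i w : `|sgn2 i w| <= 1 by exact: sign_product_norm.
split; first exact: centered_sum_integrable ms s1 _.
apply: (@centered_sum_sqr _ _ _ P sgn2 mu _ (fun i => 384 / delta ^+ 2 *
  (rho i ^+ 2 + rho (i + h) ^+ 2 + rho (i - h) ^+ 2))) => //.
- by move=> i; exact: sign_product_mean_stationary.
- move=> i j; apply: le_trans (cov_sg_process SG c0 i j rho1) _.
  have r0 : 0 < 1 - rho h ^+ 2 by apply: lt_le_trans gap.
  apply: ler_wpM2r; first by rewrite !addr_ge0 ?sqr_ge0.
  apply: ler_wpM2l (ler0n _ _) _ _ _; rewrite lef_pV2 ?posrE ?exprn_gt0//.
  by rewrite lerXn2r ?nnegrE// ltW.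
- move=> u uu; rewrite -mulr_sumr.
  apply: ler_wpM2l; first exact: divr_ge0 (ler0n _ _) (sqr_ge0 _).
  rewrite !big_split/=.
  (* Translating distinct lags keeps them distinct, so each of the three sums obeys the same bound;
     hence the factor 3. *)
  have shift k : \sum_(i <- u) rho (i + k) ^+ 2 <= 1 + C1 ^+ 2.
    rewrite -(big_map (fun i => i + k) xpredT (fun i => rho i ^+ 2)) sum_rho//.
    by rewrite map_inj_uniq//; exact: addIr.
  have := sum_rho uu; have := shift h; have := shift (- h); lra.
Qed.
End SignProducts.
End SignalSums.

(** * Mean square error *)

Section PointwiseError.
Context {R : realType}.

Lemma sin_lipschitz (x y : R) : `|sin x - sin y| <= `|x - y|.
Proof.
wlog xy : x y / y <= x.
  move=> H; have [/H//|/ltW/H] := leP y x.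
  by rewrite distrC [leRHS]distrC.
have [|z _ ->] := @MVT_segment R sin cos y x xy (fun z _ => is_derive_sin z).
  by apply: continuous_subspaceT => z; exact: continuous_sin.
by rewrite normrM ler_piMl// cos_max.
Qed.

(** The error splits as v (sin (pi / 2 * t) - r) + (v - c) r, with 0 <= v <= C0, the sine
    1-Lipschitz, and |r| <= 1 because r is itself a sine. *)
Lemma estimator_error (C0 L v c r t m p q : R) :
  0 <= v <= C0 -> `|v - c| <= L * `|p - q| -> sin (pi / 2 * m) = r ->
  `|v * sin (pi / 2 * t) - c * r| ^+ 2 <=
  2 * (C0 * (pi / 2)) ^+ 2 * (t - m) ^+ 2 + 2 * L ^+ 2 * (p - q) ^+ 2.
Proof.
move=> /andP[v0 vC] vc mr; rewrite real_normK ?num_real//.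
pose x := v * (sin (pi / 2 * t) - r); pose y := (v - c) * r.
have -> : v * sin (pi / 2 * t) - c * r = x + y.
  by rewrite /x /y; move: (sin _) => z; ring.
have pi2 : 0 <= pi / 2 :> R by rewrite divr_ge0 ?pi_ge0.
have hx : x ^+ 2 <= (C0 * (pi / 2)) ^+ 2 * (t - m) ^+ 2.
  rewrite -exprMn -(real_normK (num_real x)) -[leRHS](real_normK (num_real _)).
  rewrite lerXn2r ?nnegrE// /x -mr -[C0 * _ * _]mulrA normrM [leRHS]normrM (ger0_norm v0).
  rewrite (ger0_norm (le_trans v0 vC)) ler_pM//.
  by apply: le_trans (sin_lipschitz _ _) _; rewrite -mulrBr.
have hy : y ^+ 2 <= L ^+ 2 * (p - q) ^+ 2.
  rewrite -exprMn -(real_normK (num_real y)) -[leRHS](real_normK (num_real _)).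
  rewrite lerXn2r ?nnegrE// /y normrM -[leRHS]mulr1 ler_pM//.
    by apply: le_trans vc _; rewrite normrM ler_wpM2r// ler_norm.
  by rewrite -mr ler_norml sin_geN1 sin_le1.
move: hx hy; have := sqr_ge0 (x - y); rewrite -!mulrA.
move: (_ * (t - m) ^+ 2) (_ * (p - q) ^+ 2) => u w; nra.
Qed.

Lemma sqr_sum2_le (x y : R) : (x + y) ^+ 2 <= 2 * (x ^+ 2 + y ^+ 2).
Proof. by have := sqr_ge0 (x - y); nra. Qed.

Lemma sqr_sum4_le (x y z u : R) :
  (x + y + z + u) ^+ 2 <= 4 * (x ^+ 2 + y ^+ 2 + z ^+ 2 + u ^+ 2).
Proof.
have := sqr_sum2_le (x + y) (z + u); have := sqr_sum2_le x y; have := sqr_sum2_le z u.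
by rewrite addrA; lra.
Qed.

Lemma truncated_rate (K B q n x : R) : 0 <= K -> 0 <= B -> 0 < q -> 0 < n ->
  x <= B -> x <= K / (q * n) -> x <= (K + B) * Num.min 1 (q * n)^-1.
Proof.
move=> K0 B0 q0 n0 xB xK.
have y0 : 0 <= (q * n)^-1 by rewrite invr_ge0 mulr_ge0 ?ltW.
rewrite /Num.min; case: ifP => _; first by rewrite mulr1 (le_trans xB)// lerDr.
by rewrite (le_trans xK)// ler_wpM2r// lerDl.
Qed.
End PointwiseError.

Section MeanSquareError.
Context {d} {T : measurableType d} {R : realType} (P : probability T R).
Variables (C0 C1 s alpha : R) (N h M : nat).
Hypotheses (hC0 : 1 <= C0) (hs : 1 / 2 < s) (alpha0 : 0 < alpha).
Hypotheses (h0 : (0 < h)%N) (hN : (h < N)%N) (hM : 4 * C1 ^+ 2 < M%:R).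
Variables (f : R -> R) (X : int -> {RV P >-> R}) (W : nat * nat -> {RV P >-> R}).
Hypotheses (Hf : smoothness_class C0 C1 s f).
Hypotheses (SG : stationary_gaussian f X) (LN : laplace_noise N X W).
Local Notation c := (autocov f).
Local Notation rho := (autocorr f).
Local Notation m2 := (@laplace_moment R 2).
Local Notation m4 := (@laplace_moment R 4).
Local Notation n := (N - h)%N.
Local Notation a := (3 / alpha).

Let delta : R := (2 * M%:R ^+ 2)^-1.
Let L := variance_lipschitz C0.

Definition sign_constant : R := 384 / delta ^+ 2 * (3 * (1 + C1 ^+ 2)).
Definition exceed_constant : R := 2 * (1 + C1 ^+ 2).
(** 8 = 2 * 4 and 4 = 2 * 2 come from splitting the error in two and then squaring sums of four and
    of two terms. 18 = 2 * 3^2, 81 = 3^4 and 9 = 3^2 come from the noise scale 3 / alpha. *)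
Definition rate_constant : R :=
  8 * (C0 * (pi / 2)) ^+ 2 * (sign_constant + 18 * m2 + 81 * m4) +
  4 * L ^+ 2 * (exceed_constant + 9 * m2).

Let C00 : 0 < C0. Proof. exact: lt_le_trans hC0. Qed.

Let cC : C0^-1 <= c 0 <= C0.
Proof. by case: Hf => _; rewrite in_itv/=. Qed.

Let c0 : 0 < c 0.
Proof. by case/andP: cC => h1 _; apply: lt_le_trans h1; rewrite invr_gt0. Qed.

Let delta0 : 0 < delta.
Proof.
rewrite invr_gt0 mulr_gt0 ?exprn_gt0//; apply: le_lt_trans hM.
by rewrite mulr_ge0 ?sqr_ge0.
Qed.

Let gap : delta <= 1 - rho h%:Z ^+ 2.
Proof.
apply: (autocorr_gap SG c0 _ hM); first by rewrite eqz_nat -lt0n.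
exact: sum_sqr_autocorr_neq0 hs Hf.
Qed.

Let mu : R := \int[P]_w (Num.sg (X 0 w) * Num.sg (X (0 + h%:Z) w)).

Let sheppard_mu : sin (pi / 2 * mu) = rho h%:Z.
Proof. by apply: (sheppard_process SG c0); rewrite -subr_gt0 (lt_le_trans delta0). Qed.

Let p : R := 2 * (1 - Phi (C0 / Num.sqrt (c 0))).

Let J := index_iota 1 n.+1.
Let I := index_iota 1 N.+1.

Let J_range j : j \in J -> [/\ (0 < j)%N, (j <= N)%N & (j + h <= N)%N].
Proof.
rewrite mem_index_iota ltnS => /andP[j1 j2]; split => //.
  exact: leq_trans j2 (leq_subr _ _).
by rewrite -(subnK (ltnW hN)) leq_add2r.
Qed.

(** Up to powers of the scale a, Q1 to Q4 expand the sum of products of released signs, centered at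
    mu: signal, two mixed terms, pure noise. Q5 and Q6 do so for the released indicators; the factor
    1 in Q6 gives it the shape of a modulated noise sum. *)
Let Q1 w := \sum_(j <- J) (Num.sg (X j%:Z w) * Num.sg (X (j%:Z + h%:Z) w) - mu).
Let Q2 w := \sum_(j <- J) Num.sg (X j%:Z w) * W ((j + h)%N, 2%N) w.
Let Q3 w := \sum_(j <- J) Num.sg (X (j + h)%N%:Z w) * W (j, 2%N) w.
Let Q4 w := \sum_(j <- J) W (j, 2%N) w * W ((j + h)%N, 2%N) w.
Let Q5 w := \sum_(i <- I) ((C0 < `|X i%:Z w|)%R%:R - p).
Let Q6 w := \sum_(i <- I) 1 * W (i, 1%N) w.

Let z := released C0 alpha X W.

Let n0 : 0 < n%:R :> R. Proof. by rewrite ltr0n subn_gt0. Qed.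
Let N0 : 0 < N%:R :> R. Proof. by rewrite ltr0n (leq_trans _ hN). Qed.

Let signalE w : n%:R^-1 * \sum_(1 <= j < n.+1) (z w j).2 * (z w (j + h)%N).2 - mu =
  n%:R^-1 * (Q1 w + a * Q2 w + a * Q3 w + a ^+ 2 * Q4 w).
Proof.
apply: (mulfI (lt0r_neq0 n0)); rewrite mulrBr [n%:R * (n%:R^-1 * _)]mulrA [RHS]mulrA mulfV ?lt0r_neq0// !mul1r.
have -> : n%:R * mu = \sum_(j <- J) mu.
  by rewrite big_const_seq count_predT iter_addr_0 size_iota subn1 mulr_natl.
rewrite -sumrB /Q2 /Q3 /Q4 !mulr_sumr -!big_split/=; apply: eq_bigr => j _.
rewrite /z /released /privatize/= PoszD.
by move: a (Num.sg _) (Num.sg _) (W _ w) (W _ w) mu => b x y u v m; ring.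
Qed.

Let meanE w : N%:R^-1 * \sum_(1 <= i < N.+1) (z w i).1 - p =
  N%:R^-1 * (Q5 w + a * Q6 w).
Proof.
apply: (mulfI (lt0r_neq0 N0)); rewrite mulrBr [N%:R * (N%:R^-1 * _)]mulrA [RHS]mulrA mulfV ?lt0r_neq0// !mul1r.
have -> : N%:R * p = \sum_(i <- I) p.
  by rewrite big_const_seq count_predT iter_addr_0 size_iota subn1 mulr_natl.
rewrite -sumrB /Q6 !mulr_sumr -!big_split/=; apply: eq_bigr => i _.
rewrite /z /released /privatize/=.
by move: a (_%:R) (W _ w) p => b x u m; ring.
Qed.

Let k1 := 8 * (C0 * (pi / 2)) ^+ 2 * n%:R^-1 ^+ 2.
Let k2 := 4 * L ^+ 2 * N%:R^-1 ^+ 2.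

(** A pointwise majorant of the squared error, quadratic in the six sums; its expectation is
    computed term by term. *)
Let G w := k1 * Q1 w ^+ 2 + (k1 * a ^+ 2) * Q2 w ^+ 2 + (k1 * a ^+ 2) * Q3 w ^+ 2 +
  (k1 * a ^+ 4) * Q4 w ^+ 2 + k2 * Q5 w ^+ 2 + (k2 * a ^+ 2) * Q6 w ^+ 2.

Let autocov_tildeE w : autocov_tilde C0 N h (z w) = var_hat C0 N (z w) *
  sin (pi / 2 * (n%:R^-1 * \sum_(1 <= j < n.+1) (z w j).2 * (z w (j + h)%N).2)).
Proof. by rewrite /autocov_tilde; congr (_ * sin _); rewrite mulrA invfM mulrA. Qed.

Let error_le w : `|autocov_tilde C0 N h (z w) - c h%:Z| ^+ 2 <= G w.
Proof.
rewrite autocov_tildeE (autocovE c0 h%:Z).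
apply: le_trans (estimator_error _ (var_hat_bounds hC0 N (z w))
  (var_hat_lipschitz hC0 N (z w) cC) sheppard_mu) _.
rewrite signalE meanE.
set S := _ + a ^+ 2 * _; set U := _ + a * Q6 w.
pose A := 2 * (C0 * (pi / 2)) ^+ 2 * n%:R^-1 ^+ 2; pose B := 2 * L ^+ 2 * N%:R^-1 ^+ 2.
rewrite -/L (_ : _ + _ = A * S ^+ 2 + B * U ^+ 2); last first.
  rewrite /A /B !(exprMn _ n%:R^-1) !(exprMn _ N%:R^-1).
  by move: (_ ^+ 2) (_ ^+ 2) (_ ^+ 2) (_ ^+ 2) => *; ring.
have A0 : 0 <= A by rewrite mulr_ge0 ?sqr_ge0// mulr_ge0 ?sqr_ge0.
have B0 : 0 <= B by rewrite mulr_ge0 ?sqr_ge0// mulr_ge0 ?sqr_ge0.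
apply: le_trans (lerD (ler_wpM2l A0 (sqr_sum4_le _ _ _ _)) (ler_wpM2l B0 (sqr_sum2_le _ _))) _.
rewrite le_eqVlt /G (_ : k1 = 4 * A); last by rewrite /k1 /A; move: (_ ^+ 2) (_ ^+ 2) => u v; ring.
rewrite (_ : k2 = 2 * B); last by rewrite /k2 /B; move: (_ ^+ 2) (_ ^+ 2) => u v; ring.
apply/orP; left; apply/eqP.
by move: A0 B0; move: A B a (Q1 w) (Q2 w) (Q3 w) (Q4 w) (Q5 w) (Q6 w) => *; ring.
Qed.

Let sg1 (x : R) : `|Num.sg x| <= 1.
Proof. by rewrite normr_sg; case: (x != 0). Qed.

Let sigma_sg i : sigma_measurable setT X (fun w => Num.sg (X i w)).
Proof. by apply: (measurableT_comp (@measurable_sg R)); exact: sigma_measurable_RV. Qed.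

Let sizeJ : size J = n. Proof. by rewrite size_iota subn1. Qed.
Let sizeI : size I = N. Proof. by rewrite size_iota subn1. Qed.

Let bound (B : R) (m : nat) (Q : T -> R) :=
  P.-integrable setT (EFin \o (fun w => Q w ^+ 2)) /\ \int[P]_w (Q w ^+ 2) <= m%:R * B.

Let bound1 : bound sign_constant n Q1.
Proof.
rewrite /bound -sizeJ.
exact: (sign_products_sum SG hs Hf c0 (iota_uniq _ _) delta0 gap).
Qed.

Let bound2 : bound m2 n Q2.
Proof.
rewrite /bound -sizeJ; have DJ j : j \in J -> noise_index N ((j + h)%N, 2%N).
  by move=> /J_range[j1 j2 j3]; rewrite /noise_index/= j3 addn_gt0 j1.
split.
- by apply: (modulated_noise_integrable LN DJ (S := fun j w => Num.sg (X j%:Z w))).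
- apply: (modulated_noise_sqr LN (iota_uniq _ _) _ DJ (S := fun j w => Num.sg (X j%:Z w))) => //.
  by move=> j k [] /addIn.
Qed.

Let bound3 : bound m2 n Q3.
Proof.
rewrite /bound -sizeJ; have DJ j : j \in J -> noise_index N (j, 2%N).
  by move=> /J_range[j1 j2 j3]; rewrite /noise_index/= j2 j1.
split.
- by apply: (modulated_noise_integrable LN DJ (S := fun j w => Num.sg (X (j + h)%N%:Z w))).
- apply: (modulated_noise_sqr LN (iota_uniq _ _) _ DJ (S := fun j w => Num.sg (X (j + h)%N%:Z w))) => //.
  by move=> j k [].
Qed.

Let bound4 : bound m4 n Q4.
Proof.
rewrite /bound -sizeJ.
have DJ j : j \in J -> noise_index N (j, 2%N) /\ noise_index N ((j + h)%N, 2%N).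
  by move=> /J_range[j1 j2 j3]; rewrite /noise_index/= j1 j2 j3 addn_gt0 j1.
split.
- exact: (noise_products_integrable LN DJ).
- exact: (noise_products_sqr LN (iota_uniq _ _) h0 DJ).
Qed.

Let bound5 : bound exceed_constant N Q5.
Proof.
rewrite /bound -[N in (N%:R * _)]sizeI.
exact: (exceed_sum SG hs Hf c0 (iota_uniq _ _) (ltW C00)).
Qed.

Let bound6 : bound m2 N Q6.
Proof.
rewrite /bound -[N in (N%:R * _)]sizeI; have DI i : i \in I -> noise_index N (i, 1%N).
  by rewrite mem_index_iota ltnS => iI; rewrite /noise_index/= iI.
have mS (i : nat) : sigma_measurable setT X (fun=> 1) by exact: measurable_cst.
have S1 (i : nat) (w : T) : `|1 : R| <= 1 by rewrite normr1.
split.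
- exact: (modulated_noise_integrable LN DI mS S1).
- by apply: (modulated_noise_sqr LN (iota_uniq _ _) _ DI mS S1) => i j [].
Qed.

Let k1_ge0 : 0 <= k1.
Proof. by rewrite mulr_ge0 ?sqr_ge0// mulr_ge0 ?sqr_ge0. Qed.

Let k2_ge0 : 0 <= k2.
Proof. by rewrite mulr_ge0 ?sqr_ge0// mulr_ge0 ?sqr_ge0. Qed.

Let integrable_G : P.-integrable setT (EFin \o G).
Proof.
case: bound1 bound2 bound3 bound4 bound5 bound6 => [i1 _] [i2 _] [i3 _] [i4 _] [i5 _] [i6 _].
by do 5!(apply: integrableDR; last exact: integrableZ); exact: integrableZ.
Qed.

Let a_ge0 : 0 <= a. Proof. by rewrite divr_ge0// ltW. Qed.

Let expectation_G : \int[P]_w G w <=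
  k1 * n%:R * (sign_constant + 2 * a ^+ 2 * m2 + a ^+ 4 * m4) +
  k2 * N%:R * (exceed_constant + a ^+ 2 * m2).
Proof.
case: bound1 bound2 bound3 bound4 bound5 bound6 => [i1 b1] [i2 b2] [i3 b3] [i4 b4] [i5 b5] [i6 b6].
rewrite RintegralD//; [|by do 4!(apply: integrableDR; last exact: integrableZ); exact: integrableZ|exact: integrableZ].
rewrite RintegralD//; [|by do 3!(apply: integrableDR; last exact: integrableZ); exact: integrableZ|exact: integrableZ].
rewrite RintegralD//; [|by do 2!(apply: integrableDR; last exact: integrableZ); exact: integrableZ|exact: integrableZ].
rewrite RintegralD//; [|by do 1!(apply: integrableDR; last exact: integrableZ); exact: integrableZ|exact: integrableZ].
rewrite RintegralD//; [|exact: integrableZ|exact: integrableZ].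
rewrite !RintegralZl//.
have ka2 : 0 <= k1 * a ^+ 2 by rewrite mulr_ge0// exprn_ge0.
have ka4 : 0 <= k1 * a ^+ 4 by rewrite mulr_ge0// exprn_ge0.
have kb2 : 0 <= k2 * a ^+ 2 by rewrite mulr_ge0// exprn_ge0.
apply: le_trans (lerD (lerD (lerD (lerD (lerD (ler_wpM2l k1_ge0 b1) (ler_wpM2l ka2 b2))
  (ler_wpM2l ka2 b3)) (ler_wpM2l ka4 b4)) (ler_wpM2l k2_ge0 b5)) (ler_wpM2l kb2 b6)) _.
rewrite le_eqVlt; apply/orP; left; apply/eqP.
move: {ka2 ka4 kb2 b1 b2 b3 b4 b5 b6 i1 i2 i3 i4 i5 i6} k1 k2 n%:R N%:R (a ^+ 2) (a ^+ 4).
by move: sign_constant exceed_constant m2 m4 => *; ring.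
Qed.

Let q := Num.min (alpha ^+ 4) 1.

Let q_gt0 : 0 < q. Proof. by rewrite lt_min exprn_gt0//=. Qed.

Let q_le1 : q <= 1. Proof. by rewrite ge_min lexx orbT. Qed.

(** min (alpha^4, 1) is also at most alpha^2, so noise terms of order alpha^-2 fit into the rate. *)
Let a2q : a ^+ 2 * q <= 9.
Proof.
rewrite expr_div_n mulrAC ler_pdivrMr ?exprn_gt0//.
rewrite (_ : 3 ^+ 2 = 9 :> R); last by rewrite -natrX.
rewrite ler_pM2l//; have [a1|a1] := leP alpha 1.
  by apply: (@le_trans _ _ (alpha ^+ 4)); rewrite ?ge_min ?lexx// ler_wiXn2l// ltW.
by apply: (le_trans q_le1); rewrite exprn_ege1// ltW.
Qed.

Let a4q : a ^+ 4 * q <= 81.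
Proof.
rewrite expr_div_n mulrAC ler_pdivrMr ?exprn_gt0//.
rewrite (_ : 3 ^+ 4 = 81 :> R); last by rewrite -natrX.
by rewrite ler_pM2l// ge_min lexx.
Qed.

Let moment_ge0 k : ~~ odd k -> 0 <= (laplace_moment k : R).
Proof.
move=> k_even; apply: Rintegral_ge0 => x _.
by rewrite mulr_ge0 ?laplace_pdf_ge0// exprn_even_ge0.
Qed.

Let sign_constant_ge0 : 0 <= sign_constant.
Proof.
apply: mulr_ge0; first exact: divr_ge0 (ler0n _ _) (exprn_ge0 _ (ltW delta0)).
by rewrite mulr_ge0 ?addr_ge0 ?sqr_ge0.
Qed.

Let exceed_constant_ge0 : 0 <= exceed_constant.
Proof. by rewrite mulr_ge0 ?addr_ge0 ?sqr_ge0. Qed.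

Lemma rate_constant_ge0 : 0 <= rate_constant.
Proof.
have := moment_ge0 (isT : ~~ odd 2); have := moment_ge0 (isT : ~~ odd 4) => ? ?.
apply: addr_ge0; apply: mulr_ge0.
- by apply: mulr_ge0; rewrite ?sqr_ge0.
- by apply: addr_ge0; [apply: addr_ge0|] => //; apply: mulr_ge0.
- by apply: mulr_ge0; rewrite ?sqr_ge0.
- by apply: addr_ge0 => //; apply: mulr_ge0.
Qed.

Let expectation_G_rate : \int[P]_w G w <= rate_constant / (q * n%:R).
Proof.
apply: le_trans expectation_G _; rewrite ler_pdivlMr ?mulr_gt0// mulrDl.
have m2_ge0 := moment_ge0 (isT : ~~ odd 2); have m4_ge0 := moment_ge0 (isT : ~~ odd 4).
apply: lerD.
  rewrite [leLHS](_ : _ = 8 * (C0 * (pi / 2)) ^+ 2 *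
      (q * sign_constant + 2 * (a ^+ 2 * q) * m2 + a ^+ 4 * q * m4)); last first.
    rewrite /k1; have := lt0r_neq0 n0; move: ((C0 * (pi / 2)) ^+ 2) n%:R q (a ^+ 2) (a ^+ 4).
    by move: sign_constant m2 m4 => s1 s2 s4 A x u b2 b4 x0; field.
  apply: ler_wpM2l; first by apply: mulr_ge0; rewrite ?sqr_ge0.
  apply: lerD; first apply: lerD.
  - by rewrite ler_piMl.
  - by rewrite ler_wpM2r//; have := a2q; move: (_ * q) => y; lra.
  - by rewrite ler_wpM2r.
(* The indicators are averaged over all N observations, and N >= N - h, so this part meets the rate
   with room to spare. *)
apply: (@le_trans _ _ (k2 * N%:R * (exceed_constant + a ^+ 2 * m2) * (q * N%:R))).
  rewrite ler_wpM2l//.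
    by apply: mulr_ge0; [apply: mulr_ge0|apply: addr_ge0 => //; apply: mulr_ge0; rewrite ?sqr_ge0] => //; exact: ltW.
  by rewrite ler_wpM2l ?(ltW q_gt0)// ler_nat leq_subr.
rewrite [leLHS](_ : _ = 4 * L ^+ 2 * (q * exceed_constant + a ^+ 2 * q * m2)); last first.
  rewrite /k2; have := lt0r_neq0 N0; move: (L ^+ 2) N%:R q (a ^+ 2).
  by move: exceed_constant m2 => s1 s2 A x u b2 x0; field.
apply: ler_wpM2l; first by apply: mulr_ge0; rewrite ?sqr_ge0.
apply: lerD.
- by rewrite ler_piMl.
- by rewrite ler_wpM2r.
Qed.

Let rho_le1 : `|rho h%:Z| <= 1.
Proof. by rewrite -sheppard_mu ler_norml sin_geN1 sin_le1. Qed.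

Let error_bounded w : `|autocov_tilde C0 N h (z w) - c h%:Z| ^+ 2 <= 4 * C0 ^+ 2.
Proof.
rewrite (_ : 4 * C0 ^+ 2 = (C0 + C0) ^+ 2); last by ring.
rewrite lerXn2r ?nnegrE ?addr_ge0 ?(ltW C00)//.
apply: le_trans (ler_normB _ _) _; apply: lerD.
  rewrite autocov_tildeE normrM; case/andP: (var_hat_bounds hC0 N (z w)) => v0 vC.
  rewrite (ger0_norm v0) -[leRHS]mulr1 ler_pM// ler_norml sin_geN1.
  by rewrite sin_le1.
rewrite (autocovE c0) normrM gtr0_norm// -[leRHS]mulr1 ler_pM ?(ltW c0)//.
by case/andP: cC.
Qed.

(** Pointwise domination by [G] gives the rate and domination by 4 C0^2 the factor 1 in the minimum;
    the sum of the two constants covers whichever is attained. *)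
Lemma mean_square_error_le :
  ('E_P[(fun w => `|autocov_tilde C0 N h (z w) - c h%:Z| ^+ 2)%R] <=
   ((rate_constant + 4 * C0 ^+ 2) * Num.min 1 (q * n%:R)^-1)%:E)%E.
Proof.
have e0 w : (0 <= (`|autocov_tilde C0 N h (z w) - c h%:Z| ^+ 2)%:E)%E.
  by rewrite lee_fin exprn_ge0.
rewrite unlock; set E := (\int[P]_w _)%E.
have E1 : (E <= (\int[P]_w G w)%:E)%E.
  rewrite /Rintegral fineK; last exact: integrable_fin_num.
  by apply: integral_dominated_le => // w; rewrite lee_fin.
have E2 : (E <= (4 * C0 ^+ 2)%:E)%E.
  rewrite -[X in X%:E](Rintegral_prob_cst P) /Rintegral fineK; last first.
    by apply: integrable_fin_num => //; exact: finite_measure_integrable_cst.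
  by apply: integral_dominated_le => // w; rewrite lee_fin.
have E0 : (0 <= E)%E by exact: integral_ge0.
have Efin : E \is a fin_num by rewrite ge0_fin_numE// (le_lt_trans E2)// ltry.
rewrite -(fineK Efin) lee_fin; rewrite -(fineK Efin) !lee_fin in E1 E2.
apply: truncated_rate => //.
- exact: rate_constant_ge0.
- by rewrite mulr_ge0 ?sqr_ge0.
- exact: le_trans expectation_G_rate.
Qed.
End MeanSquareError.

Theorem proposition3 (R : realType) (C0 C1 s : R)
    (hC0 : 1 <= C0) (hC1 : 0 < C1) (hs : 1 / 2 < s) :
  exists C : R,
    forall (N : nat) (alpha : R) (h : nat),
      (2 <= N)%N -> 0 < alpha -> (1 <= h <= N - 1)%N ->
    forall f : R -> R, smoothness_class C0 C1 s f ->
    forall (d : measure_display) (T : measurableType d) (P : probability T R)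
      (X : int -> {RV P >-> R}) (W : nat * nat -> {RV P >-> R}),
      stationary_gaussian f X -> laplace_noise N X W ->
    ('E_P[(fun w : T =>
             `|autocov_tilde C0 N h (released C0 alpha X W w)
               - autocov f h%:Z| ^+ 2)%R]
     <= (C * Num.min 1 (Num.min (alpha ^+ 4) 1 * (N - h)%:R)^-1)%:E)%E.
Proof.
(* M depends on C1 alone, so the gap and the constant are fixed before N, alpha, h and f. *)
pose M := Num.bound (4 * C1 ^+ 2).
have hM : 4 * C1 ^+ 2 < M%:R by apply: archi_boundP; rewrite mulr_ge0 ?sqr_ge0.
exists (rate_constant C0 C1 M + 4 * C0 ^+ 2).
move=> N alpha h N2 alpha0 /andP[h0 hN] f Hf d T P X W SG LN.
apply: (mean_square_error_le hC0 hs alpha0 h0 _ hM Hf SG LN).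
by rewrite (leq_ltn_trans hN)// subn1 ltn_predL (leq_trans _ N2).
Qed.
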